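(* Consider the TASEP in $\mathcal X_N(L)$ started from $(\mathbf x_1(0),\dots,\mathbf x_N(0))=Y=(y_1,\dots,y_N)\in\mathcal X_N(L)$. Fix a positive integer $m$, let $(k_1,t_1),\dots,(k_m,t_m)$ be $m$ distinct points in $\{1,\dots,N\}\times[0,\infty)$ with $0\le t_1\le\cdots\le t_m$, and let $a_1,\dots,a_m\in\mathbb Z$. Then $$\mathbb P_Y\big(\mathbf x_{k_1}(t_1)\ge a_1,\dots,\mathbf x_{k_m}(t_m)\ge a_m\big)=\oint\cdots\oint \mathcal C(\mathbf z,\mathbf k)\,\mathcal D_Y(\mathbf z,\mathbf k,\mathbf a,\mathbf t)\,\frac{dz_m}{2\pi i z_m}\cdots\frac{dz_1}{2\pi i z_1},$$ where the contours are nested (counterclockwise, centered at $0$) circles with $0<|z_m|<\cdots<|z_1|$, $\mathbf z=(z_1,\dots,z_m)$, $\mathbf k=(k_1,\dots,k_m)$, $\mathbf a=(a_1,\dots,a_m)$, $\mathbf t=(t_1,\dots,t_m)$, and $$\mathcal C(\mathbf z,\mathbf k)=(-1)^{m-1}(-1)^{(k_m-1)(N+1)}z_1^{(k_1-1)L}\prod_{\ell=2}^m\left[z_\ell^{(k_\ell-k_{\ell-1})L}\left(\left(\frac{z_\ell}{z_{\ell-1}}\right)^L-1\right)^{N-1}\right],$$ $$\mathcal D_Y(\mathbf z,\mathbf k,\mathbf a,\mathbf t)=\det\left[\sum_{w_1\in\mathcal R_{z_1},\dots,w_m\in\mathcal R_{z_m}}\frac{w_1^i(w_1+1)^{y_i-i}w_m^{-j}}{\prod_{\ell=2}^m(w_\ell-w_{\ell-1})}\prod_{\ell=1}^m\mathcal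 G_\ell(w_\ell)\right]_{i,j=1}^N,$$ $$\mathcal G_\ell(w)=\frac{w(w+1)}{L(w+\rho)}\cdot\frac{w^{-k_\ell}(w+1)^{-a_\ell+k_\ell}e^{t_\ell w}}{w^{-k_{\ell-1}}(w+1)^{-a_{\ell-1}+k_{\ell-1}}e^{t_{\ell-1}w}},\qquad t_0=k_0=a_0=0.$$
   Context: Let $1\le N<L$ be integers and $\rho=N/L$. Configuration space: $\mathcal X_N(L)=\{(x_1,\dots,x_N)\in\mathbb Z^N:x_1<x_2<\cdots<x_N<x_1+L\}$. The TASEP in $\mathcal X_N(L)$ is the continuous-time Markov process $(\mathbf x_1(t),\dots,\mathbf x_N(t))$ on $\mathcal X_N(L)$ in which each particle independently attempts to jump one step to the right at rate $1$, the jump being suppressed if the resulting configuration is not in $\mathcal X_N(L)$ (usual TASEP exclusion plus $\mathbf x_N(t)<\mathbf x_1(t)+L$). $\mathbb P_Y$ is the law of the process started from $Y$. For $z\in\mathbb C$, $q_z(w)=w^N(w+1)^{L-N}-z^L$ and $\mathcal R_z=\{w\in\mathbb C:q_z(w)=0\}$. For $z\neq0$ the roots are simple and different from $0,-1$, except when $w=-\rho$ is a (double) root; at the finitely many such points of a contour the entries of the determinant are understood through their analytic extension in $z_\ell$. *)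

(* Defs.v *)
From HB Require Import structures.
From mathcomp Require Import all_boot all_order all_algebra.
From mathcomp Require Import complex.
From mathcomp Require Import all_classical all_reals all_analysis.

Set Implicit Arguments.
Unset Strict Implicit.
Unset Printing Implicit Defensive.

Import Order.TTheory GRing.Theory Num.Theory.
Import numFieldTopology.Exports numFieldNormedType.Exports.

Local Open Scope classical_set_scope.
Local Open Scope ring_scope.

Section Process.
Context {R : realType} {N L : nat}.

(* x_1 < ... < x_N < x_1 + L; coordinates are indexed from 0. *)
Definition in_conf (x : {ffun 'I_N -> int}) : bool :=
  [forall i : 'I_N, forall j : 'I_N, (i < j)%N ==> (x i < x j)] &&
  [forall i : 'I_N, forall j : 'I_N,
     (i == 0%N :> nat) && (j.+1 == N :> nat) ==> (x j < x i + L%:Z)].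

Definition conf := {x : {ffun 'I_N -> int} | in_conf x}.

Definition jump (x : {ffun 'I_N -> int}) (i : 'I_N) : {ffun 'I_N -> int} :=
  [ffun j => x j + (j == i)%:Z].

(* [insubd] falls back on [x] itself when the jump leaves the state space. *)
Definition attempt (x : conf) (i : 'I_N) : conf := insubd x (jump (val x) i).

Definition tasep_generator (f : conf -> R) (x : conf) : R :=
  \sum_(i < N) (f (attempt x i) - f x).

Definition qrate (x y : conf) : R := tasep_generator (fun x' => (x' == y)%:R) x.

Record tasep_transition (p : R -> conf -> conf -> R) : Prop := {
  transition_ge0 : forall (t : R) x y, 0 <= t -> 0 <= p t x y;
  transition_sum : forall (t : R) x, 0 <= t ->
    (\esum_(y in [set: conf]) (p t x y)%:E)%E = 1%E;
  transition_init : forall x y, p 0 x y = (x == y)%:R;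
  transition_semigroup : forall (s t : R) x y, 0 <= s -> 0 <= t ->
    (p (s + t) x y)%:E = (\esum_(z in [set: conf]) (p s x z * p t z y)%:E)%E;
  transition_rate : forall x y,
    (p h x y - (x == y)%:R) / h @[h --> 0^'+] --> qrate x y }.

(* The events fixing finitely many past values form a pi-system generating the
   natural filtration, so [tasep_markov] is the Markov property with respect
   to that filtration. *)
Record is_tasep d (T : measurableType d) (P : probability T R) (Y : conf)
    (X : R -> T -> conf) : Prop := {
  tasep_measurable : forall (t : R) x, 0 <= t -> measurable [set w | X t w = x];
  tasep_init : P [set w | X 0 w = Y] = 1%E;
  tasep_markov : exists2 p, tasep_transition p &
    forall (n : nat) (s : 'I_n -> R) (c : 'I_n -> conf) (t h : R) (x y : conf),
      (forall i, 0 <= s i <= t) -> 0 <= t -> 0 <= h ->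
      P [set w | (forall i, X (s i) w = c i) /\ X t w = x /\ X (t + h) w = y]
      = (P [set w | (forall i, X (s i) w = c i) /\ X t w = x]
         * (p h x y)%:E)%E }.

End Process.

Arguments conf : clear implicits.

Section ComplexAnalysis.
Variable R : realType.

(* The complex numbers with the topology given by the norm. *)
Definition Cplx : numClosedFieldType := R[i]%C.

Definition cexp (w : Cplx) : Cplx :=
  ((expR (complex.Re w))%:C%C : Cplx) *
  (cos (complex.Im w) +i* sin (complex.Im w))%C.

Definition cintegral (a b : R) (f : R -> Cplx) : Cplx :=
  ((\int[lebesgue_measure]_(x in `[a, b]) complex.Re (f x))
   +i* (\int[lebesgue_measure]_(x in `[a, b]) complex.Im (f x)))%C.

Definition circle (r theta : R) : Cplx := ((r%:C)%C : Cplx) * cexp (theta *i)%C.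

(* Integral of f(z) dz over |z| = r, counterclockwise. *)
Definition oint (r : R) (f : Cplx -> Cplx) : Cplx :=
  cintegral 0 (2 * pi)
    (fun theta => f (circle r theta) * (('i%C : Cplx) * circle r theta)).

(* Iterated integral of f(z) dz_m/(2 pi i z_m) ... dz_1/(2 pi i z_1) over the
   circles |z_l| = r_l, the integral over z_m being the innermost one. *)
Fixpoint ointn (m : nat) :
    ('I_m -> R) -> ('rV[Cplx]_m -> Cplx) -> Cplx :=
  if m is m'.+1 then fun r f =>
    oint (r ord0) (fun z =>
      ointn (fun l => r (lift ord0 l))
            (fun zs => f (row_mx (const_mx z : 'rV_1) zs))
      / ((((2 * pi) *i)%C : Cplx) * z))
  else fun _ f => f 0.

End ComplexAnalysis.

Section Formula.
Variables (R : realType) (N L : nat).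
Local Notation C := (Cplx R).

Definition rho : C := N%:R / L%:R.

Definition qpoly (z w : C) : C := w ^+ N * (w + 1) ^+ (L - N) - z ^+ L.

Definition rootset (z : C) : set C := [set w | qpoly z w = 0].

(* There are n.+1 points, indexed by 'I_n.+1; [k l] is in {1, ..., N}. *)
Variable n : nat.
Implicit Types (z : 'rV[C]_n.+1) (w : {ffun 'I_n.+1 -> C}) (l : 'I_n.+1).

Definition predo l : 'I_n.+1 := inord l.-1.

Definition prevval (V : nmodType) (f : 'I_n.+1 -> V) l : V :=
  if l == 0%N :> nat then 0 else f (predo l).

Variables (Y : conf N L) (k : 'I_n.+1 -> nat) (a : 'I_n.+1 -> int)
  (t : 'I_n.+1 -> R).

Definition calC z : C :=
  (-1) ^+ n * (-1) ^+ ((k ord_max - 1) * N.+1) *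
  z 0 ord0 ^+ ((k ord0 - 1) * L) *
  \prod_(l < n.+1 | (0 < l)%N)
    (z 0 l ^ (((k l)%:Z - (k (predo l))%:Z) * L%:Z) *
     ((z 0 l / z 0 (predo l)) ^+ L - 1) ^+ (N - 1)).

Definition gfun (k0 : nat) (a0 : int) (t0 : R) (v : C) : C :=
  v ^- k0 * (v + 1) ^ (- a0 + k0%:Z) * cexp (((t0%:C)%C : C) * v).

Definition calG l (v : C) : C :=
  v * (v + 1) / (L%:R * (v + rho)) *
  (gfun (k l) (a l) (t l) v / gfun (prevval k l) (prevval a l) (prevval t l) v).

(* The sum over w_1, ..., w_m; [i] and [j] are the indices shifted by one. *)
Definition rawD (i j : 'I_N) z : C :=
  \sum_(w \in [set w | forall l, rootset (z 0 l) (w l)])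
    (w ord0 ^+ i.+1 * (w ord0 + 1) ^ (val Y i - i.+1%:Z) * w ord_max ^- j.+1
     / (\prod_(l < n.+1 | (0 < l)%N) (w l - w (predo l)))
     * \prod_(l < n.+1) calG l (w l)).

(* -rho is the only possible multiple root, and there the summand has a
   vanishing denominator. *)
Definition regular : set 'rV[C]_n.+1 :=
  [set z | forall l, ~ rootset (z 0 l) (- rho)].

Definition entryD (i j : 'I_N) z : C :=
  if `[< regular z >] then rawD i j z
  else lim (rawD i j z' @[z' --> within regular (nbhs z)]).

Definition calD z : C := \det (\matrix_(i < N, j < N) entryD i j z).

End Formula.

(* Main.v *)
(* Put p(w) = w^N (w+1)^(L-N) and Z = z^L. A sum of f(w) w(w+1)/(L(w+rho)) over
   the roots of p = Z is Z times the sum of f(w)/p'(w), and for polynomial f the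
   latter is the coefficient of w^(L-1) in f mod (p - Z); this is polynomial in Z
   and makes sense at multiple roots. Since 1/(w'-w) = H(w,w')/(Z'-Z) with
   H(w,w') = (p(w')-p(w))/(w'-w), the sums over w_1, ..., w_m decouple, and the
   integrand becomes an explicit prefactor times
   det(U_1 H T_2 H ... T_m Hfin), where only U_1 depends on Y and t_1.
   As a function of t_1 and Y, with the other time increments fixed, the integral
   solves the backward equation of TASEP: differentiation multiplies a row of U_1
   by w = (w+1) - 1, the difference of the rows after and before a jump, and a
   blocked jump does not change the determinant, because it adds to a row another
   one (Z times another one for the last particle). The integral grows at most
   exponentially in Y, which gives uniqueness. At t_1 = 0 the rows
   of U_1 expand in powers of Z_1 or of 1/Z_1; so the integral over z_1 vanishes
   when y_{k_1} < a_1, and it otherwise reproduces the formula for the remaining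
   m-1 points, since H is the inverse Gram matrix of the residue form. The theorem
   follows by induction on m and the Markov property. *)
Require Import Defs.
From HB Require Import structures.
From mathcomp Require Import all_boot all_order all_algebra.
From mathcomp Require Import complex.
From mathcomp Require Import all_classical all_reals all_analysis.
From mathcomp Require Import fingroup perm separable ring lra zify.

Set Implicit Arguments.
Unset Strict Implicit.
Unset Printing Implicit Defensive.

Import Order.TTheory GRing.Theory Num.Theory.
Import numFieldTopology.Exports numFieldNormedType.Exports.

Local Open Scope classical_set_scope.
Local Open Scope ring_scope.

(** * The residue functional of a polynomial *)

(** Each decoupled entry carries the product of the 1 / (Z_l / Z_(l-1) - 1), so the determinant
    carries its [N]-th power; the power [N - 1] in [calC] leaves, up to sign, one factor 1 / (1 -
    Z_l / Z_(l-1)) per pair. Nested contours make it a geometric series, and integrating it over z_1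
    against Z_1^e gives Z_2^e for e >= 0 and 0 for e < 0: it substitutes Z_2 for Z_1. Hence the only
    contour integrals ever evaluated are means of integer powers of z over a circle. The state space
    is infinite, and the transition function is only given right derivatives at time zero, pointwise
    in the target state. Time derivatives are therefore replaced by first-order expansions with
    explicit remainders, and uniqueness is obtained by Euler steps in a space weighted by an
    exponential of the positions, on which the generator is bounded. Regularity on the contours is
    stated as boundedness and uniform continuity: this passes to iterated integrals, and on slightly
    thickened contours it yields the limits that define the entries where -rho is a root. *)

Section ResidueFunctional.
Variable F : fieldType.
Implicit Types (P Q q : {poly F}).

(* For monic [q] with simple roots, the sum of [P(w) / q'(w)] over these roots. *)
Definition topc q P : F := (P %% q)`_(size q).-2.

Lemma topcD q P Q : topc q (P + Q) = topc q P + topc q Q.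
Proof. by rewrite /topc modpD coefD. Qed.

Lemma topcZ q c P : topc q (c *: P) = c * topc q P.
Proof. by rewrite /topc modpZl coefZ. Qed.

Lemma topc0 q : topc q 0 = 0.
Proof. by rewrite /topc mod0p coef0. Qed.

Lemma topc_sum q I (r : seq I) (A : pred I) (G : I -> {poly F}) :
  topc q (\sum_(i <- r | A i) G i) = \sum_(i <- r | A i) topc q (G i).
Proof. exact: (big_morph _ (topcD q) (topc0 q)). Qed.

Lemma topc_mull q P : topc q (q * P) = 0.
Proof. by rewrite /topc modp_mulr coef0. Qed.

(** Lagrange interpolation: [P %% q] is determined by its values on [rs], and the basis polynomial q
    / ((X - w) q'(w)) has leading coefficient 1 / q'(w) in degree [size rs - 1]. *)
Lemma topc_lagrange q (rs : seq F) P : q \is monic ->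
    uniq rs -> all (root q) rs -> size q = (size rs).+1 ->
  topc q P = \sum_(w <- rs) P.[w] / q^`().[w].
Proof.
move=> qm urs ars sq.
have q0 : q != 0 by apply: monic_neq0.
have quo w : w \in rs -> q = (q %/ ('X - w%:P)) * ('X - w%:P).
  by move=> wr; rewrite divpK // dvdp_XsubCl (allP ars).
have squo w : w \in rs -> size (q %/ ('X - w%:P)) = size rs.
  by move=> wr; rewrite size_divp ?polyXsubC_eq0 // size_XsubC sq subSS subn0.
have dq w : w \in rs -> (q %/ ('X - w%:P)).[w] = q^`().[w].
  move=> wr; rewrite {2}(quo _ wr) derivM derivXsubC mulr1 hornerD hornerM.
  by rewrite hornerXsubC subrr mulr0 add0r.
have dq0 w : w \in rs -> q^`().[w] != 0.
  move=> wr; rewrite -dq //.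
  have -> : q = \prod_(v <- rs) ('X - v%:P).
    rewrite [LHS](all_roots_prod_XsubC sq ars) ?uniq_rootsE //.
    by rewrite (monicP qm) scale1r.
  rewrite (perm_big _ (perm_to_rem wr)) big_cons /= mulrC mulpK ?polyXsubC_eq0 //.
  rewrite -rootE root_prod_XsubC; apply/negP => wr'.
  by rewrite (rem_filter _ urs) mem_filter /= eqxx in wr'.
set R := P %% q.
have PR w : w \in rs -> P.[w] = R.[w].
  move=> wr; rewrite {1}(divp_eq P q) hornerD hornerM.
  by have /eqP -> := allP ars _ wr; rewrite mulr0 add0r.
pose I := \sum_(w <- rs) (R.[w] / q^`().[w]) *: (q %/ ('X - w%:P)).
have RI : R = I.
  apply/eqP; rewrite -subr_eq0; apply/eqP.
  apply: (@roots_geq_poly_eq0 F _ rs) => //.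
  - apply/allP => w wr; rewrite rootE hornerD hornerN subr_eq0 /I horner_sum.
    rewrite (bigD1_seq w) //= big1_seq ?addr0; last first.
      move=> v /andP[vw vr]; rewrite hornerZ.
      have /eqP : q.[w] = 0 by apply/eqP/(allP ars).
      rewrite {1}(quo _ vr) hornerM hornerXsubC mulf_eq0 subr_eq0.
      by rewrite [w == v]eq_sym (negPf vw) orbF => /eqP ->; rewrite mulr0.
    by rewrite hornerZ dq // divfK // dq0.
  - rewrite -ltnS -sq; apply: (leq_ltn_trans (size_polyD _ _)).
    rewrite size_polyN gtn_max ltn_modp q0 sq ltnS.
    apply: (leq_trans (size_sum _ _ _)).
    rewrite big_seq; elim/big_ind: _ => // [x y hx hy|w wr].
      by rewrite geq_max hx.
    by apply: (leq_trans (size_scale_leq _ _)); rewrite squo.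
rewrite /topc -/R {1}RI coef_sum big_seq [RHS]big_seq.
apply: eq_bigr => w wr; rewrite coefZ PR // sq /=.
have -> : (q %/ ('X - w%:P))`_(size rs).-1 = 1; last by rewrite mulr1.
rewrite -(squo _ wr) -lead_coefE.
have /eqP := monicP qm; rewrite {1}(quo _ wr) lead_coefM lead_coefXsubC mulr1.
by move/eqP.
Qed.

Lemma drop_polyS a P : drop_poly a P = (P`_a)%:P + 'X * drop_poly a.+1 P.
Proof.
apply/polyP => i; rewrite coefD coefC coefXM !coef_drop_poly.
by case: i => [|i] /=; rewrite ?addr0 ?add0r // addSnnS.
Qed.

Section Level.
Variables (p : {poly F}) (L : nat).
Hypotheses (L_gt0 : (0 < L)%N) (p_monic : p \is monic) (size_p : size p = L.+1).

(** [p - Z] and [p] have the same derivative, so at simple roots this is the sum of P(w) / p'(w)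
    over the fibre p(w) = Z. *)
Definition lam Z P : F := topc (p - Z%:P) P.

Let size_q Z : size (p - Z%:P) = L.+1.
Proof.
rewrite size_polyDl ?size_p // size_polyN.
by apply: (leq_ltn_trans (size_polyC_leq1 _)); rewrite ltnS.
Qed.

Let monic_q Z : p - Z%:P \is monic.
Proof.
rewrite monicE lead_coefDl ?size_p ?size_polyN; first by rewrite (monicP p_monic).
by apply: (leq_ltn_trans (size_polyC_leq1 _)); rewrite ltnS.
Qed.

Lemma lamD Z P Q : lam Z (P + Q) = lam Z P + lam Z Q.
Proof. exact: topcD. Qed.

Lemma lamZ Z c P : lam Z (c *: P) = c * lam Z P.
Proof. exact: topcZ. Qed.

Lemma lamN Z P : lam Z (- P) = - lam Z P.
Proof. by rewrite -scaleN1r lamZ mulN1r. Qed.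

Lemma lam_sum Z I (r : seq I) (A : pred I) (G : I -> {poly F}) :
  lam Z (\sum_(i <- r | A i) G i) = \sum_(i <- r | A i) lam Z (G i).
Proof. exact: topc_sum. Qed.

Lemma lam_mulp Z P : lam Z (p * P) = Z * lam Z P.
Proof.
have -> : p * P = (p - Z%:P) * P + Z *: P.
  by rewrite mulrBl mul_polyC subrK.
by rewrite lamD lamZ /lam topc_mull add0r.
Qed.

Lemma lam_small Z P : (size P <= L)%N -> lam Z P = P`_L.-1.
Proof. by move=> sP; rewrite /lam /topc modp_small size_q ?ltnS. Qed.

Lemma lam_modq Z P Q : lam Z (P * (Q %% (p - Z%:P))) = lam Z (P * Q).
Proof.
rewrite [in RHS](divp_eq Q (p - Z%:P)) mulrDr lamD [X in _ = X + _](_ : _ = 0).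
  by rewrite add0r.
by rewrite mulrA mulrC /lam topc_mull.
Qed.

Lemma lam_lagrange Z (rs : seq F) P : uniq rs -> all (root (p - Z%:P)) rs ->
    size rs = L ->
  lam Z P = \sum_(w <- rs) P.[w] / p^`().[w].
Proof.
move=> urs ars srs; rewrite /lam (topc_lagrange _ (monic_q Z) urs ars) ?size_q ?srs //.
by rewrite derivB derivC subr0.
Qed.

(** The expansion of [P] in base [p] has digits of degree less than [L]; this is the coefficient of
    degree [L - 1] of the [n]-th digit. *)
Fixpoint lamc n P : F := if n is n'.+1 then lamc n' (P %/ p) else (P %% p)`_L.-1.

Let size_divpp P : size (P %/ p) = (size P - L)%N.
Proof. by rewrite size_divp ?monic_neq0 // size_p. Qed.

Lemma lamc_small n P : (size P <= n * L + L.-1)%N -> lamc n P = 0.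
Proof.
elim: n P => [|n IH] P /=.
  rewrite mul0n add0n => sP.
  rewrite nth_default //; apply: leq_trans sP.
  by apply: leq_modp.
by rewrite mulSn -addnA => sP; apply: IH; rewrite size_divpp leq_subLR.
Qed.

(** Under [lam Z] a factor [p] becomes [Z], so the base-[p] expansion of [P] becomes a polynomial in
    [Z]. *)
Lemma lam_expand Z d P : (size P <= d * L)%N ->
  lam Z P = \sum_(n < d) lamc n P * Z ^+ n.
Proof.
elim: d P => [|d IH] P sP.
  rewrite big_ord0; move: sP; rewrite mul0n leqn0 size_poly_eq0 => /eqP ->.
  exact: topc0.
rewrite big_ord_recl /= expr0 mulr1 {1}(divp_eq P p) lamD mulrC lam_mulp.
rewrite IH ?size_divpp ?leq_subLR -?mulSn // addrC; congr (_ + _).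
  rewrite lam_small //.
  by rewrite -ltnS -size_p ltn_modp monic_neq0.
by rewrite mulr_sumr; apply: eq_bigr => i _; rewrite exprS mulrCA.
Qed.

(** Summation by parts, from [drop_poly a p] = p_a + X [drop_poly a.+1 p]. It serves twice: g(a) =
    y^a yields the divided difference of [p], and the moments g(a) = [lam Z ('X^a * P)] yield the
    dual basis. *)
Lemma drop_poly_tele (g : nat -> F) :
  \sum_(a < L) (g a.+1 *: drop_poly a.+1 p - g a *: ('X * drop_poly a.+1 p))
  = (\sum_(a < L.+1) p`_a * g a)%:P - g 0%N *: p.
Proof.
have dropL : drop_poly L p = (p`_L)%:P.
  rewrite drop_polyS drop_poly_eq0 ?size_p // mulr0 addr0 //.
rewrite (eq_bigr (fun a : 'I_L => (g a.+1 *: drop_poly a.+1 p - g a *: drop_poly a p)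
                     + (p`_a * g a)%:P)); last first.
  move=> a _; rewrite [drop_poly a p]drop_polyS scalerDr.
  by rewrite -[g a *: _%:P]mul_polyC -polyCM [p`_a * _]mulrC; ring.
rewrite big_split /= -(big_mkord xpredT
  (fun a => g a.+1 *: drop_poly a.+1 p - g a *: drop_poly a p)) telescope_sumr //.
rewrite dropL drop_poly0l big_ord_recr /= polyCD raddf_sum /=.
by rewrite -mul_polyC -polyCM [g L * _]mulrC; ring.
Qed.

Lemma hankel_horner x y :
  (y - x) * (\sum_(c < L) \sum_(a < L) x ^+ c * p`_(a + c).+1 * y ^+ a)
  = p.[y] - p.[x].
Proof.
have E (a : 'I_L) : (drop_poly a.+1 p).[x] = \sum_(c < L) x ^+ c * p`_(a + c).+1.
  rewrite (@horner_coef_wide _ L).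
    by apply: eq_bigr => c _; rewrite coef_drop_poly mulrC addnS addnC.
  by rewrite size_drop_poly size_p leq_subLR addSn ltnS leq_addl.
have := congr1 (fun P => P.[x]) (drop_poly_tele (fun a => y ^+ a)).
rewrite hornerD hornerC hornerN hornerZ expr0 mul1r horner_sum.
rewrite (@horner_coef_wide _ L.+1 p y) ?size_p // => <-.
rewrite exchange_big /= mulr_sumr; apply: eq_bigr => a _.
rewrite hornerD hornerN !hornerZ hornerM hornerX E -mulr_suml mulrA exprS.
ring.
Qed.

(** The polynomials [drop_poly a.+1 p] are the basis dual to the monomials. The left-hand side [D]
    is linear in [Q], fixes 1, and commutes with multiplication by X modulo [q], so it agrees with
    reduction modulo [q] on every monomial. *)
Lemma lam_dual Z Q :
  \sum_(a < L) lam Z ('X^a * Q) *: drop_poly a.+1 p = Q %% (p - Z%:P).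
Proof.
pose q : {poly F} := p - Z%:P; rewrite -/q.
pose D Q : {poly F} := \sum_(a < L) lam Z ('X^a * Q) *: drop_poly a.+1 p.
have D0 : D 0 = 0.
  by rewrite /D big1 // => a _; rewrite mulr0 /lam topc0 scale0r.
have DD P1 P2 : D (P1 + P2) = D P1 + D P2.
  rewrite /D -big_split; apply: eq_bigr => a _.
  by rewrite mulrDr lamD scalerDl.
have DZ c P1 : D (c *: P1) = c *: D P1.
  rewrite /D scaler_sumr; apply: eq_bigr => a _.
  by rewrite -scalerAr lamZ scalerA.
have sD P1 : (size (D P1) < size q)%N.
  rewrite size_q ltnS; apply: (leq_trans (size_sum _ _ _)).
  elim/big_ind: _ => // [x y hx hy|a _]; first by rewrite geq_max hx.
  apply: (leq_trans (size_scale_leq _ _)).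
  by rewrite size_drop_poly size_p leq_subLR addSn ltnS leq_addl.
(* Only a = L - 1 contributes: lower moments of 1 vanish, and the last dual polynomial is the
   leading coefficient of [p]. *)
have D1 : D 1 = 1.
  rewrite /D; case: L L_gt0 size_p lam_small => // l _ sp ls.
  rewrite big_ord_recr /= big1 ?add0r.
    rewrite ls ?mulr1 ?size_polyXn // coefXn eqxx scale1r.
    rewrite drop_polyS drop_poly_eq0 ?sp // mulr0 addr0.
    by have := monicP p_monic; rewrite lead_coefE sp /= => ->.
  move=> a _; rewrite ls mulr1 ?size_polyXn; last by rewrite ltnS ltnW.
  by rewrite coefXn gtn_eqF ?scale0r.
have DX P1 : D ('X * P1) = 'X * D P1 - lam Z P1 *: q.
  have := drop_poly_tele (fun a => lam Z ('X^a * P1)).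
  rewrite /= expr0 mul1r sumrB => /eqP; rewrite subr_eq => /eqP E.
  rewrite /D (eq_bigr (fun a : 'I_L => lam Z ('X^(a.+1) * P1) *: drop_poly a.+1 p)); last first.
    by move=> a _; rewrite exprSr -mulrA.
  rewrite E addrC; congr (_ + _).
    by rewrite mulr_sumr; apply: eq_bigr => a _; rewrite scalerAr.
  have -> : \sum_(a < L.+1) p`_a * lam Z ('X^a * P1) = Z * lam Z P1.
    rewrite -lam_mulp -[in p * _](@coefK _ p) size_p poly_def mulr_suml lam_sum.
    by apply: eq_bigr => a _; rewrite -scalerAl lamZ.
  by rewrite /q scalerBr opprB -[Z%:P]alg_polyC scalerA mulrC alg_polyC.
have DXn n : D 'X^n = 'X^n %% q.
  elim: n => [|n IH].
    by rewrite expr0 D1 modp_small // size_poly1 size_q ltnS.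
  rewrite exprS DX IH -[LHS](@modp_small _ _ q); last first.
    by rewrite -IH -DX.
  by rewrite modpD modpN modpZl modpp scaler0 subr0 modp_mul.
rewrite -/(D Q) -[Q]coefK poly_def.
rewrite (big_morph D DD D0).
rewrite (big_morph (fun P => P %% q) (modpD q) (mod0p q)).
by apply: eq_bigr => i _; rewrite DZ DXn modpZl.
Qed.

(* The bilinear form [(P, Q) |-> lam Z (P * Q)] on [F[X] / (p - Z)] has the
   Hankel matrix of [p], which does not depend on [Z], as its inverse Gram
   matrix in the monomial basis. *)
Lemma lam_repro Z P Q :
  lam Z (P * Q) = \sum_(c < L) \sum_(a < L)
    lam Z (P * 'X^c) * p`_(a + c).+1 * lam Z ('X^a * Q).
Proof.
rewrite -lam_modq -lam_dual mulr_sumr lam_sum exchange_big /=.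
apply: eq_bigr => a _; rewrite -scalerAr lamZ mulrC.
have -> : drop_poly a.+1 p = \sum_(c < L) p`_(a + c).+1 *: 'X^c.
  rewrite -[LHS](@coefK) poly_def.
  rewrite (big_ord_widen L (fun c => (drop_poly a.+1 p)`_c *: 'X^c)).
    rewrite big_mkcond /=; apply: eq_bigr => c _.
    rewrite coef_drop_poly addnC addSn; case: ltnP => // h.
    move: h; rewrite size_drop_poly size_p leq_subLR => h.
    by rewrite nth_default ?scale0r // size_p -addSn.
  by rewrite size_drop_poly size_p leq_subLR addSn ltnS leq_addl.
rewrite mulr_sumr lam_sum mulr_suml; apply: eq_bigr => c _.
by rewrite -scalerAr lamZ mulrC mulrA [in RHS]mulrAC mulrC mulrA; ring.
Qed.

End Level.
End ResidueFunctional.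
Arguments lamc : simpl never.

(** * The complex norm and exponential *)

Section ComplexNorm.
Variable R : realType.
Local Notation C := (Cplx R).
Implicit Types (z w : C) (x y : R).

(** The norm of [Cplx R] takes its values in [Cplx R] itself; its real part makes the order and the
    limits of [R] available. *)
Definition nrm z : R := complex.Re `|z|.

Lemma nrmE z : `|z| = ((nrm z)%:C)%C.
Proof. by rewrite /nrm normc_def. Qed.

Lemma real_complexD x y : ((x + y)%:C)%C = (x%:C)%C + (y%:C)%C :> C.
Proof. exact: (rmorphD (real_complex R)). Qed.

Lemma real_complexM x y : ((x * y)%:C)%C = (x%:C)%C * (y%:C)%C :> C.
Proof. exact: (rmorphM (real_complex R)). Qed.

Lemma real_complexX x n : ((x ^+ n)%:C)%C = (x%:C)%C ^+ n :> C.
Proof. exact: (rmorphXn (real_complex R)). Qed.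

Lemma real_complexV x : ((x^-1)%:C)%C = (x%:C)%C^-1 :> C.
Proof. exact: (fmorphV (real_complex R)). Qed.

Lemma real_complexN x : ((- x)%:C)%C = - (x%:C)%C :> C.
Proof. exact: (rmorphN (real_complex R)). Qed.

Lemma real_complex_nat n : (n%:R%:C)%C = n%:R :> C.
Proof. exact: (rmorph_nat (real_complex R)). Qed.

Lemma real_complex_sum I (r : seq I) (P : pred I) (f : I -> R) :
  ((\sum_(i <- r | P i) f i)%:C)%C = \sum_(i <- r | P i) ((f i)%:C)%C :> C.
Proof. exact: (rmorph_sum (real_complex R)). Qed.

Lemma le_nrmC z x : (`|z| <= (x%:C)%C) = (nrm z <= x).
Proof. by rewrite nrmE lecR. Qed.

Lemma lt_nrmC z x : (`|z| < (x%:C)%C) = (nrm z < x).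
Proof. by rewrite nrmE ltcR. Qed.

Lemma nrm_ge0 z : 0 <= nrm z.
Proof. by rewrite -ler0c -nrmE normr_ge0. Qed.

Lemma nrmM z w : nrm (z * w) = nrm z * nrm w.
Proof. by apply: complexI; rewrite -nrmE normrM !nrmE real_complexM. Qed.

Lemma nrmD z w : nrm (z + w) <= nrm z + nrm w.
Proof. by rewrite -lecR -nrmE real_complexD -!nrmE ler_normD. Qed.

Lemma nrmN z : nrm (- z) = nrm z.
Proof. by rewrite /nrm normrN. Qed.

Lemma nrmB z w : nrm (z - w) <= nrm z + nrm w.
Proof. by rewrite -(nrmN w) nrmD. Qed.

Lemma nrm_distC z w : nrm (z - w) = nrm (w - z).
Proof. by rewrite /nrm distrC. Qed.

Lemma nrmX z n : nrm (z ^+ n) = nrm z ^+ n.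
Proof. by apply: complexI; rewrite -nrmE normrX nrmE real_complexX. Qed.

Lemma nrmV z : nrm z^-1 = (nrm z)^-1.
Proof. by apply: complexI; rewrite -nrmE normfV nrmE real_complexV. Qed.

Lemma nrm0 : nrm 0 = 0. Proof. by rewrite /nrm normr0. Qed.
Lemma nrm1 : nrm 1 = 1. Proof. by rewrite /nrm normr1. Qed.

Lemma nrm_eq0 z : (nrm z == 0) = (z == 0).
Proof.
rewrite -[RHS]normr_eq0 nrmE; apply/eqP/eqP => [-> //|/(congr1 (@complex.Re R)) //].
Qed.

Lemma nrm_gt0 z : (0 < nrm z) = (z != 0).
Proof. by rewrite lt0r nrm_eq0 nrm_ge0 andbT. Qed.

Lemma nrm_real x : nrm (x%:C)%C = `|x|.
Proof. by rewrite /nrm normc_def /= expr0n /= addr0 sqrtr_sqr. Qed.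

Lemma nrm_nat n : nrm n%:R = n%:R.
Proof. by rewrite -real_complex_nat nrm_real normr_nat. Qed.

Lemma nrm_sum I (r : seq I) (P : pred I) (f : I -> C) :
  nrm (\sum_(i <- r | P i) f i) <= \sum_(i <- r | P i) nrm (f i).
Proof.
elim/big_rec2: _ => [|i a b _ ab]; first by rewrite nrm0.
by apply: le_trans (nrmD _ _) _; rewrite lerD2l.
Qed.

Lemma nrm_prod I (r : seq I) (P : pred I) (f : I -> C) :
  nrm (\prod_(i <- r | P i) f i) = \prod_(i <- r | P i) nrm (f i).
Proof. exact: (big_morph _ nrmM nrm1). Qed.

Lemma ReD z w : complex.Re (z + w) = complex.Re z + complex.Re w.
Proof. by case: z w => [a b] [c d]. Qed.

Lemma ImD z w : complex.Im (z + w) = complex.Im z + complex.Im w.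
Proof. by case: z w => [a b] [c d]. Qed.

Lemma ReN z : complex.Re (- z) = - complex.Re z. Proof. by case: z. Qed.
Lemma ImN z : complex.Im (- z) = - complex.Im z. Proof. by case: z. Qed.

Lemma Re_sum I (r : seq I) (P : pred I) (f : I -> C) :
  complex.Re (\sum_(i <- r | P i) f i) = \sum_(i <- r | P i) complex.Re (f i).
Proof. exact: (big_morph (fun z : C => complex.Re z) ReD). Qed.

Lemma Im_sum I (r : seq I) (P : pred I) (f : I -> C) :
  complex.Im (\sum_(i <- r | P i) f i) = \sum_(i <- r | P i) complex.Im (f i).
Proof. exact: (big_morph (fun z : C => complex.Im z) ImD). Qed.

Lemma ler_Re_nrm z : `|complex.Re z| <= nrm z.
Proof. by rewrite -lecR -nrmE; exact: normc_ge_Re. Qed.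

Lemma ler_Im_nrm z : `|complex.Im z| <= nrm z.
Proof.
have := ler_Re_nrm (z * ('i%C : C)); rewrite nrmM.
have -> : nrm ('i%C : C) = 1 by rewrite /nrm normc_def /= expr0n expr1n add0r sqrtr1.
by rewrite mulr1; case: z => a b /=; rewrite mulr0 sub0r mulr1 normrN.
Qed.

Lemma nrm_le_ReIm z : nrm z <= `|complex.Re z| + `|complex.Im z|.
Proof.
case: z => a b /=; have -> : (a +i* b)%C = (a%:C)%C + (b%:C)%C * ('i%C : C) :> C.
  by apply/eqP; rewrite eq_complex /=; apply/andP; split; apply/eqP; ring.
apply: le_trans (nrmD _ _) _; rewrite nrmM !nrm_real.
have -> : nrm ('i%C : C) = 1 by rewrite /nrm normc_def /= expr0n expr1n add0r sqrtr1.
by rewrite mulr1.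
Qed.

Lemma cvg_nrmP (T : Type) (F : set_system T) {FF : Filter F} (f : T -> C) (l : C) :
  f @ F --> l <-> (forall e : R, 0 < e -> \forall x \near F, nrm (l - f x) < e).
Proof.
split=> [/cvgrPdist_lt H e e0|H].
  have /H : 0 < ((e%:C)%C : C) by rewrite (ltcR 0 e).
  by apply: filterS => x; rewrite lt_nrmC.
apply/cvgrPdist_lt => e e0.
have e0' : e = ((complex.Re e)%:C)%C by rewrite RRe_real // ger0_real // ltW.
have /H : 0 < complex.Re e by rewrite -(ltcR 0) -e0'.
by apply: filterS => x; rewrite -lt_nrmC -e0'.
Qed.

Lemma cvg_nrm (T : Type) (F : set_system T) {FF : Filter F} (f : T -> C) (l : C)
    (b : T -> R) :
  (forall i : T, nrm (l - f i) <= b i) -> b @ F --> (0 : R) -> f @ F --> l.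
Proof.
move=> fb /cvgr0Pnorm_lt b0; apply/cvg_nrmP => e /b0.
by apply: filterS => x; apply: le_lt_trans; apply: le_trans (fb x) (ler_norm _).
Qed.

(** Taken on real and imaginary parts, so that completeness of [R] suffices. It is meaningful for
    Cauchy sequences. *)
Definition clim (u : nat -> C) : C :=
  ((lim (complex.Re (u n) @[n --> \oo])) +i*
   (lim (complex.Im (u n) @[n --> \oo])))%C.

Lemma cauchy_bound_cvg (v b : nat -> R) :
  (forall m n, (m <= n)%N -> `|v n - v m| <= b m) -> b @ \oo --> (0 : R) ->
  cvg (v @ \oo).
Proof.
move=> vb /cvgr0Pnorm_lt b0; apply/cauchy_cvgP/cauchy_exP => e e0.
have /b0 [N _ HN] : 0 < e by [].
exists (v N), N => // n /= Nn; rewrite /ball /= distrC.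
apply: le_lt_trans (vb _ _ Nn) _; apply: le_lt_trans (ler_norm _) _.
by apply: HN => /=.
Qed.

Lemma cvg_clim (u : nat -> C) (b : nat -> R) :
  (forall m n, (m <= n)%N -> nrm (u n - u m) <= b m) -> b @ \oo --> (0 : R) ->
  u @ \oo --> clim u.
Proof.
move=> ub b0.
have cRe : cvg (complex.Re (u n) @[n --> \oo]).
  apply: cauchy_bound_cvg b0 => m n mn.
  by rewrite -ReN -ReD; apply: le_trans (ler_Re_nrm _) (ub _ _ mn).
have cIm : cvg (complex.Im (u n) @[n --> \oo]).
  apply: cauchy_bound_cvg b0 => m n mn.
  by rewrite -ImN -ImD; apply: le_trans (ler_Im_nrm _) (ub _ _ mn).
apply/cvg_nrmP => e e0; have e2 : 0 < e / 2 by rewrite divr_gt0.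
have /cvgrPdist_lt /(_ _ e2) HRe := cRe.
have /cvgrPdist_lt /(_ _ e2) HIm := cIm.
near=> n; apply: le_lt_trans (nrm_le_ReIm _) _.
rewrite ReD ImD ReN ImN /= [e]splitr ltrD //; first by near: n.
by near: n.
Unshelve. all: by end_near. Qed.

Lemma clim_dist (u : nat -> C) (b : nat -> R) m :
  (forall m n, (m <= n)%N -> nrm (u n - u m) <= b m) -> b @ \oo --> (0 : R) ->
  nrm (clim u - u m) <= b m.
Proof.
move=> ub b0; apply/ler_addgt0Pr => e e0.
have /cvg_nrmP /(_ _ e0) [M _ HM] := cvg_clim ub b0.
have := HM (maxn M m) (leq_maxl _ _) => h.
have -> : clim u - u m = (clim u - u (maxn M m)) + (u (maxn M m) - u m) by ring.
apply: le_trans (nrmD _ _) _; rewrite addrC; apply: lerD; last exact: ltW.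
by apply: ub; rewrite leq_maxr.
Qed.

Lemma Cplx_hausdorff : hausdorff_space C.
Proof. exact: norm_hausdorff. Qed.

End ComplexNorm.

(** * Truncated exponential series *)

Section ExpPoly.
Variable R : realType.
Local Notation C := (Cplx R).
Implicit Types (P Q : {poly C}) (x y : R).

(** The residue functional only accepts polynomials, so exp(s w) enters through its first [K] Taylor
    terms in w. *)
Definition epol (F : fieldType) K (s : F) : {poly F} :=
  \poly_(k < K) (s ^+ k / k`!%:R).

Lemma epol_horner (F : fieldType) K (s w : F) :
  (epol K s).[w] = (epol K (s * w)).[1].
Proof.
rewrite !horner_poly; apply: eq_bigr => k _.
by rewrite expr1n mulr1 exprMn mulrAC.
Qed.

(** Majorant of [P]: a linear functional bounded by x^k on each X^k is bounded on [P] by the value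
    of the majorant at x. *)
Definition pabs (P : {poly C}) : {poly R} := \poly_(k < size P) nrm P`_k.

Lemma coef_pabs P k : (pabs P)`_k = nrm P`_k.
Proof.
rewrite coef_poly; case: ltnP => // h.
by rewrite nth_default // nrm0.
Qed.

Lemma ler_horner (A B : {poly R}) x : 0 <= x -> (forall k, A`_k <= B`_k) ->
  A.[x] <= B.[x].
Proof.
move=> x0 AB; pose n := maxn (size A) (size B).
rewrite (@horner_coef_wide _ n A) ?leq_maxl // (@horner_coef_wide _ n B) ?leq_maxr //.
by apply: ler_sum => k _; rewrite ler_wpM2r // exprn_ge0.
Qed.

Lemma pabs_ge0 P x : 0 <= x -> 0 <= (pabs P).[x].
Proof.
move=> x0; rewrite -(horner0 x); apply: ler_horner => // k.
by rewrite coef0 coef_pabs nrm_ge0.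
Qed.

Lemma pabsD P Q x : 0 <= x -> (pabs (P + Q)).[x] <= (pabs P).[x] + (pabs Q).[x].
Proof.
move=> x0; rewrite -hornerD; apply: ler_horner => // k.
by rewrite coefD !coef_pabs coefD nrmD.
Qed.

Lemma coef_pabsM P Q k : nrm (P * Q)`_k <= (pabs P * pabs Q)`_k.
Proof.
rewrite !coefM; apply: le_trans (nrm_sum _ _ _) _; apply: ler_sum => i _.
by rewrite nrmM !coef_pabs.
Qed.

Lemma pabsM P Q x : 0 <= x -> (pabs (P * Q)).[x] <= (pabs P).[x] * (pabs Q).[x].
Proof.
move=> x0; rewrite -hornerM; apply: ler_horner => // k.
by rewrite coef_pabs coef_pabsM.
Qed.

Lemma pabs1 x : (pabs 1).[x] = 1.
Proof.
have -> : pabs 1 = 1.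
  by apply/polyP => k; rewrite coef_pabs !coef1; case: eqP; rewrite ?nrm1 ?nrm0.
exact: hornerC.
Qed.

Lemma pabsX P x n : 0 <= x -> (pabs (P ^+ n)).[x] <= (pabs P).[x] ^+ n.
Proof.
move=> x0; elim: n => [|n IH]; first by rewrite !expr0 pabs1.
rewrite !exprS; apply: le_trans (pabsM _ _ x0) _.
by rewrite ler_wpM2l // pabs_ge0.
Qed.

Lemma pabs_epol K (w : C) : pabs (epol K w) = epol K (nrm w).
Proof.
apply/polyP => k; rewrite coef_pabs !coef_poly; case: ifP; rewrite ?nrm0 //.
by rewrite nrmM nrmX nrmV nrm_nat.
Qed.

Lemma epol1E K (x : R) : (epol K x).[1] = series (exp_coeff x) K.
Proof.
rewrite horner_poly /series /= big_mkord; apply: eq_bigr => k _.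
by rewrite expr1n mulr1.
Qed.

Lemma epol1_cvg (x : R) : (epol K x).[1] @[K --> \oo] --> expR x.
Proof.
rewrite (_ : (fun K => _) = series (exp_coeff x)); last first.
  by apply/funext => K; rewrite epol1E.
exact: is_cvg_series_exp_coeff.
Qed.

Lemma epol1_le (x : R) m n : 0 <= x -> (m <= n)%N -> (epol m x).[1] <= (epol n x).[1].
Proof.
move=> x0 mn; apply: ler_horner => // k; rewrite !coef_poly.
have t0 : 0 <= x ^+ k / k`!%:R by rewrite divr_ge0 // exprn_ge0.
by case: ltnP => km; case: ltnP => kn //; lia.
Qed.

Lemma epol1_le_expR (x : R) m : 0 <= x -> (epol m x).[1] <= expR x.
Proof.
move=> x0; have c := @epol1_cvg x.
rewrite -(cvg_lim (@Rhausdorff R) c).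
apply: limr_ge; first by apply/cvg_ex; exists (expR x).
by exists m => // n /= mn; exact: epol1_le.
Qed.

Lemma coef_epolM (F : numFieldType) K (u v : F) n : (n < K)%N ->
  (epol K u * epol K v)`_n = (u + v) ^+ n / n`!%:R.
Proof.
move=> nK; rewrite coefM addrC exprDn mulr_suml.
apply: eq_bigr => i _; have iN : (i <= n)%N by rewrite -ltnS.
rewrite !coef_poly (leq_ltn_trans (leq_subr _ _) nK) (leq_ltn_trans iN nK).
rewrite -(bin_fact iN) !natrM -mulr_natr.
have f0 m : m`!%:R != 0 :> F by rewrite pnatr_eq0 -lt0n fact_gt0.
have b0 : 'C(n, i)%:R != 0 :> F by rewrite pnatr_eq0 -lt0n bin_gt0.
by field; rewrite b0 !f0.
Qed.

Lemma epol_addE (F : numFieldType) K (u v : F) :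
  (epol K u).[1] * (epol K v).[1] - (epol K (u + v)).[1]
  = \sum_(K <= n < K + K) (epol K u * epol K v)`_n.
Proof.
rewrite -hornerM (@horner_coef_wide _ (K + K)); last first.
  apply: (leq_trans (size_polyMleq _ _)).
  by apply: (leq_trans (leq_pred _)); rewrite leq_add // size_poly.
rewrite (eq_bigr (fun n : 'I_(K+K) => (epol K u * epol K v)`_n)); last first.
  by move=> i _; rewrite expr1n mulr1.
rewrite -(big_mkord xpredT (fun n => (epol K u * epol K v)`_n)).
rewrite (big_cat_nat (n := K)) ?leq_addr //= addrAC horner_poly.
rewrite [X in X - _ + _]big_mkord (eq_bigr _ (fun i _ => coef_epolM u v (ltn_ord i))).
rewrite -sumrB big1 ?add0r // => i _.
by rewrite expr1n mulr1 subrr.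
Qed.

(** The defect of multiplicativity consists of the coefficients of degree at least [K] of the
    product, which are dominated by those for |u| and |v|; for real arguments the defect tends to
    zero by the real exponential law. *)
Lemma epol_add_dist K (u v : C) :
  nrm ((epol K u).[1] * (epol K v).[1] - (epol K (u + v)).[1]) <=
  (epol K (nrm u)).[1] * (epol K (nrm v)).[1] - (epol K (nrm u + nrm v)).[1].
Proof.
rewrite !epol_addE; apply: le_trans (nrm_sum _ _ _) _; apply: ler_sum => n _.
by apply: le_trans (coef_pabsM _ _ _) _; rewrite !pabs_epol.
Qed.

Lemma epol_real K x : (epol K (x%:C)%C).[1] = ((epol K x).[1]%:C)%C :> C.
Proof.
rewrite !horner_poly real_complex_sum; apply: eq_bigr => k _.
by rewrite !expr1n !mulr1 real_complexM real_complexX real_complexV real_complex_nat.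
Qed.

Lemma epol_imag K y : (epol K (y *i)%C).[1] =
  (series (cos_coeff y) K +i* series (sin_coeff y) K)%C :> C.
Proof.
rewrite horner_poly /series /= !big_mkord.
have -> : ((\sum_(k < K) cos_coeff y k) +i* (\sum_(k < K) sin_coeff y k))%C =
   \sum_(k < K) ((cos_coeff y k) +i* (sin_coeff y k))%C :> C.
  by apply/eqP; rewrite eq_complex Re_sum Im_sum /= !eqxx.
apply: eq_bigr => k _; rewrite expr1n mulr1.
have -> : (y *i)%C = (y%:C)%C * ('i%C : C) :> C.
  by apply/eqP; rewrite eq_complex /=; apply/andP; split; apply/eqP; ring.
rewrite exprMn -real_complexX -real_complex_nat -real_complexV.
have -> : ('i%C : C) ^+ k = ((~~ odd k)%:R * (-1) ^+ k./2 +i* ((odd k)%:R * (-1) ^+ k.-1./2))%C.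
  have i2 j : ('i%C : C) ^+ j.*2 = (((-1) ^+ j)%:C)%C.
    by rewrite -muln2 mulnC exprM (sqr_i R) real_complexX real_complexN.
  rewrite -{1}(odd_double_half k) exprD i2.
  case: (boolP (odd k)) => ok.
    have -> : k.-1./2 = k./2.
      by rewrite -[in RHS](odd_double_half k) ok; lia.
    by rewrite expr1; apply/eqP; rewrite eq_complex /=; apply/andP; split; apply/eqP; ring.
  by rewrite expr0 mul1r /= mul0r mul1r.
rewrite /cos_coeff /sin_coeff /= -?exprnP.
apply/eqP; rewrite eq_complex /=; apply/andP; split; apply/eqP; ring.
Qed.

Lemma cvg_complex (f g : nat -> R) (a b : R) :
  f @ \oo --> a -> g @ \oo --> b -> ((f K +i* g K)%C : C) @[K --> \oo] --> ((a +i* b)%C : C).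
Proof.
move=> /cvgrPdist_lt fa /cvgrPdist_lt gb; apply/cvg_nrmP => e e0.
have e2 : 0 < e / 2 by rewrite divr_gt0.
near=> n; apply: le_lt_trans (nrm_le_ReIm _) _.
rewrite /= [e]splitr ltrD //; first by near: n; exact: fa.
by near: n; exact: gb.
Unshelve. all: by end_near. Qed.

Lemma cvg_epol_real x : ((epol K (x%:C)%C).[1] : C) @[K --> \oo] --> (((expR x)%:C)%C : C).
Proof.
rewrite (_ : (fun _ => _) = fun K => (((epol K x).[1] +i* 0)%C : C)).
  by apply: cvg_complex; [exact: epol1_cvg | exact: cvg_cst].
by apply/funext => K; rewrite epol_real.
Qed.

Lemma cvg_epol_imag y : ((epol K (y *i)%C).[1] : C) @[K --> \oo]
  --> ((cos y +i* sin y)%C : C).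
Proof.
rewrite (_ : (fun _ => _) =
    fun K => ((series (cos_coeff y) K +i* series (sin_coeff y) K)%C : C)).
  apply: cvg_complex.
    rewrite unlock; exact: is_cvg_series_cos_coeff.
  rewrite unlock; exact: is_cvg_series_sin_coeff.
by apply/funext => K; rewrite epol_imag.
Qed.

Lemma cvg_epolM (u v a b : C) :
  ((epol K u).[1] : C) @[K --> \oo] --> a -> ((epol K v).[1] : C) @[K --> \oo] --> b ->
  ((epol K (u + v)).[1] : C) @[K --> \oo] --> a * b.
Proof.
move=> ua vb.
have ab := cvgM ua vb.
pose D K : R := (epol K (nrm u)).[1] * (epol K (nrm v)).[1] - (epol K (nrm u + nrm v)).[1].
have D0 : D @ \oo --> (0 : R).
  have H := cvgB (cvgM (@epol1_cvg (nrm u)) (@epol1_cvg (nrm v))) (@epol1_cvg (nrm u + nrm v)).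
  by rewrite expRD subrr in H; exact: H.
pose E K : C := (epol K u).[1] * (epol K v).[1] - (epol K (u + v)).[1].
have E0 : E @ \oo --> (0 : C).
  by apply: cvg_nrm D0 => K; rewrite sub0r nrmN; exact: epol_add_dist.
have H := cvgB (ab _) E0; rewrite subr0 in H.
have -> : (fun K => ((epol K (u + v)).[1] : C)) =
    (fun K => (epol K u).[1] * (epol K v).[1] - E K).
  by apply/funext => K; rewrite /E; ring.
exact: H.
Qed.

(** [cexp] is built from the real exponential, cosine and sine. Their series settle the real and the
    imaginary axis, and [cvg_epolM] multiplies the two. *)
Lemma cvg_cexp (w : C) : ((epol K w).[1] : C) @[K --> \oo] --> cexp w.
Proof.
rewrite {1}(_ : w = ((complex.Re w)%:C)%C + ((complex.Im w) *i)%C); last first.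
  by case: w => a b; apply/eqP; rewrite eq_complex /= addr0 add0r !eqxx.
by apply: cvg_epolM; [exact: cvg_epol_real | exact: cvg_epol_imag].
Qed.

Lemma cvg_uniqueC (u : nat -> C) (a b : C) : u @ \oo --> a -> u @ \oo --> b -> a = b.
Proof.
move=> ua ub; rewrite -(cvg_lim (@Cplx_hausdorff R) ua).
by rewrite -(cvg_lim (@Cplx_hausdorff R) ub).
Qed.

Lemma cexpD (u v : C) : cexp (u + v) = cexp u * cexp v.
Proof.
apply: (@cvg_uniqueC (fun K => (epol K (u + v)).[1])); first exact: cvg_cexp.
by apply: cvg_epolM; exact: cvg_cexp.
Qed.

Lemma cexp0 : cexp (0 : C) = 1.
Proof. by rewrite /cexp /= expR0 cos0 sin0 mul1r. Qed.

Lemma cexp_neq0 (w : C) : cexp w != 0.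
Proof.
apply/eqP => w0; have := cexpD w (- w); rewrite subrr cexp0 w0 mul0r => /eqP.
by rewrite oner_eq0.
Qed.

Lemma cexpN (w : C) : cexp (- w) = (cexp w)^-1.
Proof.
apply: (mulfI (cexp_neq0 w)); rewrite -cexpD subrr cexp0 mulfV //.
exact: cexp_neq0.
Qed.

End ExpPoly.

(** * Root sums with exponential weights *)

Section LamExp.
Variable R : realType.
Local Notation C := (Cplx R).
Variables (p : {poly C}) (L : nat).
Hypotheses (L_gt0 : (0 < L)%N) (p_monic : p \is monic) (size_p : size p = L.+1).
Implicit Types (P Q : {poly C}) (Z : C) (s h M : R).

(** Cauchy's bound for the roots of p(w) = Z with |Z| <= M. *)
Definition radius M : R := 1 + M + \sum_(i < L) nrm p`_i.

Lemma radius_ge1 M : 0 <= M -> 1 <= radius M.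
Proof.
by move=> M0; rewrite /radius -addrA lerDl addr_ge0 // sumr_ge0 // => i _; exact: nrm_ge0.
Qed.

Lemma radius_ge0 M : 0 <= M -> 0 <= radius M.
Proof. by move=> /radius_ge1; exact: le_trans. Qed.

(** Strong induction: for k >= L, X^k is p X^(k-L) minus the terms p_i X^(i+k-L), and [p] acts as
    [Z]; so the k-th moment is a combination of earlier ones with total weight at most
    [radius M - 1]. *)
Lemma lam_Xn_bound Z M k : nrm Z <= M -> nrm (lam p Z 'X^k) <= radius M ^+ k.
Proof.
move=> ZM; have M0 : 0 <= M := le_trans (nrm_ge0 _) ZM.
have B1 := radius_ge1 M0; have B0 := radius_ge0 M0.
elim/ltn_ind: k => k IH; have [kL|Lk] := ltnP k L.
  rewrite (@lam_small _ p L) ?size_polyXn // coefXn.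
  by case: eqP => _; rewrite ?nrm1 ?nrm0 ?exprn_ge0 // exprn_ege1.
have -> : 'X^k = p * 'X^(k - L) - \sum_(i < L) p`_i *: 'X^(i + (k - L)) :> {poly C}.
  rewrite -[p in p * _](@coefK _ p) size_p poly_def big_ord_recr /= mulrDl.
  have -> : p`_L = 1 by have := monicP p_monic; rewrite lead_coefE size_p.
  rewrite scale1r -exprD subnKC // mulr_suml addrAC -sumrB big1 ?add0r // => i _.
  by rewrite -scalerAl -exprD subrr.
rewrite lamD lamN lam_mulp lam_sum.
apply: le_trans (nrmB _ _) _; rewrite nrmM.
have kL1 : (k - L <= k.-1)%N by lia.
apply: (@le_trans _ _ (M * radius M ^+ k.-1 + (\sum_(i < L) nrm p`_i) * radius M ^+ k.-1)).
  apply: lerD.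
    apply: ler_pM => //; rewrite ?nrm_ge0 //.
    by apply: le_trans (IH _ _) _; [lia | apply: ler_weXn2l].
  apply: le_trans (nrm_sum _ _ _) _; rewrite mulr_suml; apply: ler_sum => i _.
  rewrite lamZ nrmM ler_wpM2l ?nrm_ge0 //.
  have iL := ltn_ord i.
  by apply: le_trans (IH _ _) _; [lia | apply: ler_weXn2l; lia].
have -> : radius M ^+ k = radius M * radius M ^+ k.-1.
  by rewrite -exprS prednK //; lia.
rewrite -mulrDl ler_wpM2r ?exprn_ge0 //.
by rewrite /radius -addrA lerDr ler01.
Qed.

Lemma lam_bound Z M P : nrm Z <= M -> nrm (lam p Z P) <= (pabs P).[radius M].
Proof.
move=> ZM; rewrite -{1}[P]coefK poly_def lam_sum.
rewrite (@horner_coef_wide _ (size P) (pabs P)) ?size_poly //.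
apply: le_trans (nrm_sum _ _ _) _; apply: ler_sum => i _.
by rewrite lamZ nrmM coef_pabs ler_wpM2l ?nrm_ge0 // lam_Xn_bound.
Qed.

Lemma pabs_nonneg (D : {poly R}) : (forall k, 0 <= D`_k) ->
  pabs (map_poly (real_complex R) D) = D.
Proof.
move=> D0; apply/polyP => k; rewrite coef_pabs coef_map /=.
by rewrite nrm_real ger0_norm.
Qed.

Lemma map_epol K s : map_poly (real_complex R) (epol K s) = epol K (s%:C)%C :> {poly C}.
Proof.
apply/polyP => k; rewrite coef_map !coef_poly; case: ifP => // _.
by rewrite /= real_complexM real_complexX real_complexV real_complex_nat.
Qed.

(** [lam] for the weight P(w) exp(s w). For s >= 0 the tail of the exponential series at [radius M]
    bounds the truncation error uniformly in |Z| <= M. *)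
Definition Lam Z P s : C := clim (fun K => lam p Z (P * epol K (s%:C)%C)).

Definition Lam_err M P s K : R :=
  (pabs P).[radius M] * (expR (s * radius M) - (epol K (s * radius M)).[1]).

Lemma Lam_err_cvg M P s : Lam_err M P s @ \oo --> (0 : R).
Proof.
have H := cvgB (cvg_cst (expR (s * radius M))) (@epol1_cvg R (s * radius M)).
have := cvgM (cvg_cst (pabs P).[radius M]) (H _ _).
by rewrite subrr mulr0; apply.
Qed.

Lemma Lam_cauchy Z M P s : nrm Z <= M -> 0 <= s -> forall m n, (m <= n)%N ->
  nrm (lam p Z (P * epol n (s%:C)%C) - lam p Z (P * epol m (s%:C)%C))
  <= Lam_err M P s m.
Proof.
move=> ZM s0 m n mn; have M0 : 0 <= M := le_trans (nrm_ge0 _) ZM.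
have B0 := radius_ge0 M0.
rewrite -lamN -lamD -mulrBr; apply: le_trans (lam_bound _ ZM) _.
apply: le_trans (pabsM _ _ B0) _; rewrite ler_wpM2l ?pabs_ge0 //.
rewrite -!map_epol -rmorphB pabs_nonneg; last first.
  move=> k; rewrite coefB !coef_poly.
  have t0 : 0 <= s ^+ k / k`!%:R by rewrite divr_ge0 // exprn_ge0.
  by case: ltnP => km; case: ltnP => kn; rewrite ?subr0 ?subrr //; lia.
rewrite hornerD hornerN !(epol_horner _ s (radius M)) lerD2r.
by rewrite epol1_le_expR // mulr_ge0.
Qed.

Lemma Lam_cvg Z P s : 0 <= s ->
  (lam p Z (P * epol K (s%:C)%C) : C) @[K --> \oo] --> Lam Z P s.
Proof.
move=> s0; apply: cvg_clim (Lam_cauchy P (lexx (nrm Z)) s0) _.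
exact: Lam_err_cvg.
Qed.

Lemma Lam_unique Z P s l : 0 <= s ->
  (lam p Z (P * epol K (s%:C)%C) : C) @[K --> \oo] --> l -> Lam Z P s = l.
Proof. by move=> s0; apply: cvg_uniqueC; exact: Lam_cvg. Qed.

Lemma Lam_dist Z M P s K : nrm Z <= M -> 0 <= s ->
  nrm (Lam Z P s - lam p Z (P * epol K (s%:C)%C)) <= Lam_err M P s K.
Proof.
move=> ZM s0; apply: (@clim_dist _ (fun K => lam p Z (P * epol K (s%:C)%C))).
  exact: Lam_cauchy.
exact: Lam_err_cvg.
Qed.

Lemma Lam0 Z P : Lam Z P 0 = lam p Z P.
Proof.
(* At [s = 0] one term of the series is exact, and the error bound vanishes. *)
have := @Lam_dist Z (nrm Z) P 0 1 (lexx _) (lexx _).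
have e1 (F : numFieldType) : epol 1 (0 : F) = 1.
  apply/polyP => k; rewrite coef_poly coef1; case: k => [|k] //=.
  by rewrite expr0 fact0 divr1.
rewrite /Lam_err mul0r expR0 !e1 hornerC subrr mulr0 mulr1 => h.
apply/eqP; rewrite -subr_eq0 -nrm_eq0; apply/eqP/le_anti.
by rewrite h nrm_ge0.
Qed.

Lemma Lam_bound Z M P s : nrm Z <= M -> 0 <= s ->
  nrm (Lam Z P s) <= (pabs P).[radius M] * expR (s * radius M).
Proof.
move=> ZM s0; have := @Lam_dist Z M P s 0 ZM s0.
have e0 (F : numFieldType) (x : F) : epol 0 x = 0.
  by apply/polyP => k; rewrite coef_poly coef0.
by rewrite /Lam_err !e0 mulr0 {1}/lam topc0 horner0 !subr0.
Qed.

Lemma LamD Z P Q s : 0 <= s -> Lam Z (P + Q) s = Lam Z P s + Lam Z Q s.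
Proof.
move=> s0; apply: Lam_unique => //.
have -> : (fun K => lam p Z ((P + Q) * epol K (s%:C)%C)) =
   (fun K => lam p Z (P * epol K (s%:C)%C) + lam p Z (Q * epol K (s%:C)%C)).
  by apply/funext => K; rewrite mulrDl lamD.
by apply: cvgD; exact: Lam_cvg.
Qed.

Lemma Lam_mulp Z P s : 0 <= s -> Lam Z (p * P) s = Z * Lam Z P s.
Proof.
move=> s0; apply: Lam_unique => //.
have -> : (fun K => lam p Z (p * P * epol K (s%:C)%C)) =
   (fun K => Z * lam p Z (P * epol K (s%:C)%C)).
  by apply/funext => K; rewrite -mulrA lam_mulp.
by apply: cvgM; [exact: cvg_cst | exact: Lam_cvg].
Qed.

Lemma Lam_mulpX Z n P s : 0 <= s -> Lam Z (p ^+ n * P) s = Z ^+ n * Lam Z P s.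
Proof.
move=> s0; elim: n P => [|n IH] P; first by rewrite !expr0 !mul1r.
by rewrite !exprS -!mulrA Lam_mulp // IH.
Qed.

Lemma Lam_repro Z P Q s : 0 <= s ->
  Lam Z (P * Q) s = \sum_(c < L) \sum_(a < L)
    lam p Z (P * 'X^c) * p`_(a + c).+1 * Lam Z ('X^a * Q) s.
Proof.
move=> s0; apply: Lam_unique => //.
have -> : (fun K => lam p Z (P * Q * epol K (s%:C)%C)) =
   (fun K => \sum_(c < L) \sum_(a < L)
    lam p Z (P * 'X^c) * p`_(a + c).+1 * lam p Z (('X^a * Q) * epol K (s%:C)%C)).
  apply/funext => K; rewrite -mulrA (lam_repro L_gt0 p_monic size_p).
  by under eq_bigr do under eq_bigr do rewrite mulrA.
apply: cvg_big => [|c _]; first exact: add_continuous.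
apply: cvg_big => [|a _]; first exact: add_continuous.
by apply: cvgM; [exact: cvg_cst | exact: Lam_cvg].
Qed.

Lemma Lam_lagrange Z (rs : seq C) P s : 0 <= s -> uniq rs ->
    all (root (p - Z%:P)) rs -> size rs = L ->
  Lam Z P s = \sum_(w <- rs) P.[w] * cexp ((s%:C)%C * w) / p^`().[w].
Proof.
move=> s0 urs ars srs; apply: Lam_unique => //.
have -> : (fun K => lam p Z (P * epol K (s%:C)%C)) =
   (fun K => \sum_(w <- rs) (P.[w] / p^`().[w] * (epol K ((s%:C)%C * w)).[1])).
  apply/funext => K; rewrite (lam_lagrange L_gt0 p_monic size_p _ urs ars srs).
  by apply: eq_bigr => w _; rewrite hornerM [(epol K _).[w]]epol_horner mulrAC.
under [X in _ --> X]eq_bigr do rewrite mulrAC.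
apply: cvg_big => [|w _]; first exact: add_continuous.
by apply: cvgM; [exact: cvg_cst | exact: cvg_cexp].
Qed.

Lemma nrm_lim_le (u : nat -> C) (v : nat -> R) (l : C) (m : R) :
  u @ \oo --> l -> v @ \oo --> m -> (forall K, nrm (u K) <= v K) -> nrm l <= m.
Proof.
move=> /cvg_nrmP ul /cvgrPdist_lt vm uv; apply/ler_addgt0Pr => e e0.
have e2 : 0 < e / 2 by rewrite divr_gt0.
have [M1 _ H1] := ul _ e2; have [M2 _ H2] := vm _ e2.
have := H1 (maxn M1 M2) (leq_maxl _ _); have := H2 (maxn M1 M2) (leq_maxr _ _).
have := uv (maxn M1 M2); set K := maxn _ _ => h3 h2 h1.
have -> : l = (l - u K) + u K by ring.
apply: le_trans (nrmD _ _) _.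
move: h2; rewrite /= ltr_norml => /andP[h2 _]; move: h1 => /= h1; lra.
Qed.

(** Makes the coefficients in X of exp((s + h) X) - exp(s X) - h X exp(s X) nonnegative. *)
Lemma bernoulli_le s h k : 0 <= s -> 0 <= h ->
  s ^+ k + h * (k%:R * s ^+ k.-1) <= (s + h) ^+ k.
Proof.
move=> s0 h0; elim: k => [|k IH]; first by rewrite !expr0 mul0r mulr0 addr0.
rewrite [X in _ <= X]exprS; apply: le_trans (ler_wpM2l (addr_ge0 s0 h0) IH).
case: k {IH} => [|k] /=; first by rewrite !expr0 expr1; lra.
have sk : 0 <= s ^+ k by apply: exprn_ge0.
have hh : 0 <= h * h * (k.+1%:R * s ^+ k) by rewrite !mulr_ge0.
rewrite -[k.+2%:R]natr1 !exprS; nra.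
Qed.

Lemma Lam_taylor Z M P s h : nrm Z <= M -> 0 <= s -> 0 <= h ->
  nrm (Lam Z P (s + h) - Lam Z P s - (h%:C)%C * Lam Z ('X * P) s)
  <= (pabs P).[radius M] * (expR ((s + h) * radius M) - expR (s * radius M)
      - h * radius M * expR (s * radius M)).
Proof.
move=> ZM s0 h0; have M0 : 0 <= M := le_trans (nrm_ge0 _) ZM.
have B0 := radius_ge0 M0.
(* The order [K] next to [K.+1] accounts for the factor X. All coefficients are nonnegative, so this
   polynomial is its own majorant and may be evaluated at [radius M]. *)
pose D K : {poly R} := epol K.+1 (s + h) - epol K.+1 s - h *: ('X * epol K s).
have D0 K k : 0 <= (D K)`_k.
  rewrite !coefB coefZ coefXM !coef_poly.
  case: k => [|k] /=; first by rewrite !expr0 mulr0 subr0 subrr.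
  rewrite ltnS; case: ltnP => _; last by rewrite mulr0 subr0 subrr.
  rewrite factS natrM invfM mulrA.
  have -> : (s + h) ^+ k.+1 / k.+1%:R / k`!%:R - s ^+ k.+1 * (k.+1%:R^-1 / k`!%:R)
     - h * (s ^+ k / k`!%:R) =
     ((s + h) ^+ k.+1 - (s ^+ k.+1 + h * (k.+1%:R * s ^+ k))) / (k.+1%:R * k`!%:R).
    by field; rewrite !gt_eqF.
  apply: divr_ge0; last by apply: mulr_ge0; exact: ltW.
  by rewrite subr_ge0; apply: (@bernoulli_le _ _ k.+1).
apply: (@nrm_lim_le (fun K => lam p Z (P * map_poly (real_complex R) (D K)))
   (fun K => (pabs P).[radius M] * (D K).[radius M])).
- have -> : (fun K => lam p Z (P * map_poly (real_complex R) (D K))) =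
   (fun K => lam p Z (P * epol K.+1 ((s + h)%:C)%C) - lam p Z (P * epol K.+1 (s%:C)%C)
     - (h%:C)%C * lam p Z ('X * P * epol K (s%:C)%C)).
    apply/funext => K; rewrite /D !rmorphB /= map_polyZ rmorphM /= map_polyX !map_epol.
    rewrite !mulrBr !lamD !lamN -scalerAr lamZ; congr (_ - _ * lam _ _ _).
    by rewrite mulrA [P * _]mulrC.
  apply: cvgB; first apply: cvgB.
  + by have := @Lam_cvg Z P _ (addr_ge0 s0 h0); rewrite -cvg_shiftS.
  + by have := @Lam_cvg Z P _ s0; rewrite -cvg_shiftS.
  + by apply: cvgM; [exact: cvg_cst | exact: Lam_cvg].
- apply: cvgM; first exact: cvg_cst.
  have -> : (fun K => (D K).[radius M]) = (fun K =>
     (epol K.+1 ((s + h) * radius M)).[1] - (epol K.+1 (s * radius M)).[1]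
     - h * radius M * (epol K (s * radius M)).[1]).
    apply/funext => K; rewrite !hornerD !hornerN hornerZ hornerM hornerX.
    by rewrite !(epol_horner _ _ (radius M)) mulrA.
  apply: cvgB; first apply: cvgB.
  + by have := @epol1_cvg R ((s + h) * radius M); rewrite -cvg_shiftS.
  + by have := @epol1_cvg R (s * radius M); rewrite -cvg_shiftS.
  + by apply: cvgM; [exact: cvg_cst | exact: epol1_cvg].
- move=> K; apply: le_trans (lam_bound _ ZM) _; apply: le_trans (pabsM _ _ B0) _.
  by rewrite pabs_nonneg.
Qed.

End LamExp.

(** * Root sums with integer exponents and their Laurent expansions in Z *)

Section Mu.
Variable R : realType.
Local Notation C := (Cplx R).
Variables (N L : nat).
Hypotheses (N_gt0 : (0 < N)%N) (ltNL : (N < L)%N).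
Implicit Types (P Q : {poly C}) (Z : C) (s h : R) (a b : int) (M : nat).

Definition pNL : {poly C} := 'X^N * ('X + 1) ^+ (L - N).

Let L_gt0 : (0 < L)%N. Proof. exact: leq_ltn_trans ltNL. Qed.

Lemma Xp1E : 'X + 1 = 'X - (-1)%:P :> {poly C}.
Proof. by rewrite polyCN opprK. Qed.

Lemma pNL_monic : pNL \is monic.
Proof. by rewrite rpredM ?monicXn // rpredX // Xp1E monicXsubC. Qed.

Lemma size_Xp1n n : size (('X + 1 : {poly C}) ^+ n) = n.+1.
Proof. by rewrite Xp1E size_exp_XsubC. Qed.

Lemma size_XnXp1n i j : size ('X^i * ('X + 1) ^+ j : {poly C}) = (i + j).+1.
Proof.
by rewrite size_monicM ?monicXn ?size_polyXn ?size_Xp1n ?addnS //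
  -size_poly_eq0 size_Xp1n.
Qed.

Lemma size_pNL : size pNL = L.+1.
Proof. by rewrite size_XnXp1n subnKC // ltnW. Qed.

Lemma pNL_horner (w : C) : pNL.[w] = w ^+ N * (w + 1) ^+ (L - N).
Proof. by rewrite hornerM hornerXn horner_exp hornerD hornerX hornerC. Qed.

(** The weight w^a (w+1)^b multiplied by p(w)^M. Under [adm] both exponents are nonnegative and the
    absolute values are harmless. *)
Definition fpoly a b M : {poly C} :=
  'X^((absz (a + (N * M)%:Z)%R)) * ('X + 1) ^+ ((absz (b + ((L - N) * M)%:Z)%R)).

Definition adm a b M : bool := (0 <= a + (N * M)%:Z) && (0 <= b + ((L - N) * M)%:Z).

Lemma adm_abs a b : adm a b (`|a|%N + `|b|%N).
Proof.
by rewrite /adm; apply/andP; split; nia.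
Qed.

Lemma adm_leq a b M M' : (M <= M')%N -> adm a b M -> adm a b M'.
Proof.
move=> MM /andP[h1 h2]; rewrite /adm.
have e1 : (N * M <= N * M')%N by rewrite leq_mul2l MM orbT.
have e2 : ((L - N) * M <= (L - N) * M')%N by rewrite leq_mul2l MM orbT.
by apply/andP; split; lia.
Qed.

Lemma fpoly_shift a b M j : adm a b M -> fpoly a b (M + j) = pNL ^+ j * fpoly a b M.
Proof.
move=> /andP[h1 h2]; rewrite /fpoly /pNL exprMn -!exprM.
have -> : (absz (a + (N * (M + j))%:Z)%R) = (N * j + (absz (a + (N * M)%:Z)%R))%N by lia.
have -> : (absz (b + ((L - N) * (M + j))%:Z)%R)
   = ((L - N) * j + (absz (b + ((L - N) * M)%:Z)%R))%N by set D := (L - N)%N in h2 *; rewrite mulnDr; lia.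
by rewrite !exprD; ring.
Qed.

(* The sum of [w^a (w+1)^b exp(s w) / p'(w)] over the roots of [p(w) = Z], see
   [mu_lagrange], in a form that also makes sense at multiple roots: negative
   exponents are removed by means of [p(w) = Z]. *)
Definition mu a b s Z : C :=
  Z ^- (`|a|%N + `|b|%N) * Lam pNL Z (fpoly a b (`|a|%N + `|b|%N)) s.

(** Raising [M] by j multiplies the polynomial by p^j and hence [Lam] by Z^j, which the prefactor
    compensates. *)
Lemma muE a b s Z M : adm a b M -> Z != 0 -> 0 <= s ->
  mu a b s Z = Z ^- M * Lam pNL Z (fpoly a b M) s.
Proof.
move=> ab Z0 s0; rewrite /mu; set M0 := (_ + _)%N.
have sh M1 M2 : adm a b M1 -> Z ^- M1 * Lam pNL Z (fpoly a b M1) s =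
    Z ^- (M1 + M2) * Lam pNL Z (fpoly a b (M1 + M2)) s.
  move=> h; rewrite fpoly_shift // (Lam_mulpX L_gt0 pNL_monic size_pNL) //.
  by rewrite exprD invfM -mulrA mulKf // expf_neq0.
by rewrite (sh M0 M) ?adm_abs // (sh M M0) // addnC.
Qed.

(** The relation p(w) = Z under the sum. It links the last row to the first one when the last
    particle is blocked. *)
Lemma mu_shift a b s Z : Z != 0 -> 0 <= s ->
  mu (a + N%:Z) (b + (L - N)%:Z) s Z = Z * mu a b s Z.
Proof.
move=> Z0 s0; set M := (`|a| + `|b|)%N.
have ab : adm a b M by exact: adm_abs.
rewrite (@muE _ _ s Z M _ Z0 s0); last first.
  by move: ab => /andP[h1 h2]; apply/andP; split; lia.
have -> : fpoly (a + N%:Z) (b + (L - N)%:Z) M = fpoly a b (M + 1).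
  by rewrite /fpoly; congr ('X^_ * _ ^+ _); congr absz; rewrite mulnDr muln1; lia.
by rewrite fpoly_shift // expr1 (Lam_mulp L_gt0 pNL_monic size_pNL) // mulrCA.
Qed.

(** (w+1)^(b+1) = w (w+1)^b + (w+1)^b under the sum. The left-hand side is a row after a jump, and
    the factor w is a time derivative. *)
Lemma mu_split a b s Z : Z != 0 -> 0 <= s ->
  mu a (b + 1) s Z = mu (a + 1) b s Z + mu a b s Z.
Proof.
move=> Z0 s0; set M := (`|a| + `|b|)%N.
have ab : adm a b M by exact: adm_abs.
have [h1 h2] := andP ab.
rewrite (@muE a b s Z M) // (@muE a (b + 1) s Z M) //; last by apply/andP; split; lia.
rewrite (@muE (a + 1) b s Z M) //; last by apply/andP; split; lia.
have -> : fpoly a (b + 1) M = fpoly (a + 1) b M + fpoly a b M.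
  rewrite /fpoly.
  have -> : (absz (a + 1 + (N * M)%:Z)%R) = (absz (a + (N * M)%:Z)%R).+1 by lia.
  have -> : (absz (b + 1 + ((L - N) * M)%:Z)%R) = (absz (b + ((L - N) * M)%:Z)%R).+1.
    by set D := (L - N)%N in h2 *; lia.
  by rewrite !exprS; ring.
by rewrite (LamD L_gt0 pNL_monic size_pNL) // mulrDr.
Qed.

Lemma fpoly_addl a b (c : nat) M : adm a b M -> fpoly (a + c%:Z) b M = 'X^c * fpoly a b M.
Proof.
move=> /andP[h1 h2]; rewrite /fpoly mulrA -exprD; congr ('X^_ * _).
by lia.
Qed.

Lemma fpolyM a b a' b' M M' : adm a b M -> adm a' b' M' ->
  fpoly a b M * fpoly a' b' M' = fpoly (a + a') (b + b') (M + M').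
Proof.
move=> /andP[h1 h2] /andP[h3 h4]; rewrite /fpoly mulrACA -!exprD.
by congr ('X^_ * _ ^+ _); rewrite mulnDr; lia.
Qed.

(** Each factor is cleared of negative exponents by its own power of [Z]. Time sits in the second
    one only, the first being a row at time zero. *)
Lemma mu_repro a b a' b' s Z : Z != 0 -> 0 <= s ->
  \sum_(c < L) \sum_(d < L)
     mu (a + c%:Z) b 0 Z * pNL`_(d + c).+1 * mu (d%:Z + a') b' s Z
  = mu (a + a') (b + b') s Z.
Proof.
move=> Z0 s0.
set M := (`|a| + `|b|)%N; set M' := (`|a'| + `|b'|)%N.
have ab : adm a b M by exact: adm_abs.
have ab' : adm a' b' M' by exact: adm_abs.
rewrite (@muE (a + a') (b + b') s Z (M + M')) //; last first.
  move: ab ab' => /andP[h1 h2] /andP[h3 h4]; apply/andP; split; rewrite mulnDr; lia.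
rewrite -fpolyM // (Lam_repro L_gt0 pNL_monic size_pNL) // exprD invfM.
rewrite mulr_sumr; apply: eq_bigr => c _; rewrite mulr_sumr; apply: eq_bigr => d _.
rewrite (@muE (a + c%:Z) b 0 Z M) //; last by move: ab => /andP[h1 h2]; apply/andP; split; lia.
rewrite [(d : nat)%:Z + a']addrC (@muE (a' + d%:Z) b' s Z M') //; last by move: ab' => /andP[h1 h2]; apply/andP; split; lia.
rewrite !fpoly_addl // (Lam0 L_gt0 pNL_monic size_pNL) [_ * fpoly a b M]mulrC; ring.
Qed.

Lemma mu_lagrange a b s Z (rs : seq C) : Z != 0 -> 0 <= s -> uniq rs ->
    (forall w, w \in rs -> pNL.[w] = Z) -> size rs = L ->
  mu a b s Z = \sum_(w <- rs) w ^ a * (w + 1) ^ b * cexp ((s%:C)%C * w) / pNL^`().[w].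
Proof.
move=> Z0 s0 urs rsZ srs; set M := (`|a| + `|b|)%N.
have ab : adm a b M by exact: adm_abs.
rewrite (@muE a b s Z M) // (Lam_lagrange L_gt0 pNL_monic size_pNL _ s0 urs) //; last first.
  by apply/allP => w wr; rewrite rootE hornerD hornerN hornerC rsZ // subrr.
rewrite mulr_sumr big_seq [RHS]big_seq; apply: eq_bigr => w wr.
(* At a root, dividing by Z^M undoes the multiplication by p(w)^M. *)
suff key : Z ^- M * (fpoly a b M).[w] = w ^ a * (w + 1) ^ b by rewrite !mulrA key.
have [h1 h2] := andP ab.
have wN := rsZ w wr; rewrite pNL_horner in wN.
have LN : (0 < L - N)%N by rewrite subn_gt0.
have w0 : w != 0.
  by apply: contra_neq Z0 => w0; rewrite -wN w0 expr0n gtn_eqF // mul0r.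
have w1 : w + 1 != 0.
  by apply: contra_neq Z0 => w0'; rewrite -wN w0' expr0n gtn_eqF // mulr0.
apply: (mulfI (expf_neq0 M Z0)). rewrite mulVKf ?expf_neq0 //.
rewrite /fpoly hornerM hornerXn horner_exp hornerD hornerX hornerC.
have -> : w ^+ (absz (a + (N * M)%:Z)%R) = w ^ a * (w ^+ N) ^+ M.
  by rewrite -exprM !exprnP gez0_abs // expfzDr.
have -> : (w + 1) ^+ (absz (b + ((L - N) * M)%:Z)%R) = (w + 1) ^ b * ((w + 1) ^+ (L - N)) ^+ M.
  by rewrite -exprM !exprnP gez0_abs // expfzDr.
by rewrite -wN exprMn; ring.
Qed.

Lemma pabs_fpoly a b M x : 0 <= x ->
  (pabs (fpoly a b M)).[x] <= (x + 1) ^+ (`|a| + `|b| + L * M)%N.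
Proof.
move=> x0; have x1 : 0 <= x + 1 by rewrite addr_ge0.
have pX : (pabs 'X).[x] <= x + 1.
  have -> : pabs ('X : {poly C}) = 'X :> {poly R}.
    by apply/polyP => k; rewrite coef_pabs !coefX; case: eqP; rewrite ?nrm1 ?nrm0.
  by rewrite hornerX lerDl.
have pX1 : (pabs ('X + 1)).[x] <= x + 1.
  apply: le_trans (pabsD _ _ x0) _; rewrite pabs1 lerD2r.
  have -> : pabs ('X : {poly C}) = 'X :> {poly R}.
    by apply/polyP => k; rewrite coef_pabs !coefX; case: eqP; rewrite ?nrm1 ?nrm0.
  by rewrite hornerX.
apply: le_trans (pabsM _ _ x0) _.
apply: (@le_trans _ _ ((x + 1) ^+ (absz (a + (N * M)%:Z)%R) * (x + 1) ^+ (absz (b + ((L - N) * M)%:Z)%R))).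
  apply: ler_pM; rewrite ?pabs_ge0 //; apply: le_trans (pabsX _ _ x0) _;
  by rewrite lerXn2r // nnegrE ?pabs_ge0.
rewrite -exprD; apply: ler_weXn2l; first by rewrite lerDr.
have -> : (L * M = N * M + (L - N) * M)%N by rewrite -mulnDl subnKC // ltnW.
lia.
Qed.

(** The price of one unit of |a| + |b|: a factor 1 / |Z| and at most [L.+1] degrees of the
    polynomial. *)
Definition mu_base (lo hi : R) : R := lo^-1 * (radius pNL L hi + 1) ^+ L.+1.

Lemma mu_bound a b s Z (lo hi : R) : 0 < lo -> lo <= nrm Z -> nrm Z <= hi -> 0 <= s ->
  nrm (mu a b s Z) <= mu_base lo hi ^+ (`|a| + `|b|) * expR (s * radius pNL L hi).
Proof.
move=> lo0 loZ Zhi s0; set M := (`|a| + `|b|)%N.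
have hi0 : 0 <= hi by apply: le_trans Zhi; exact: nrm_ge0.
have B0 := radius_ge0 pNL L hi0.
rewrite /mu nrmM /mu_base exprMn -mulrA; apply: ler_pM; rewrite ?nrm_ge0 //.
  rewrite nrmV nrmX -exprVn lerXn2r ?nnegrE ?invr_ge0 ?nrm_ge0 ?(ltW lo0) //.
  by rewrite lef_pV2 // posrE // (lt_le_trans lo0).
apply: le_trans (Lam_bound L_gt0 pNL_monic size_pNL _ Zhi s0) _.
rewrite ler_wpM2r ?expR_ge0 //; apply: le_trans (pabs_fpoly _ _ _ B0) _.
by rewrite -exprM mulSn.
Qed.

(** Multiply exp(-x) >= 1 - x by (1 + x) exp(x). *)
Lemma expR_taylor2 (x : R) : 0 <= x -> expR x - 1 - x <= x ^+ 2 * expR x.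
Proof.
move=> x0; have h1 := expR_ge1Dx (- x); have h2 : 0 < expR x := expR_gt0 x.
have h3 : expR x * expR (- x) = 1 by rewrite -expRD subrr expR0.
have h4 : (1 + x) * (1 + - x) <= (1 + x) * expR (- x) by rewrite ler_wpM2l // addr_ge0.
have h5 : expR x * ((1 + x) * (1 + - x)) <= expR x * ((1 + x) * expR (- x)).
  by rewrite ler_wpM2l // ltW.
have h6 : expR x * ((1 + x) * expR (- x)) = 1 + x by rewrite mulrCA h3 mulr1.
rewrite h6 in h5; nra.
Qed.

Lemma mu_taylor a b (lo hi T : R) : 0 < lo ->
  exists2 c : R, 0 <= c & forall Z s h, lo <= nrm Z -> nrm Z <= hi ->
    0 <= s -> 0 <= h -> s + h <= T ->
  nrm (mu a b (s + h) Z - mu a b s Z - (h%:C)%C * mu (a + 1) b s Z) <= c * h ^+ 2.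
Proof.
move=> lo0; set M := (`|a| + `|b|)%N; set B := radius pNL L hi.
(* For [hi < 0] no [Z] satisfies the bounds. *)
have [hi0|hi0] := leP 0 hi; last first.
  by exists 0 => // Z s h _ Zhi; have := nrm_ge0 Z; rewrite leNgt (le_lt_trans Zhi hi0).
have B0 : 0 <= B := radius_ge0 pNL L hi0.
have pB := pabs_ge0 (fpoly a b M) B0.
exists (lo ^- M * ((pabs (fpoly a b M)).[B] * (B ^+ 2 * expR (T * B)))).
  by rewrite !mulr_ge0 ?invr_ge0 ?exprn_ge0 ?expR_ge0 // ltW.
move=> Z s h loZ Zhi s0 h0 shT.
have Z0 : Z != 0 by rewrite -nrm_gt0 (lt_le_trans lo0).
have ab : adm a b M by exact: adm_abs.
have [h1 h2] := andP ab.
rewrite (@muE (a + 1) b s Z M) //; last by apply/andP; split; lia.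
rewrite (@muE a b s Z M) // (@muE a b (s + h) Z M) ?addr_ge0 //.
rewrite (fpoly_addl 1 ab) expr1 [_%:C%C * _]mulrCA -!mulrBr nrmM -mulrA.
apply: ler_pM; rewrite ?nrm_ge0 //.
  rewrite nrmV nrmX -!exprVn lerXn2r ?nnegrE ?invr_ge0 ?nrm_ge0 ?(ltW lo0) //.
  by rewrite lef_pV2 // posrE // (lt_le_trans lo0).
apply: le_trans (Lam_taylor L_gt0 pNL_monic size_pNL _ Zhi s0 h0) _.
rewrite -[X in _ <= X]mulrA -/B; apply: ler_wpM2l => //.
have hB : 0 <= h * B by rewrite mulr_ge0.
have := expR_taylor2 hB; rewrite mulrDl expRD => h3.
have h4 : expR (s * B) * expR (h * B) <= expR (T * B).
  by rewrite -expRD -mulrDl ler_expR ler_wpM2r.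
have h5 : expR (s * B) * (expR (h * B) - 1 - h * B) <=
    expR (s * B) * ((h * B) ^+ 2 * expR (h * B)).
  by rewrite ler_wpM2l // expR_ge0.
have h6 : (h * B) ^+ 2 * (expR (s * B) * expR (h * B)) <= (h * B) ^+ 2 * expR (T * B).
  by rewrite ler_wpM2l // sqr_ge0.
nra.
Qed.

(* Laurent expansion in [Z] when the weight is a polynomial. *)
Lemma mu_expand_pos a b (e c : nat) : adm a b e ->
  exists (E : nat -> C) (d : nat), [/\ forall n, (d <= n)%N -> E n = 0,
    E 0%N = lamc pNL L 0 (fpoly a b e * 'X^c) &
    forall Z, Z != 0 -> Z ^+ e * mu (a + c%:Z) b 0 Z = \sum_(n < d) E n * Z ^+ n].
Proof.
move=> ab; have [h1 h2] := andP ab.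
pose F := fpoly a b e * 'X^c; pose d := (size F).+1.
exists (fun n => lamc pNL L n F), d; split => // [n dn|Z Z0].
  apply: (lamc_small pNL_monic size_pNL).
  apply: leq_trans (leq_addr _ _); apply: (leq_trans (ltnW dn)); exact: leq_pmulr.
rewrite (@muE _ _ _ _ e) //; last by apply/andP; split; lia.
rewrite mulVKf ?expf_neq0 // (Lam0 L_gt0 pNL_monic size_pNL) fpoly_addl // mulrC.
apply: (lam_expand L_gt0 pNL_monic size_pNL).
by apply: (leq_trans (leqnSn _)); rewrite leq_pmulr.
Qed.

(* Laurent expansion in [Z] when the weight has small degree at infinity. *)
Lemma mu_expand_neg a b (e c : nat) : (c < L)%N -> a + b + (e * L)%:Z + 2 <= L%:Z ->
  exists (E : nat -> C) (d : nat), [/\ forall n, (d <= n)%N -> E n = 0,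
    a + b + (e * L)%:Z < 0 -> E 0%N = 0 &
    forall Z, Z != 0 -> Z ^+ e * mu (a + c%:Z) b 0 Z = \sum_(n < d) E n * Z ^- n].
Proof.
move=> cL hdeg; pose M := (e + (`|a| + `|b|))%N.
have ab : adm a b M by apply: adm_leq (adm_abs a b); rewrite leq_addl.
have [h1 h2] := andP ab.
pose F := fpoly (a + c%:Z) b M.
have sF : (size F)%:Z = a + b + c%:Z + (L * M)%:Z + 1.
  rewrite /F fpoly_addl // /fpoly mulrA -exprD size_XnXp1n.
  have -> : (L * M = N * M + (L - N) * M)%N by rewrite -mulnDl subnKC // ltnW.
  by lia.
have lF n : (size F <= n * L + L.-1)%N -> lamc pNL L n F = 0.
  exact: (lamc_small pNL_monic size_pNL).
(* The degree of [F] makes [lamc n F] vanish for n > m, and also for n = m when a + b + e L < 0;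
   division by Z^m leaves only nonpositive powers. *)
pose m := (M - e)%N; have mE : M = (e + m)%N by rewrite /m /M addnC addnK addnC.
exists (fun n => if (n <= m)%N then lamc pNL L (m - n) F else 0), m.+1; split.
- by move=> n mn; rewrite leqNgt mn.
- by move=> dneg; rewrite leq0n subn0; apply: lF; lia.
move=> Z Z0; rewrite (@muE _ _ _ _ M) //; last by apply/andP; split; lia.
rewrite (Lam0 L_gt0 pNL_monic size_pNL) -/F.
rewrite (@lam_expand _ pNL L L_gt0 pNL_monic size_pNL Z (m.+1 + size F)); last first.
  by rewrite mulnDl; apply: leq_trans (leq_addl _ _); rewrite leq_pmulr.
rewrite big_split_ord /= [X in _ * (_ + X)]big1 ?addr0; last first.
  move=> i _. rewrite lF ?mul0r //.
  by rewrite mulnDl mulSn; lia.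
rewrite (reindex_inj rev_ord_inj) mulrA mulr_sumr.
apply: eq_bigr => i _; rewrite /= subSS.
have im : (i <= m)%N by rewrite -ltnS.
rewrite im mulrCA; congr (_ * _).
have -> : Z ^+ e / Z ^+ M = Z ^- m.
  by rewrite mE exprD invfM mulrA mulfV ?expf_neq0 // mul1r.
rewrite -[in Z ^- m](subnK im) exprD invfM mulrAC mulVf ?expf_neq0 // mul1r //.
Qed.

End Mu.

(** * Circle integrals *)

Section CircleMean.
Variable R : realType.
Local Notation C := (Cplx R).
Implicit Types (x y r : R) (g : C -> C).

Definition cis x : C := (cos x +i* sin x)%C.

Lemma circleE r x : circle r x = (r%:C)%C * cis x.
Proof. by rewrite /circle /cexp /= expR0 mul1r. Qed.

Lemma cisD x y : cis (x + y) = cis x * cis y.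
Proof. by apply/eqP; rewrite eq_complex /= cosD sinD eqxx /= addrC. Qed.

Lemma cis0 : cis 0 = 1.
Proof. by rewrite /cis cos0 sin0. Qed.

Lemma nrm_cis x : nrm (cis x) = 1.
Proof. by rewrite /nrm normc_def /= cos2Dsin2 sqrtr1. Qed.

Lemma cis_neq0 x : cis x != 0.
Proof. by rewrite -nrm_gt0 nrm_cis. Qed.

Lemma nrm_circle r x : 0 <= r -> nrm (circle r x) = r.
Proof. by move=> r0; rewrite circleE nrmM nrm_cis nrm_real mulr1 ger0_norm. Qed.

Lemma circle_neq0 r x : 0 < r -> circle r x != 0.
Proof. by move=> r0; rewrite -nrm_gt0 nrm_circle // ltW. Qed.

Lemma cisXn x n : cis x ^+ n = cis (n%:R * x).
Proof.
elim: n => [|n IH]; first by rewrite expr0 mul0r cis0.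
by rewrite exprS IH -cisD -natr1 mulrDl mul1r addrC.
Qed.

Lemma cisXz x (n : int) : cis x ^ n = cis (n%:~R * x).
Proof.
case: n => n; first by rewrite -exprnP cisXn.
have -> : (Negz n)%:~R * x = - (n.+1%:R * x) by rewrite NegzE mulrNz mulNr.
apply: (mulfI (cis_neq0 (n.+1%:R * x))).
rewrite -cisD subrr cis0 NegzE -exprnN -cisXn mulfV //.
by rewrite cisXn cis_neq0.
Qed.

Lemma cis2pi : cis (2 * pi) = 1.
Proof. by rewrite /cis mulr_natl cos2pi sin2pi. Qed.

Lemma cis_period (n : int) : cis (n%:~R * (2 * pi)) = 1.
Proof. by rewrite -cisXz cis2pi exp1rz. Qed.

Lemma cis_dist x y : nrm (cis x - cis y) <= `|cos x - cos y| + `|sin x - sin y|.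
Proof. exact: nrm_le_ReIm. Qed.

(** Uniform, because the same property has to be recovered for functions obtained by integrating
    over inner variables. *)
Definition uc1 r g := forall e, 0 < e -> exists2 d, 0 < d &
  forall z z' : C, nrm z = r -> nrm z' = r -> nrm (z - z') < d -> nrm (g z - g z') < e.

Lemma uc1_near r g x : 0 < r -> uc1 r g -> forall e, 0 < e ->
  \forall y \near x, nrm (g (circle r x) - g (circle r y)) < e.
Proof.
move=> r0 ug e e0; have [d d0 Hd] := ug e e0.
have d2 : 0 < d / r / 2 by rewrite !divr_gt0.
have /cvgrPdist_lt /(_ _ d2) Hc := @continuous_cos R x.
have /cvgrPdist_lt /(_ _ d2) Hs := @continuous_sin R x.
near=> y; apply: Hd; rewrite ?nrm_circle ?(ltW r0) //.
rewrite !circleE -mulrBr nrmM nrm_real gtr0_norm // -ltr_pdivlMl // mulrC.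
apply: le_lt_trans (cis_dist _ _) _.
rewrite [_ / _]splitr ltrD //; first by near: y.
by near: y.
Unshelve. all: by end_near. Qed.

Lemma uc1_Re_continuous r g : 0 < r -> uc1 r g ->
  continuous (fun x => complex.Re (g (circle r x)) : R^o).
Proof.
move=> r0 ug x; apply/cvgrPdist_lt => e e0.
apply: filterS (uc1_near x r0 ug e0) => y; apply: le_lt_trans.
by rewrite -ReN -ReD ler_Re_nrm.
Qed.

Lemma uc1_Im_continuous r g : 0 < r -> uc1 r g ->
  continuous (fun x => complex.Im (g (circle r x)) : R^o).
Proof.
move=> r0 ug x; apply/cvgrPdist_lt => e e0.
apply: filterS (uc1_near x r0 ug e0) => y; apply: le_lt_trans.
by rewrite -ImN -ImD ler_Im_nrm.
Qed.

Local Notation mu := (@lebesgue_measure R).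
Local Notation I := (`[(0 : R), 2 * pi]%classic).

Lemma continuous_integrable_2pi (f : R -> R^o) : continuous f ->
  mu.-integrable I (EFin \o f).
Proof.
move=> cf; apply: continuous_compact_integrable; first exact: segment_compact.
exact: continuous_subspaceT.
Qed.

(** With dz / (2 pi i z) as measure the contour integral is the mean over the circle, as [omeanE]
    shows. *)
Definition omean r g : C := oint r (fun z => g z / ((((2 * pi) *i)%C : C) * z)).

Lemma pi2_neq0 : 2 * pi != 0 :> R.
Proof. by rewrite mulf_neq0 // gt_eqF // pi_gt0. Qed.

Lemma omeanE r g : 0 < r -> uc1 r g -> omean r g =
  ((\int[mu]_(x in I) complex.Re (g (circle r x))) / (2 * pi)
  +i* ((\int[mu]_(x in I) complex.Im (g (circle r x))) / (2 * pi)))%C.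
Proof.
move=> r0 ug; rewrite /omean /oint /cintegral.
have E x : g (circle r x) / ((((2 * pi) *i)%C : C) * circle r x) *
   (('i%C : C) * circle r x) = (((2 * pi)^-1)%:C)%C * g (circle r x).
  have -> : ((2 * pi) *i)%C = ((2 * pi)%:C)%C * ('i%C : C) :> C.
    by apply/eqP; rewrite eq_complex /=; apply/andP; split; apply/eqP; ring.
  have c0 := circle_neq0 x r0.
  have i0 : ('i%C : C) != 0 by rewrite eq_complex /= negb_and oner_neq0 orbT.
  have p0 : ((2 * pi)%:C)%C != 0 :> C by rewrite -nrm_gt0 nrm_real normr_gt0 pi2_neq0.
  rewrite real_complexV; move: ((2 * pi)%:C)%C p0 (circle r x) c0 => P p0 c c0.
  by field; rewrite i0 p0 c0.
congr Complex.
  rewrite -RintegralZr //; last exact/continuous_integrable_2pi/uc1_Re_continuous.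
  by apply: eq_Rintegral => x _; rewrite E; case: (g _) => a b /=; ring.
rewrite -RintegralZr //; last exact/continuous_integrable_2pi/uc1_Im_continuous.
by apply: eq_Rintegral => x _; rewrite E; case: (g _) => a b /=; ring.
Qed.

Lemma uc1D r g1 g2 : uc1 r g1 -> uc1 r g2 -> uc1 r (fun z => g1 z + g2 z).
Proof.
move=> u1 u2 e e0; have e2 : 0 < e / 2 by rewrite divr_gt0.
have [d1 d10 H1] := u1 _ e2; have [d2 d20 H2] := u2 _ e2.
exists (Num.min d1 d2) => [|z z' zr z'r]; first by rewrite lt_min d10.
rewrite lt_min => /andP[h1 h2].
have -> : g1 z + g2 z - (g1 z' + g2 z') = (g1 z - g1 z') + (g2 z - g2 z') by ring.
by apply: le_lt_trans (nrmD _ _) _; rewrite [e]splitr ltrD // ?H1 ?H2.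
Qed.

Lemma uc1Z r c g : uc1 r g -> uc1 r (fun z => c * g z).
Proof.
move=> u e e0; have c0 : 0 < nrm c + 1 by rewrite ltr_wpDl ?nrm_ge0.
have [d d0 H] := u _ (divr_gt0 e0 c0).
exists d => // z z' zr z'r h; rewrite -mulrBr nrmM.
apply: (@le_lt_trans _ _ ((nrm c + 1) * nrm (g z - g z'))).
  by rewrite ler_wpM2r ?nrm_ge0 // lerDl.
by rewrite -ltr_pdivlMl // mulrC; apply: H.
Qed.

Lemma Rint_lin (f1 f2 : R -> R) (a b : R) :
  continuous (f1 : R -> R^o) -> continuous (f2 : R -> R^o) ->
  (\int[mu]_(x in I) (a * f1 x + b * f2 x)) / (2 * pi) =
  a * ((\int[mu]_(x in I) f1 x) / (2 * pi)) + b * ((\int[mu]_(x in I) f2 x) / (2 * pi)).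
Proof.
move=> c1 c2; have i1 := continuous_integrable_2pi c1; have i2 := continuous_integrable_2pi c2.
have cZ (f : R -> R) (c : R) : continuous (f : R -> R^o) ->
    continuous ((fun x => c * f x) : R -> R^o).
  by move=> cf x; apply: cvgM; [exact: cvg_cst | exact: cf].
rewrite RintegralD //; try exact/continuous_integrable_2pi/cZ.
by rewrite !RintegralZl // mulrDl !mulrA.
Qed.

Lemma omeanD r g1 g2 : 0 < r -> uc1 r g1 -> uc1 r g2 ->
  omean r (fun z => g1 z + g2 z) = omean r g1 + omean r g2.
Proof.
move=> r0 u1 u2; rewrite !omeanE //; last exact: uc1D.
apply/eqP; rewrite eq_complex /=; apply/andP; split; apply/eqP.
  have := Rint_lin 1 1 (uc1_Re_continuous r0 u1) (uc1_Re_continuous r0 u2).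
  rewrite !mul1r => <-; congr (_ / _); apply: eq_Rintegral => x _.
  by rewrite ReD !mul1r.
have := Rint_lin 1 1 (uc1_Im_continuous r0 u1) (uc1_Im_continuous r0 u2).
rewrite !mul1r => <-; congr (_ / _); apply: eq_Rintegral => x _.
by rewrite ImD !mul1r.
Qed.

Lemma omeanZ r c g : 0 < r -> uc1 r g -> omean r (fun z => c * g z) = c * omean r g.
Proof.
move=> r0 u; rewrite !omeanE //; last exact: uc1Z.
case: c => a b; apply/eqP; rewrite eq_complex /=; apply/andP; split; apply/eqP.
  have := Rint_lin a (- b) (uc1_Re_continuous r0 u) (uc1_Im_continuous r0 u).
  rewrite mulNr => <-; congr (_ / _); apply: eq_Rintegral => x _.
  by case: (g _) => ? ? /=; rewrite mulNr.
rewrite -(Rint_lin a b (uc1_Im_continuous r0 u) (uc1_Re_continuous r0 u)).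
by congr (_ / _); apply: eq_Rintegral => x _; case: (g _) => ? ? /=.
Qed.

Lemma omean_ext r g1 g2 : 0 <= r -> (forall z, nrm z = r -> g1 z = g2 z) ->
  omean r g1 = omean r g2.
Proof.
move=> r0 E; rewrite /omean /oint; congr cintegral; apply/funext => x.
by rewrite E // nrm_circle.
Qed.

Lemma Rint_bound (f : R -> R) B : continuous (f : R -> R^o) -> (forall x, `|f x| <= B) ->
  `|(\int[mu]_(x in I) f x) / (2 * pi)| <= B.
Proof.
move=> cf fB; have p0 : 0 < 2 * pi :> R by rewrite mulr_gt0 // pi_gt0.
rewrite normrM normfV (gtr0_norm p0) ler_pdivrMr //.
have ci := continuous_integrable_2pi cf.
apply: le_trans (le_normr_Rintegral _ ci) _ => //.
apply: (@le_trans _ _ (\int[mu]_(x in I) cst B x)).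
  apply: le_Rintegral => //.
    apply: continuous_integrable_2pi => x.
    by apply: continuous_comp; [exact: cf | exact: norm_continuous].
  by apply: continuous_integrable_2pi => x; exact: cvg_cst.
rewrite Rintegral_cst //= lebesgue_measure_itv /= lte_fin p0 /= oppr0 addr0 //.
Qed.

(** The factor 2 comes from bounding real and imaginary parts separately. *)
Lemma omean_bound r g B : 0 < r -> uc1 r g -> (forall z, nrm z = r -> nrm (g z) <= B) ->
  nrm (omean r g) <= 2 * B.
Proof.
move=> r0 u gB; rewrite omeanE //; apply: le_trans (nrm_le_ReIm _) _ => /=.
have -> : 2 * B = B + B by ring.
apply: lerD; apply: Rint_bound.
- exact: uc1_Re_continuous.
- by move=> x; apply: le_trans (ler_Re_nrm _) _; rewrite gB // nrm_circle // ltW.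
- exact: uc1_Im_continuous.
- by move=> x; apply: le_trans (ler_Im_nrm _) _; rewrite gB // nrm_circle // ltW.
Qed.

(** The primitives sin(c x) / c and -cos(c x) / c take the same values at 0 and 2 pi by
    periodicity. *)
Lemma int_trig (c : R) : c != 0 -> cis (c * (2 * pi)) = 1 ->
  (\int[mu]_(x in I) cos (c * x) = 0) /\ (\int[mu]_(x in I) sin (c * x) = 0).
Proof.
move=> c0 [h1 h2]; have p0 : 0 < 2 * pi :> R by rewrite mulr_gt0 // pi_gt0.
have cM : continuous (fun x : R => c * x : R^o) by move=> x; exact: mulrl_continuous.
have cc : continuous (fun x : R => cos (c * x) : R^o).
  by move=> x; apply: (continuous_comp (cM x)); exact: continuous_cos.
have cs : continuous (fun x : R => sin (c * x) : R^o).
  by move=> x; apply: (continuous_comp (cM x)); exact: continuous_sin.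
have LR (F : R -> R) : (forall x : R, derivable F x 1) -> derivable_oo_LRcontinuous F 0 (2 * pi).
  move=> dF; have cF : continuous F.
    by move=> x; apply: differentiable_continuous; apply/derivable1_diffP.
  by split=> [x _ //||]; [apply: cvg_at_right_filter|apply: cvg_at_left_filter]; exact: cF.
have dM (x : R) : is_derive x 1 (fun x : R => c * x) c.
  have H := is_deriveZ (f := id) c (is_derive_id x 1).
  by apply: is_derive_eq H _; rewrite /GRing.scale /= mulr1.
have ds (x : R) : is_derive x 1 (fun x => sin (c * x)) (c * cos (c * x)).
  apply: is_derive_eq (is_derive1_comp (is_derive_sin (c * x)) (dM x)) _.
  by rewrite mulrC.
have dc (x : R) : is_derive x 1 (fun x => cos (c * x)) (c * - sin (c * x)).
  apply: is_derive_eq (is_derive1_comp (is_derive_cos (c * x)) (dM x)) _.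
  by rewrite mulrC.
have ds' (x : R) : is_derive x 1 (fun x => c^-1 * sin (c * x)) (cos (c * x)).
  by apply: is_derive_eq (is_deriveZ c^-1 (ds x)) _; rewrite /GRing.scale /= mulKf.
have dc' (x : R) : is_derive x 1 (fun x => - c^-1 * cos (c * x)) (sin (c * x)).
  apply: is_derive_eq (is_deriveZ (- c^-1) (dc x)) _.
  by rewrite /GRing.scale /= mulrN mulrNN mulKf.
split; rewrite /Rintegral.
  rewrite (@continuous_FTC2 _ _ (fun x => c^-1 * sin (c * x)) _ _ p0) ?h2 ?mulr0 ?sin0 //=.
  - by rewrite mulr0 subrr.
  - exact: continuous_subspaceT.
  - by apply: LR => x; have [] := ds' x.
  - by move=> x _; rewrite derive1E; have [_] := ds' x.
rewrite (@continuous_FTC2 _ _ (fun x => - c^-1 * cos (c * x)) _ _ p0) ?h1 ?mulr0 ?cos0 //=.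
- by rewrite subrr.
- exact: continuous_subspaceT.
- by apply: LR => x; have [] := dc' x.
- by move=> x _; rewrite derive1E; have [_] := dc' x.
Qed.

Lemma omean_cst r (c : C) : 0 < r -> omean r (fun _ => c) = c.
Proof.
move=> r0; have p0 : 0 < 2 * pi :> R by rewrite mulr_gt0 // pi_gt0.
rewrite omeanE //; last by move=> e e0; exists 1 => // *; rewrite subrr nrm0.
rewrite !Rintegral_cst //= lebesgue_measure_itv /= lte_fin p0 /= oppr0 addr0.
by rewrite !mulfK ?gt_eqF //; case: c.
Qed.

Lemma omean_Xz r (n : int) : 0 < r -> n != 0 -> uc1 r (fun z => z ^ n) ->
  omean r (fun z => z ^ n) = 0.
Proof.
move=> r0 n0 u; rewrite omeanE //.
have E x : circle r x ^ n = ((r ^ n)%:C)%C * cis (n%:~R * x).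
  rewrite circleE expfzMl cisXz; congr (_ * _).
  case: n {n0 u} => n; first by rewrite -!exprnP real_complexX.
  by rewrite NegzE -!exprnN real_complexV real_complexX.
have nR : (n%:~R : R) != 0 by rewrite intr_eq0.
have [hc hs] := int_trig nR (cis_period n).
have iT (f : R -> R) : continuous (f : R -> R^o) -> mu.-integrable I (EFin \o f).
  exact: continuous_integrable_2pi.
have cM : continuous (fun x : R => n%:~R * x : R^o).
  by move=> x; apply: cvgM; [exact: cvg_cst | exact: cvg_id].
apply/eqP; rewrite eq_complex /=; apply/andP; split; apply/eqP.
  have -> : \int[mu]_(x in I) complex.Re (circle r x ^ n) =
      \int[mu]_(x in I) (r ^ n * cos (n%:~R * x)).
    by apply: eq_Rintegral => x _; rewrite E /=; ring.
  rewrite RintegralZl // ?hc ?mulr0 ?mul0r //.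
  by apply: iT => x; apply: (continuous_comp (cM x)); exact: continuous_cos.
have -> : \int[mu]_(x in I) complex.Im (circle r x ^ n) =
      \int[mu]_(x in I) (r ^ n * sin (n%:~R * x)).
  by apply: eq_Rintegral => x _; rewrite E /=; ring.
rewrite RintegralZl // ?hs ?mulr0 ?mul0r //.
by apply: iT => x; apply: (continuous_comp (cM x)); exact: continuous_sin.
Qed.

End CircleMean.

(** * Bounded uniformly continuous functions on annuli and iterated contour integrals *)

Section Nice.
Variable R : realType.
Local Notation C := (Cplx R).

Section Fixed.
Variables (m : nat) (lo hi : 'I_m -> R).
Implicit Types (z : 'rV[C]_m) (f g : 'rV[C]_m -> C).

Definition ann z := forall l, lo l <= nrm (z 0 l) <= hi l.

(** Equal radii [lo = hi] give the torus of integration; annuli of positive width serve for limits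
    at points of the torus taken from outside it. *)
Definition nice f :=
  (exists B, forall z, ann z -> nrm (f z) <= B) /\
  (forall e, 0 < e -> exists2 d, 0 < d & forall z z', ann z -> ann z' ->
     (forall l, nrm (z 0 l - z' 0 l) < d) -> nrm (f z - f z') < e).

Lemma nice_ext f g : (forall z, ann z -> f z = g z) -> nice f -> nice g.
Proof.
move=> E [[B HB] U]; split; first by exists B => z az; rewrite -E // HB.
by move=> e /U [d d0 H]; exists d => // z z' az az' h; rewrite -!E // H.
Qed.

Lemma nice_cst c : nice (fun _ => c).
Proof.
split; first by exists (nrm c).
by move=> e e0; exists 1 => // *; rewrite subrr nrm0.
Qed.

Lemma nice_coord l : nice (fun z => z 0 l).
Proof.
split; first by exists (hi l) => z /(_ l) /andP[].
by move=> e e0; exists e => // z z' _ _; apply.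
Qed.

Lemma niceD f g : nice f -> nice g -> nice (fun z => f z + g z).
Proof.
move=> [[B1 HB1] U1] [[B2 HB2] U2]; split.
  exists (B1 + B2) => z az; apply: le_trans (nrmD _ _) _.
  by rewrite lerD ?HB1 ?HB2.
move=> e e0; have e2 : 0 < e / 2 by rewrite divr_gt0.
have [d1 d10 H1] := U1 _ e2; have [d2 d20 H2] := U2 _ e2.
exists (Num.min d1 d2) => [|z z' az az' h]; first by rewrite lt_min d10.
have -> : f z + g z - (f z' + g z') = (f z - f z') + (g z - g z') by ring.
apply: le_lt_trans (nrmD _ _) _; rewrite [e]splitr ltrD // ?H1 ?H2 //.
  by move=> l; have := h l; rewrite lt_min => /andP[].
by move=> l; have := h l; rewrite lt_min => /andP[].
Qed.

Lemma niceM f g : nice f -> nice g -> nice (fun z => f z * g z).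
Proof.
move=> [[B1 HB1] U1] [[B2 HB2] U2]; split.
  by exists (B1 * B2) => z az; rewrite nrmM ler_pM ?nrm_ge0 ?HB1 ?HB2.
move=> e e0; pose K1 := `|B1| + 1; pose K2 := `|B2| + 1.
have K10 : 0 < K1 by rewrite ltr_wpDl.
have K20 : 0 < K2 by rewrite ltr_wpDl.
have [d1 d10 H1] := U1 (e / K2 / 2) ltac:(by rewrite !divr_gt0).
have [d2 d20 H2] := U2 (e / K1 / 2) ltac:(by rewrite !divr_gt0).
exists (Num.min d1 d2) => [|z z' az az' h]; first by rewrite lt_min d10.
have -> : f z * g z - f z' * g z' = f z * (g z - g z') + (f z - f z') * g z' by ring.
apply: le_lt_trans (nrmD _ _) _; rewrite !nrmM [e]splitr; apply: ltrD.
  have -> : e / 2 = K1 * (e / K1 / 2) by field; rewrite gt_eqF.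
  apply: (@le_lt_trans _ _ (K1 * nrm (g z - g z'))).
    rewrite ler_wpM2r ?nrm_ge0 //; apply: le_trans (HB1 _ az) _.
    by apply: le_trans (ler_norm _) _; rewrite lerDl.
  rewrite ltr_pM2l //; apply: H2 => // l.
  by have := h l; rewrite lt_min => /andP[].
have -> : e / 2 = (e / K2 / 2) * K2 by field; rewrite gt_eqF.
apply: (@le_lt_trans _ _ (nrm (f z - f z') * K2)).
  rewrite ler_wpM2l ?nrm_ge0 //; apply: le_trans (HB2 _ az') _.
  by apply: le_trans (ler_norm _) _; rewrite lerDl.
rewrite ltr_pM2r //; apply: H1 => // l.
by have := h l; rewrite lt_min => /andP[].
Qed.

Lemma niceZ c f : nice f -> nice (fun z => c * f z).
Proof. exact: niceM (nice_cst c). Qed.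

Lemma niceB f g : nice f -> nice g -> nice (fun z => f z - g z).
Proof.
move=> nf ng; apply: (nice_ext _ (niceD nf (niceZ (-1) ng))) => z _.
by rewrite mulN1r.
Qed.

Lemma nice_sum (I : Type) (r : seq I) (P : pred I) (F : I -> 'rV[C]_m -> C) :
  (forall i, nice (F i)) -> nice (fun z => \sum_(i <- r | P i) F i z).
Proof.
move=> nF; elim: r => [|i r IH].
  by apply: (nice_ext _ (nice_cst 0)) => z _; rewrite big_nil.
case Pi : (P i).
  by apply: (nice_ext _ (niceD (nF i) IH)) => z _; rewrite big_cons Pi.
by apply: (nice_ext _ IH) => z _; rewrite big_cons Pi.
Qed.

Lemma nice_prod (I : Type) (r : seq I) (P : pred I) (F : I -> 'rV[C]_m -> C) :
  (forall i, nice (F i)) -> nice (fun z => \prod_(i <- r | P i) F i z).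
Proof.
move=> nF; elim: r => [|i r IH].
  by apply: (nice_ext _ (nice_cst 1)) => z _; rewrite big_nil.
case Pi : (P i).
  by apply: (nice_ext _ (niceM (nF i) IH)) => z _; rewrite big_cons Pi.
by apply: (nice_ext _ IH) => z _; rewrite big_cons Pi.
Qed.

Lemma niceX f n : nice f -> nice (fun z => f z ^+ n).
Proof.
move=> nf; elim: n => [|n IH].
  by apply: (nice_ext _ (nice_cst 1)) => z _; rewrite expr0.
by apply: (nice_ext _ (niceM nf IH)) => z _; rewrite exprS.
Qed.

Lemma niceV f c : 0 < c -> (forall z, ann z -> c <= nrm (f z)) -> nice f ->
  nice (fun z => (f z)^-1).
Proof.
move=> c0 fc [_ U]; have f0 z : ann z -> f z != 0.
  by move=> az; rewrite -nrm_gt0 (lt_le_trans c0) // fc.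
split.
  by exists c^-1 => z az; rewrite nrmV lef_pV2 ?posrE ?nrm_gt0 ?f0 ?fc.
move=> e e0; have [d d0 H] := U (e * c ^+ 2) ltac:(by rewrite mulr_gt0 ?exprn_gt0).
exists d => // z z' az az' h.
have -> : (f z)^-1 - (f z')^-1 = (f z' - f z) / (f z * f z').
  by field; rewrite !f0.
rewrite nrmM nrmV nrmM ltr_pdivrMr ?mulr_gt0 ?nrm_gt0 ?f0 //.
rewrite nrm_distC; apply: lt_le_trans (H _ _ az az' h) _.
rewrite ler_wpM2l ?(ltW e0) // expr2.
by apply: ler_pM; rewrite ?(ltW c0) ?fc.
Qed.

Lemma niceXz f c n : 0 < c -> (forall z, ann z -> c <= nrm (f z)) -> nice f ->
  nice (fun z => f z ^ n).
Proof.
move=> c0 fc nf; case: n => n.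
  by apply: (nice_ext _ (niceX n nf)) => z _; rewrite exprnP.
apply: (nice_ext _ (niceX n.+1 (niceV c0 fc nf))) => z _.
by rewrite NegzE -exprnN exprVn.
Qed.

(** Stability under uniform limits, since [mu] is a limit of root sums with truncated
    exponentials. *)
Lemma nice_lim f : (forall e, 0 < e -> exists2 g, nice g &
  forall z, ann z -> nrm (f z - g z) <= e) -> nice f.
Proof.
move=> H; split.
  have [g [[B HB] _] Hg] := H 1 ltr01; exists (B + 1) => z az.
  have -> : f z = g z + (f z - g z) by ring.
  by apply: le_trans (nrmD _ _) _; rewrite lerD ?HB ?Hg.
move=> e e0; have e3 : 0 < e / 4 by rewrite divr_gt0.
have [g [_ U] Hg] := H _ e3; have [d d0 Hd] := U _ e3.
exists d => // z z' az az' h.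
have -> : f z - f z' = (f z - g z) + (g z - g z') - (f z' - g z') by ring.
apply: le_lt_trans (nrmB _ _) _.
have h1 := nrmD (f z - g z) (g z - g z').
have h2 := Hg _ az; have h3 := Hg _ az'; have h4 := Hd _ _ az az' h.
lra.
Qed.

Lemma nice_mulmx p q r (A : 'rV[C]_m -> 'M[C]_(p, q)) (B : 'rV[C]_m -> 'M[C]_(q, r)) :
  (forall i j, nice (fun z => A z i j)) -> (forall i j, nice (fun z => B z i j)) ->
  forall i j, nice (fun z => (A z *m B z) i j).
Proof.
move=> nA nB i j; apply: (nice_ext (f := fun z => \sum_k A z i k * B z k j)).
  by move=> z _; rewrite mxE.
by apply: nice_sum => k; apply: niceM.
Qed.

Lemma nice_det p (A : 'rV[C]_m -> 'M[C]_p) :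
  (forall i j, nice (fun z => A z i j)) -> nice (fun z => \det (A z)).
Proof.
move=> nA; rewrite /determinant; apply: nice_sum => s.
by apply: niceZ; apply: nice_prod.
Qed.

End Fixed.

Definition tor m (r : 'I_m -> R) := ann r r.

Lemma torP m (r : 'I_m -> R) z : tor r z <-> forall l, nrm (z 0 l) = r l.
Proof.
split=> H l; first by apply/le_anti; rewrite andbC; exact: H.
by rewrite H lexx.
Qed.

Definition consz m (z : C) (zs : 'rV[C]_m) : 'rV[C]_m.+1 :=
  row_mx (const_mx z : 'rV_1) zs.

Lemma consz0 m z (zs : 'rV[C]_m) : consz z zs 0 ord0 = z.
Proof.
have -> : (ord0 : 'I_m.+1) = lshift m (ord0 : 'I_1) by apply: val_inj.
by apply: etrans (row_mxEl _ _ _ _) _; rewrite mxE.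
Qed.

Lemma conszS m z (zs : 'rV[C]_m) l : consz z zs 0 (lift ord0 l) = zs 0 l.
Proof.
have -> : lift ord0 l = rshift 1 l by apply: val_inj.
exact: row_mxEr.
Qed.

Definition rtail m (r : 'I_m.+1 -> R) : 'I_m -> R := fun l => r (lift ord0 l).

Lemma tor_cons m (r : 'I_m.+1 -> R) z zs :
  nrm z = r ord0 -> tor (rtail r) zs -> tor r (consz z zs).
Proof.
move=> hz hzs l; case: (unliftP ord0 l) => [l' ->|->].
  by rewrite conszS; exact: hzs.
by rewrite consz0 hz lexx.
Qed.

Lemma ointnS m (r : 'I_m.+1 -> R) f :
  ointn r f = omean (r ord0) (fun z => ointn (rtail r) (fun zs => f (consz z zs))).
Proof. by []. Qed.

Lemma nice_tail m (r : 'I_m.+1 -> R) f z : nrm z = r ord0 -> nice r r f ->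
  nice (rtail r) (rtail r) (fun zs => f (consz z zs)).
Proof.
move=> hz [[B HB] U]; split.
  by exists B => zs azs; apply: HB; exact: tor_cons.
move=> e /U [d d0 H]; exists d => // zs zs' azs azs' h.
apply: H; try exact: tor_cons.
move=> l; case: (unliftP ord0 l) => [l' ->|->]; first by rewrite !conszS.
by rewrite !consz0 subrr nrm0.
Qed.

(** The four properties are proved together: linearity of the outer mean rests on continuity of the
    inner integral in the outer variable, and this follows from linearity and boundedness of the
    inner integral. *)
Definition ointn_good m (r : 'I_m -> R) :=
  [/\ forall f g, nice r r f -> nice r r g ->
        ointn r (fun z => f z + g z) = ointn r f + ointn r g,
      forall c f, nice r r f -> ointn r (fun z => c * f z) = c * ointn r f,
      forall f B, 0 <= B -> nice r r f -> (forall z, tor r z -> nrm (f z) <= B) ->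
        nrm (ointn r f) <= 2 ^+ m * B &
      forall f g, (forall z, tor r z -> f z = g z) -> ointn r f = ointn r g].

Lemma ointn_uc m (r : 'I_m.+1 -> R) f : ointn_good (rtail r) -> nice r r f ->
  uc1 (r ord0) (fun z => ointn (rtail r) (fun zs => f (consz z zs))).
Proof.
move=> [gD gZ gB gE] nf; have [_ U] := nf.
move=> e e0; have K0 : 0 < 2 ^+ m * 2 :> R by rewrite mulr_gt0 ?exprn_gt0.
have [d d0 H] := U _ (divr_gt0 e0 K0).
exists d => // z z' zr z'r h.
have nz := nice_tail zr nf; have nz' := nice_tail z'r nf.
rewrite -mulN1r -gZ // -gD //; last exact: niceZ.
apply: (@le_lt_trans _ _ (2 ^+ m * (e / (2 ^+ m * 2)))); last first.
  have -> : 2 ^+ m * (e / (2 ^+ m * 2)) = e / 2 by field; rewrite ?expf_neq0 //.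
  by rewrite ltr_pdivrMr // ltr_pMr // ltr1n.
apply: gB; first by rewrite ltW // divr_gt0.
  by apply: niceD => //; apply: niceZ.
move=> zs azs; rewrite mulN1r; apply/ltW/H; try exact: tor_cons.
move=> l; case: (unliftP ord0 l) => [l' ->|->].
  by rewrite !conszS subrr nrm0.
by rewrite !consz0.
Qed.

Lemma ointn_goodP m (r : 'I_m -> R) : (forall l, 0 < r l) -> ointn_good r.
Proof.
elim: m r => [|m IH] r r0.
  split=> // [f B B0 nf fB|f g E] /=.
    by rewrite expr0 mul1r; apply: fB => -[].
  by rewrite /= E // => -[].
have gt := IH (rtail r) (fun l => r0 _); have [gD gZ gB gE] := gt.
split.
- move=> f g nf ng; rewrite !ointnS -omeanD //; try exact: ointn_uc.
  apply: omean_ext (ltW (r0 _)) _ => z zr.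
  by apply: gD; exact: nice_tail.
- move=> c f nf; rewrite !ointnS -omeanZ //; try exact: ointn_uc.
  apply: omean_ext (ltW (r0 _)) _ => z zr.
  by apply: gZ; exact: nice_tail.
- move=> f B B0 nf fB; rewrite ointnS exprS -mulrA; apply: omean_bound => //.
    exact: ointn_uc.
  move=> z zr; apply: gB => //; first exact: nice_tail.
  by move=> zs azs; apply: fB; exact: tor_cons.
- move=> f g E; rewrite !ointnS; apply: omean_ext (ltW (r0 _)) _ => z zr.
  by apply: gE => zs azs; apply: E; exact: tor_cons.
Qed.

Section OintnLin.
Variables (m : nat) (r : 'I_m -> R).
Hypothesis r0 : forall l, 0 < r l.

Lemma ointnD f g : nice r r f -> nice r r g ->
  ointn r (fun z => f z + g z) = ointn r f + ointn r g.
Proof. by case: (ointn_goodP r0) => h _ _ _; exact: h. Qed.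

Lemma ointnZ c f : nice r r f -> ointn r (fun z => c * f z) = c * ointn r f.
Proof. by case: (ointn_goodP r0) => _ h _ _; exact: h. Qed.

Lemma ointn_bound f B : 0 <= B -> nice r r f -> (forall z, tor r z -> nrm (f z) <= B) ->
  nrm (ointn r f) <= 2 ^+ m * B.
Proof. by case: (ointn_goodP r0) => _ _ h _; exact: h. Qed.

Lemma ointn_ext f g : (forall z, tor r z -> f z = g z) -> ointn r f = ointn r g.
Proof. by case: (ointn_goodP r0) => _ _ _ h; exact: h. Qed.

Lemma ointnB f g : nice r r f -> nice r r g ->
  ointn r (fun z => f z - g z) = ointn r f - ointn r g.
Proof.
move=> nf ng; rewrite -mulN1r -ointnZ // -ointnD //; last exact: niceZ.
by apply: ointn_ext => z _; rewrite mulN1r.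
Qed.

Lemma ointn_cst0 : ointn r (fun _ => 0) = 0.
Proof.
have E : ointn r (fun _ => 0) = 0 * ointn r (fun _ => 0).
  rewrite -ointnZ; last exact: nice_cst.
  by apply: ointn_ext => z _; rewrite mul0r.
by rewrite E mul0r.
Qed.

Lemma ointn_sum (I : Type) (s : seq I) (P : pred I) (F : I -> 'rV[C]_m -> C) :
  (forall i, nice r r (F i)) ->
  ointn r (fun z => \sum_(i <- s | P i) F i z) = \sum_(i <- s | P i) ointn r (F i).
Proof.
move=> nF; elim: s => [|i s IH].
  by rewrite big_nil -[RHS]ointn_cst0; apply: ointn_ext => z _; rewrite big_nil.
rewrite big_cons; case Pi : (P i).
  rewrite -IH -ointnD //; last exact: nice_sum.
  by apply: ointn_ext => z _; rewrite big_cons Pi.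
by rewrite -IH; apply: ointn_ext => z _; rewrite big_cons Pi.
Qed.

End OintnLin.

(** Orthogonality of integer powers on the circle, applied to the outermost variable. *)
Lemma ointn_shell m (r : 'I_m.+1 -> R) (n : int) g : (forall l, 0 < r l) ->
    nice (rtail r) (rtail r) g ->
  ointn r (fun z => z 0 ord0 ^ n * g (\row_l z 0 (lift ord0 l)))
  = if n == 0 then ointn (rtail r) g else 0.
Proof.
move=> r0 ng; have rt0 : forall l, 0 < rtail r l by move=> l; exact: r0.
rewrite ointnS.
have E z : nrm z = r ord0 -> ointn (rtail r) (fun zs => consz z zs 0 ord0 ^ n *
     g (\row_l consz z zs 0 (lift ord0 l))) = ointn (rtail r) g * z ^ n.
  move=> _; rewrite mulrC -ointnZ //; apply: ointn_ext => // zs _.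
  rewrite consz0; congr (_ * g _); apply/rowP => l; rewrite mxE conszS //.
rewrite (omean_ext (ltW (r0 _)) E).
have u : uc1 (r ord0) (fun z : C => z ^ n).
  have H : nice (fun _ : 'I_1 => r ord0) (fun _ => r ord0) (fun z => z 0 ord0 ^ n).
    apply: (niceXz _ (r0 ord0)); last exact: nice_coord.
    by move=> z /(_ ord0) /andP[].
  move=> e e0; have [_ /(_ _ e0) [d d0 Hd]] := H.
  exists d => // z z' zr z'r h.
  have := Hd (const_mx z) (const_mx z'); rewrite !mxE; apply.
  - by move=> l; rewrite mxE zr lexx.
  - by move=> l; rewrite mxE z'r lexx.
  - by move=> l; rewrite !mxE.
rewrite omeanZ //; case: eqP => [->|/eqP n0]; last by rewrite omean_Xz ?mulr0.
rewrite (@omean_ext _ _ _ (fun _ => 1) (ltW (r0 _))) ?omean_cst ?mulr1 //.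
Qed.

End Nice.

(** * The decoupled integrand *)

Section Integrand.
Variable R : realType.
Local Notation C := (Cplx R).
Variables (N L : nat).
Hypotheses (N_gt0 : (0 < N)%N) (ltNL : (N < L)%N).
Local Notation p := (@pNL R N L).
Local Notation mu := (@mu R N L).

Let L_gt0 : (0 < L)%N. Proof. exact: leq_ltn_trans ltNL. Qed.

Lemma pNL_lam_nice m (lo hi : 'I_m -> R) (l : 'I_m) P :
  nice lo hi (fun z => lam p (z 0 l ^+ L) P).
Proof.
have sP : (size P <= size P * L)%N by rewrite leq_pmulr.
apply: (nice_ext (f := fun z => \sum_(n < size P) lamc p L n P * (z 0 l ^+ L) ^+ n)).
  by move=> z _; rewrite (lam_expand L_gt0 (pNL_monic R N L) (size_pNL R ltNL) _ sP).
by apply: nice_sum => n; apply: niceZ; do 2 apply: niceX; exact: nice_coord.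
Qed.

Lemma mu_nice m (lo hi : 'I_m -> R) (l : 'I_m) (a b : int) (s : R) :
  0 < lo l -> 0 <= s -> nice lo hi (fun z => mu a b s (z 0 l ^+ L)).
Proof.
move=> lo0 s0; set M := (`|a| + `|b|)%N.
have zlo z : ann lo hi z -> lo l <= nrm (z 0 l) by move=> /(_ l) /andP[].
have zhi z : ann lo hi z -> nrm (z 0 l) <= hi l by move=> /(_ l) /andP[].
apply: niceM.
  apply: (@niceV _ _ _ _ _ (lo l ^+ L ^+ M)); first by rewrite !exprn_gt0.
    move=> z az; rewrite !nrmX !lerXn2r ?nnegrE ?exprn_ge0 ?nrm_ge0 ?(ltW lo0) //.
    exact: zlo.
  by do 2 apply: niceX; exact: nice_coord.
apply: nice_lim => e e0; set P := fpoly _ _ _ _ _ _.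
have := @Lam_err_cvg R p L (hi l ^+ L) P s.
move=> /cvgr0Pnorm_lt /(_ _ e0) [K _ HK].
exists (fun z => lam p (z 0 l ^+ L) (P * epol K (s%:C)%C)); first exact: pNL_lam_nice.
move=> z az; apply: le_trans (Lam_dist L_gt0 (pNL_monic R N L) (size_pNL R ltNL) P K (M := hi l ^+ L) _ s0) _.
  rewrite nrmX lerXn2r ?nnegrE ?nrm_ge0 ?zhi //.
  by rewrite (le_trans (nrm_ge0 _) (zhi _ az)).
by apply: le_trans (ler_norm _) _; apply/ltW/HK => /=.
Qed.

(* A space-time point: particle index (from 0), lower bound, time increment. *)
Definition pt : Type := nat * int * R.
Definition pk (q : pt) : int := q.1.1%:Z.
Definition pa (q : pt) : int := q.1.2.
Definition ps (q : pt) : R := q.2.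

(** Row i is the functional Q -> sum of Q(w) w^(i-k) (w+1)^(y_i-i-a+k) exp(s w) / p'(w) over the
    roots, in the monomials Q = w^b. Since i and k are both counted from 0, their differences are
    those of the formula. *)
Definition Um (y : 'I_N -> int) (q : pt) (Z : C) : 'M[C]_(N, L) :=
  \matrix_(i, b) mu (i%:Z - pk q + b%:Z) (y i - i%:Z - pa q + pk q) (ps q) Z.

Definition Tm (q q' : pt) (Z : C) : 'M[C]_L :=
  \matrix_(c, b) mu (c%:Z + (b%:Z - pk q' + pk q)) (pk q' - pa q' + pa q - pk q) (ps q') Z.

Definition Hm : 'M[C]_L := \matrix_(c, d) p`_(d + c).+1.

(** Column j holds the coefficients of p(X) / X^(j+1), which equals Z w^(-j-1) at a root; this
    removes the negative power of the last root. *)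
Definition Hfin : 'M[C]_(L, N) :=
  \matrix_(b, j) ('X^(N - j.+1) * ('X + 1) ^+ (L - N) : {poly C})`_b.

Definition tailf T n (f : 'I_n.+1 -> T) : 'I_n -> T := fun l => f (lift ord0 l).

Fixpoint chainW n : ('I_n.+1 -> pt) -> ('I_n.+1 -> C) -> 'M[C]_(L, N) :=
  if n is n'.+1 then fun q Z =>
    Hm *m Tm (q ord0) (tailf q ord0) (tailf Z ord0) *m chainW (tailf q) (tailf Z)
  else fun _ _ => Hfin.

Fixpoint chainS n : ('I_n.+1 -> pt) -> ('I_n.+1 -> C) -> C :=
  if n is n'.+1 then fun q Z =>
    tailf Z ord0 ^ (pk (tailf q ord0) - pk (q ord0)) / (1 - tailf Z ord0 / Z ord0)
    * chainS (tailf q) (tailf Z)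
  else fun _ _ => 1.

Lemma chainW_S n (q : 'I_n.+2 -> pt) Z : chainW q Z =
  Hm *m Tm (q ord0) (tailf q ord0) (tailf Z ord0) *m chainW (tailf q) (tailf Z).
Proof. by []. Qed.

Lemma chainS_S n (q : 'I_n.+2 -> pt) Z : chainS q Z =
  tailf Z ord0 ^ (pk (tailf q ord0) - pk (q ord0)) / (1 - tailf Z ord0 / Z ord0)
    * chainS (tailf q) (tailf Z).
Proof. by []. Qed.

(* On the contours this is the integrand of the theorem, with [Z l = z_l ^+ L]. *)
Definition Jint n (y : 'I_N -> int) (q : 'I_n.+1 -> pt) (Z : 'I_n.+1 -> C) : C :=
  (-1) ^+ ((q ord_max).1.1 * N.+1) * Z ord0 ^ pk (q ord0) * chainS q Z
  * \det (Um y (q ord0) (Z ord0) *m chainW q Z).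

Definition Zf n (z : 'rV[C]_n) : 'I_n -> C := fun l => z 0 l ^+ L.

Lemma ZfE n (z : 'rV[C]_n) l : Zf z l = z 0 l ^+ L.
Proof. by []. Qed.

Section Nested.

Definition nested n (lo hi : 'I_n -> R) := (forall l, 0 < lo l) /\
  (forall l, lo l <= hi l) /\ (forall l l' : 'I_n, (l < l')%N -> hi l' < lo l).

Lemma nested_tail n (lo hi : 'I_n.+1 -> R) : nested lo hi -> nested (tailf lo) (tailf hi).
Proof. by move=> [h1 [h2 h3]]; split=> [l|]; [|split=> [l|l l' ll]]; [exact: h1|exact: h2|apply: h3]. Qed.

Lemma nice_last n (lo hi : 'I_n.+1 -> R) f : nice (tailf lo) (tailf hi) f ->
  nice lo hi (fun z => f (\row_l z 0 (lift ord0 l))).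
Proof.
move=> [[B HB] U].
have S z : ann lo hi z -> ann (tailf lo) (tailf hi) (\row_l z 0 (lift ord0 l)).
  by move=> az l; rewrite mxE; exact: az.
split; first by exists B => z /S; exact: HB.
move=> e /U [d d0 H]; exists d => // z z' az az' h; apply: H; try exact: S.
by move=> l; rewrite !mxE; exact: h.
Qed.

Lemma tailf_Zf n (z : 'rV[C]_n.+1) : tailf (Zf z) = Zf (\row_l z 0 (lift ord0 l)).
Proof. by apply/funext => l; rewrite /tailf /Zf mxE. Qed.

Lemma chainW_nice n (lo hi : 'I_n.+1 -> R) (q : 'I_n.+1 -> pt) : (forall l, 0 < lo l) ->
  (forall l, 0 <= ps (q l)) -> forall b j, nice lo hi (fun z => chainW q (Zf z) b j).
Proof.
elim: n lo hi q => [|n IH] lo hi q lo0 q0 b j; first exact: nice_cst.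
rewrite /=; apply: nice_mulmx => {b j} [b j|b j].
  apply: nice_mulmx => {b j} [b j|b j]; first exact: nice_cst.
  apply: (nice_ext (f := fun z => mu (b%:Z + (j%:Z - pk (tailf q ord0) + pk (q ord0)))
     (pk (tailf q ord0) - pa (tailf q ord0) + pa (q ord0) - pk (q ord0))
     (ps (tailf q ord0)) (z 0 (lift ord0 ord0) ^+ L))).
    by move=> z _; rewrite mxE.
  by apply: mu_nice => //; exact: q0.
apply: (nice_ext (f := fun z => chainW (tailf q) (Zf (\row_l z 0 (lift ord0 l))) b j)).
  by move=> z _; rewrite tailf_Zf.
apply: (nice_last (f := fun z => chainW (tailf q) (Zf z) b j)).
by apply: IH => l; [exact: lo0 | exact: q0].
Qed.

Lemma Um_nice n (lo hi : 'I_n -> R) y q l : 0 < lo l -> 0 <= ps q ->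
  forall i b, nice lo hi (fun z => Um y q (z 0 l ^+ L) i b).
Proof.
move=> lo0 q0 i b.
apply: (nice_ext (f := fun z => mu (i%:Z - pk q + b%:Z) (y i - i%:Z - pa q + pk q) (ps q)
   (z 0 l ^+ L))); first by move=> z _; rewrite mxE.
exact: mu_nice.
Qed.

Lemma sep_bound n (lo hi : 'I_n -> R) (l l' : 'I_n) : nested lo hi -> (l < l')%N ->
  exists2 c, 0 < c & forall z, ann lo hi z -> nrm (z 0 l' ^+ L / z 0 l ^+ L) <= 1 - c.
Proof.
move=> [lo0 [lohi sep]] ll.
have hi0 : 0 < hi l' by apply: lt_le_trans (lohi l').
have x1 : (hi l' / lo l) ^+ L < 1.
  rewrite -[X in _ < X](expr1n _ L) ltrXn2r -?lt0n ?nnegrE ?divr_ge0 ?(ltW hi0) ?(ltW (lo0 l)) //.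
  by rewrite ltr_pdivrMr // mul1r sep.
exists (1 - (hi l' / lo l) ^+ L); first by rewrite subr_gt0.
move=> z az; have /andP[a1 a2] := az l; have /andP[b1 b2] := az l'.
have z0 : 0 < nrm (z 0 l) by apply: lt_le_trans a1.
rewrite subKr nrmM nrmV !nrmX -expr_div_n lerXn2r ?nnegrE ?divr_ge0 ?nrm_ge0 ?(ltW hi0) ?(ltW (lo0 l)) //.
apply: ler_pM; rewrite ?invr_ge0 ?nrm_ge0 //.
by rewrite lef_pV2 // posrE.
Qed.

Lemma geo_nice n (lo hi : 'I_n -> R) (l l' : 'I_n) : nested lo hi -> (l < l')%N ->
  nice lo hi (fun z => (1 - z 0 l' ^+ L / z 0 l ^+ L)^-1).
Proof.
move=> nst ll; have [c c0 H] := sep_bound nst ll; have [lo0 _] := nst.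
apply: (niceV c0).
  move=> z /H h.
  have := nrmD (1 - z 0 l' ^+ L / z 0 l ^+ L) (z 0 l' ^+ L / z 0 l ^+ L).
  rewrite subrK nrm1; lra.
apply: niceB; first exact: nice_cst.
apply: niceM; first by apply: niceX; exact: nice_coord.
apply: (@niceV _ _ _ _ _ (lo l ^+ L)); first by rewrite exprn_gt0.
  move=> z /(_ l) /andP[a1 _].
  by rewrite nrmX lerXn2r ?nnegrE ?nrm_ge0 ?(ltW (lo0 l)).
by apply: niceX; exact: nice_coord.
Qed.

Lemma coordXz_nice n (lo hi : 'I_n -> R) l (i : int) : 0 < lo l ->
  nice lo hi (fun z => (z 0 l ^+ L) ^ i).
Proof.
move=> lo0; apply: (@niceXz _ _ _ _ _ (lo l ^+ L)); first by rewrite exprn_gt0.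
  move=> z /(_ l) /andP[a1 _].
  by rewrite nrmX lerXn2r ?nnegrE ?nrm_ge0 ?(ltW lo0).
by apply: niceX; exact: nice_coord.
Qed.

Lemma chainS_nice n (lo hi : 'I_n.+1 -> R) (q : 'I_n.+1 -> pt) : nested lo hi ->
  nice lo hi (fun z => chainS q (Zf z)).
Proof.
elim: n lo hi q => [|n IH] lo hi q nst; first exact: nice_cst.
have [lo0 _] := nst.
rewrite /=; apply: niceM; first apply: niceM.
- by apply: coordXz_nice.
- exact: (geo_nice nst (l := ord0) (l' := lift ord0 ord0)).
apply: (nice_ext (f := fun z => chainS (tailf q) (Zf (\row_l z 0 (lift ord0 l))))).
  by move=> z _; rewrite tailf_Zf.
apply: (nice_last (f := fun z => chainS (tailf q) (Zf z))).
by apply: IH; exact: nested_tail.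
Qed.

End Nested.

(** At time zero the first point drops out: the exponents of [Um] at [q] and of [Tm] add up to those
    of [Um] at [q'], and the reproducing identity composes the two. *)
Lemma Um_repro y q q' Z : Z != 0 -> ps q = 0 -> 0 <= ps q' ->
  Um y q Z *m Hm *m Tm q q' Z = Um y q' Z.
Proof.
move=> Z0 q0 q'0; apply/matrixP => i b; rewrite [RHS]mxE.
have -> : i%:Z - pk q' + b%:Z = (i%:Z - pk q) + (b%:Z - pk q' + pk q) by ring.
have -> : y i - i%:Z - pa q' + pk q' =
  (y i - i%:Z - pa q + pk q) + (pk q' - pa q' + pa q - pk q) by ring.
rewrite -(@mu_repro R N L N_gt0 ltNL _ _ _ _ _ _ Z0 q'0) -mulmxA mxE.
apply: eq_bigr => c _; rewrite [(Hm *m _) _ _]mxE mulr_sumr; apply: eq_bigr => d _.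
by rewrite !mxE q0 mulrA.
Qed.

(** Multilinearity in the rows; [f] selects one term of the expansion for each row. *)
Lemma det_rows_expand (F : comNzRingType) (D : nat) (x : 'I_D -> F)
    (A : 'I_D -> 'M[F]_N) :
  \det (\matrix_(i, j) \sum_(n < D) x n * A n i j) =
  \sum_(f : {ffun 'I_N -> 'I_D}) (\prod_i x (f i)) * \det (\matrix_(i, j) A (f i) i j).
Proof.
rewrite /determinant; under [RHS]eq_bigr do rewrite mulr_sumr.
rewrite exchange_big /=; apply: eq_bigr => s _.
under eq_bigr do rewrite mxE.
rewrite bigA_distr_bigA mulr_sumr; apply: eq_bigr => f _.
rewrite mulrCA -big_split /=; congr (_ * _); apply: eq_bigr => i _.
by rewrite mxE.
Qed.

End Integrand.

(** * The integral at time zero *)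

Section CyclicTriangular.
Variable F : comNzRingType.

(** [lift_perm ord_max ord0 1] is the cycle i -> i + 1 modulo m + 1. *)
Lemma iter_cycle m k (i : 'I_m.+1) : (k <= m)%N ->
  ((lift_perm ord_max ord0 1 : 'S_(m.+1)) ^+ k)%g i =
   (if (i + k < m.+1)%N then i + k else i + k - m.+1)%N :> nat.
Proof.
elim: k => [|k IH] km; first by rewrite expg0 perm1 addn0 ltn_ord.
rewrite expgSr permM; have := IH (ltnW km).
move: (_ i) => j hj.
have c1 (j' : 'I_m.+1) : (lift_perm ord_max ord0 1 : 'S_(m.+1)) j' =
    (if j' == m :> nat then 0 else j'.+1)%N :> nat.
  case: (unliftP ord_max j') => [j'' ->|->]; last by rewrite lift_perm_id /= eqxx.
  rewrite lift_perm_lift perm1 /= /bump /= leqNgt ltn_ord /= add0n.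
  by rewrite ltn_eqF.
rewrite c1; have := ltn_ord i; have := ltn_ord j; move: hj; case: ltnP => h1 h2 h3 h4;
  case: ltnP => h5; case: eqP => h6; lia.
Qed.

(** A k-fold cyclic shift of the rows makes the matrix unitriangular, and a cycle of length [N] has
    sign (-1)^(N+1). *)
Lemma det_cyclic_trig N k (A : 'M[F]_N) : (k < N)%N ->
    (forall i j : 'I_N, (j < if (i < k)%N then i + N - k else i - k)%N -> A i j = 0) ->
    (forall i j : 'I_N, j = (if (i < k)%N then i + N - k else i - k)%N :> nat -> A i j = 1) ->
  \det A = (-1) ^+ (k * N.+1).
Proof.
case: N A => // m A km H0 H1.
pose s := ((lift_perm ord_max ord0 1 : 'S_(m.+1)) ^+ k)%g.
have sE i : s i = (if (i + k < m.+1)%N then i + k else i + k - m.+1)%N :> nat.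
  exact: iter_cycle.
have d1 : \det (row_perm s A) = 1.
  rewrite -det_tr det_trig.
    apply: big1 => i _; rewrite !mxE; apply: H1.
    by have := sE i; have := ltn_ord i; case: (ltnP (i + k) m.+1); case: (ltnP (s i) k); lia.
  apply/is_trig_mxP => i j ij; rewrite !mxE; apply: H0.
  by have := sE j; have := ltn_ord j; case: (ltnP (j + k) m.+1); case: (ltnP (s j) k); lia.
have sgn : (-1) ^+ s = (-1) ^+ (k * m.+2) :> F.
  have -> : odd_perm s = odd (k * m.+2).
    rewrite /s; elim: (k) => [|k' IH]; first by rewrite expg0 odd_perm1.
    by rewrite expgS odd_permM IH odd_lift_perm odd_perm1 mulSn oddD !oddS negbK !addbF.
  by rewrite signr_odd.
move: d1; rewrite row_permE det_mulmx det_perm sgn => d1.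
by rewrite -[LHS]mul1r -[X in X * _](signrMK (k * m.+2) 1) mulr1 -mulrA d1 mulr1.
Qed.

End CyclicTriangular.

(** * Expansion of the rows at time zero *)

Section TimeZero.
Variable R : realType.
Local Notation C := (Cplx R).
Variables (N L : nat).
Hypotheses (N_gt0 : (0 < N)%N) (ltNL : (N < L)%N).
Local Notation p := (@pNL R N L).
Local Notation mu := (@mu R N L).
Local Notation pt := (pt R).
Local Notation Um := (@Um R N L).

Let L_gt0 : (0 < L)%N. Proof. exact: leq_ltn_trans ltNL. Qed.

(** The maximum of the lengths serves for all indices; [Q] is what has to be remembered of the
    constant term. *)
Lemma uniform_expansion (I : finType) (f : I -> C -> C) (x : C -> nat -> C)
    (Q : I -> C -> Prop) :
  (forall i, exists (E : nat -> C) (d : nat), [/\ forall n, (d <= n)%N -> E n = 0,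
     Q i (E 0%N) & forall Z, Z != 0 -> f i Z = \sum_(n < d) E n * x Z n]) ->
  exists (E : I -> nat -> C) (D : nat), (forall i, Q i (E i 0%N)) /\
    (forall Z, Z != 0 -> forall i, f i Z = \sum_(n < D.+1) x Z n * E i n).
Proof.
move=> H; have [E HE] := choice H; have [d Hd] := choice HE.
exists E, (\max_i d i)%N; split=> [i|Z Z0 i]; first by have [] := Hd i.
have [h0 _ h] := Hd i; rewrite h //.
have di : (d i <= (\max_i d i).+1)%N by apply: leqW; exact: leq_bigmax.
rewrite (big_ord_widen _ (fun n => E i n * x Z n) di) big_mkcond /=.
apply: eq_bigr => n _; rewrite mulrC; case: ltnP => // h'.
by rewrite h0 // mulr0.
Qed.

(* The factor [Z ^+ k] of the integrand is spread over the rows [i < k]. *)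
Definition Us (y : 'I_N -> int) (q : pt) (k : nat) (Z : C) : 'M[C]_(N, L) :=
  \matrix_(i, c) (Z ^+ (i < k)%N * Um y q Z i c).

Lemma det_Us y q k Z (W : 'M[C]_(L, N)) : (k <= N)%N ->
  \det (Us y q k Z *m W) = Z ^+ k * \det (Um y q Z *m W).
Proof.
move=> kN; have -> : Us y q k Z = diag_mx (\row_i Z ^+ (i < k)%N) *m Um y q Z.
  by apply/matrixP => i c; rewrite mul_diag_mx !mxE.
rewrite -mulmxA det_mulmx det_diag; congr (_ * _).
under eq_bigr do rewrite mxE.
rewrite prodrXr; congr (_ ^+ _).
rewrite (eq_bigr (fun i : 'I_N => if (i < k)%N then 1 else 0)%N); last by move=> i _; case: ltnP.
by rewrite -big_mkcond /= (big_ord_narrow kN) /= sum1_card card_ord.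
Qed.

Lemma det_Us_expand y q k (E : 'I_N * 'I_L -> nat -> C) D (x : C -> nat -> C) Z
    (W : 'M[C]_(L, N)) :
  (forall ic : 'I_N * 'I_L, Us y q k Z ic.1 ic.2 = \sum_(n < D.+1) x Z n * E ic n) ->
  \det (Us y q k Z *m W) = \sum_(f : {ffun 'I_N -> 'I_D.+1})
    (\prod_i x Z (f i)) * \det (\matrix_(i, j) \sum_c E (i, c) (f i) * W c j).
Proof.
move=> H; pose A (n : 'I_D.+1) : 'M[C]_N := \matrix_(i, j) \sum_c E (i, c) n * W c j.
transitivity (\det (\matrix_(i, j) \sum_(n < D.+1) x Z n * A n i j)).
  congr (\det _); apply/matrixP => i j; rewrite !mxE.
  under eq_bigr do rewrite (H (_, _)) mulr_suml.
  rewrite exchange_big /=; apply: eq_bigr => n _; rewrite mxE mulr_sumr.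
  by apply: eq_bigr => c _; rewrite mulrA.
rewrite (det_rows_expand (fun n : 'I_D.+1 => x Z n) A).
apply: eq_bigr => f _; congr (_ * \det _).
by apply/matrixP => i j; rewrite !mxE.
Qed.

(** With h = p / X^(j+1), split [P] at degree j: the terms below j times h have degree less than L -
    1, X^j h is monic of degree L - 1, and the terms above j give multiples of [p], which vanish at
    Z = 0. *)
Lemma lamc0_Hfin (P : {poly C}) (j : 'I_N) :
  \sum_(c < L) lamc p L 0 (P * 'X^c) * Hfin R N L c j = P`_j.
Proof.
have lE Q : lamc p L 0 Q = lam p 0 Q.
  by rewrite /lam /topc subr0 (size_pNL R ltNL).
set h : {poly C} := 'X^(N - j.+1) * ('X + 1) ^+ (L - N).
have jN := ltn_ord j.
have sh : size h = (L - j)%N by rewrite size_XnXp1n; lia.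
have hm : h \is monic by rewrite rpredM ?monicXn // rpredX // Xp1E monicXsubC.
have -> : \sum_(c < L) lamc p L 0 (P * 'X^c) * Hfin R N L c j = lam p 0 (P * h).
  rewrite -[h in RHS]coefK poly_def mulr_sumr lam_sum.
  rewrite (big_ord_widen L (fun c => lam p 0 (P * (h`_c *: 'X^c)))); last by rewrite sh leq_subr.
  rewrite [RHS]big_mkcond /=; apply: eq_bigr => c _; rewrite lE mxE -/h.
  case: ltnP => hc; first by rewrite -scalerAr lamZ mulrC.
  by rewrite nth_default // mulr0.
have Xh : 'X^(j.+1) * h = p.
  by rewrite /h mulrA -exprD subnKC.
rewrite -{1}(poly_take_drop j.+1 P) mulrDl lamD -mulrA Xh [_ * p]mulrC.
rewrite lam_mulp mul0r addr0.
have tE : take_poly j.+1 P = take_poly j P + P`_j *: 'X^j.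
  apply/polyP => i; rewrite coefD coefZ coefXn !coef_take_poly ltnS leq_eqVlt.
  case: eqP => [->|_] /=; first by rewrite ltnn add0r mulr1.
  by rewrite mulr0 addr0.
rewrite tE mulrDl lamD -scalerAl lamZ.
rewrite !(lam_small L_gt0 (size_pNL R ltNL)); last 2 first.
- rewrite -commr_polyXn mulrC size_monicM ?monicXn ?monic_neq0 //.
  by rewrite size_polyXn sh; lia.
- apply: leq_trans (size_polyMleq _ _) _; rewrite sh.
  by move: (size_take_poly j P); move: (size _) => t ht; lia.
rewrite nth_default ?add0r; last first.
  apply: leq_trans (size_polyMleq _ _) _; rewrite sh.
  by move: (size_take_poly j P); move: (size _) => t ht; lia.
rewrite coefXnM ltnNge (_ : (j <= L.-1)%N); last by lia.
have := monicP hm; rewrite lead_coefE sh /= (_ : (L - j).-1 = L.-1 - j)%N; last by lia.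
by move=> ->; rewrite mulr1.
Qed.

Section Expand.
Variables (y : 'I_N -> int) (q : pt) (k : 'I_N).
Hypotheses (qk : pk q = k%:Z) (q0 : ps q = 0).
Hypothesis y_mono : forall i j : 'I_N, (i <= j)%N -> y i + j%:Z - i%:Z <= y j.
Hypothesis y_per : forall i j : 'I_N, y j - j%:Z + N%:Z <= y i - i%:Z + L%:Z.

(** For i < k the exponent i - k of w is negative, and the one factor [Z] assigned to the row by
    [Us] turns it into i - k + N. *)
Definition row_poly (i : 'I_N) : {poly C} :=
  fpoly R N L (i%:Z - k%:Z) (y i - i%:Z - pa q + k%:Z) (i < k)%N.

(** The exponents of w + 1 are nonnegative: y_i - i is nondecreasing in i, which settles i >= k, and
    for i < k periodicity makes the extra L - N sufficient. *)
Lemma Us_expand_pos : pa q <= y k ->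
  exists (E : 'I_N * 'I_L -> nat -> C) D,
    (forall ic, E ic 0%N = lamc p L 0 (row_poly ic.1 * 'X^(ic.2))) /\
    (forall Z, Z != 0 -> forall ic, Us y q k Z ic.1 ic.2 = \sum_(n < D.+1) Z ^+ n * E ic n).
Proof.
move=> ay; apply: (@uniform_expansion _ (fun ic Z => Us y q k Z ic.1 ic.2) (fun Z n => Z ^+ n)
   (fun ic e => e = lamc p L 0 (row_poly ic.1 * 'X^(ic.2)))) => -[i c].
have ab : adm N L (i%:Z - k%:Z) (y i - i%:Z - pa q + k%:Z) (i < k)%N.
  have h1 := y_per i k; rewrite /adm; have := ltn_ord i; have := ltn_ord k.
  case: (ltnP i k) => ik h2 h3; rewrite ?muln1 ?muln0 /=; apply/andP; split; try lia.
  by have := y_mono ik; lia.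
have [E [d [h1 h2 h3]]] := mu_expand_pos R N_gt0 ltNL c ab.
exists E, d; split => // Z Z0; rewrite -h3 // !mxE qk q0 //.
Qed.

(** The weight of row i has degree y_i - a at infinity, plus [L] if i < k. Exclusion and periodicity
    keep this at most L - 2, so no positive power of [Z] occurs; row k has negative degree and no
    constant term either. *)
Lemma Us_expand_neg : y k < pa q ->
  exists (E : 'I_N * 'I_L -> nat -> C) D,
    (forall ic, ic.1 = k -> E ic 0%N = 0) /\
    (forall Z, Z != 0 -> forall ic, Us y q k Z ic.1 ic.2 = \sum_(n < D.+1) Z ^- n * E ic n).
Proof.
move=> ay; apply: (@uniform_expansion _ (fun ic Z => Us y q k Z ic.1 ic.2) (fun Z n => Z ^- n)
   (fun ic e => ic.1 = k -> e = 0)) => -[i c].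
have hd : (i%:Z - k%:Z) + (y i - i%:Z - pa q + k%:Z) + ((i < k)%N * L)%:Z + 2 <= L%:Z.
  have h1 := y_per k i; have := ltn_ord i; have := ltn_ord k.
  case: (ltnP i k) => ik h2 h3; rewrite ?mul1n ?mul0n; last lia.
  by have := y_mono (ltnW ik); lia.
have [E [d [h1 h2 h3]]] := mu_expand_neg R N_gt0 ltNL (ltn_ord c) hd.
exists E, d; split => // [/= ik|Z Z0]; last by rewrite -h3 // !mxE qk q0.
by apply: h2; rewrite ik ltnn; lia.
Qed.

(** The lowest exponent v is i - k modulo [N], the pattern required by [det_cyclic_trig]. *)
Lemma row_poly_coef (i j : 'I_N) : pa q <= y k ->
  let v := (if (i < k)%N then i + N - k else i - k)%N in
  ((j < v)%N -> (row_poly i)`_j = 0) /\ (j = v :> nat -> (row_poly i)`_j = 1).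
Proof.
move=> ay v.
have -> : row_poly i = 'X^v * ('X + 1) ^+ (absz (y i - i%:Z - pa q + k%:Z +
     ((L - N) * (i < k))%:Z)%R).
  rewrite /row_poly /fpoly /v; congr ('X^_ * _).
  by have := ltn_ord i; have := ltn_ord k; case: (ltnP i k) => ik; rewrite ?muln1 ?muln0; lia.
split=> [jv|->]; first by rewrite coefXnM jv.
rewrite coefXnM ltnn subnn -horner_coef0 horner_exp hornerD hornerX hornerC add0r.
by rewrite expr1n.
Qed.

End Expand.
End TimeZero.

Arguments ointn : simpl never.

Section TimeZeroIntegral.
Variable R : realType.
Local Notation C := (Cplx R).
Variables (N L : nat).
Hypotheses (N_gt0 : (0 < N)%N) (ltNL : (N < L)%N).
Local Notation p := (@pNL R N L).
Local Notation pt := (pt R).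
Local Notation Um := (@Um R N L).
Local Notation Zf := (@Zf R L _).

Let L_gt0 : (0 < L)%N. Proof. exact: leq_ltn_trans ltNL. Qed.

Lemma ointn_shellZ m (r : 'I_m.+1 -> R) (e : int) g : (forall l, 0 < r l) ->
    nice (rtail r) (rtail r) g ->
  ointn r (fun z => Zf z ord0 ^ e * g (\row_l z 0 (lift ord0 l)))
  = if e == 0 then ointn (rtail r) g else 0.
Proof.
move=> r0 ng.
have := ointn_shell (L%:Z * e) r0 ng.
have -> : (L%:Z * e == 0) = (e == 0) by rewrite mulf_eq0; lia.
move=> <-; apply: ointn_ext => // z _.
by rewrite ZfE exprnP exprz_exp.
Qed.

Lemma nested_refl m (r : 'I_m -> R) : (forall l, 0 < r l) ->
  (forall l l' : 'I_m, (l < l')%N -> r l' < r l) -> nested r r.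
Proof. by move=> r0 rr; split; [|split]. Qed.

(** In the series of (Z_2 / Z_1)^k only the term k = e survives integration over z_1. No infinite
    sum is exchanged with the integral: partial sums longer than |e| already give the right-hand
    side, and the remainder x^K [F] is small uniformly on the torus. *)
Lemma ointn_geo m (r : 'I_m.+2 -> R) (e : int) g :
    (forall l, 0 < r l) -> (forall l l' : 'I_m.+2, (l < l')%N -> r l' < r l) ->
    nice (rtail r) (rtail r) g ->
  ointn r (fun z => Zf z ord0 ^ e * (1 - Zf z (lift ord0 ord0) / Zf z ord0)^-1
     * g (\row_l z 0 (lift ord0 l)))
  = ointn (rtail r) (fun zs => (if 0 <= e then Zf zs ord0 ^ e else 0) * g zs).
Proof.
move=> r0 rr ng; have nst := nested_refl r0 rr.
have rt0 : forall l, 0 < rtail r l by move=> l; exact: r0.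
have [c c0 Hc] := sep_bound ltNL nst (l := ord0) (l' := lift ord0 ord0) (ltn0Sn _).
pose x (z : 'rV[C]_m.+2) := Zf z (lift ord0 ord0) / Zf z ord0.
have xc z : tor r z -> nrm (x z) <= 1 - c by move=> /Hc.
(* [1 - c] bounds a norm at some point of the torus; the point with coordinates [r l] serves. *)
have c1 : 0 <= 1 - c.
  pose z : 'rV[C]_m.+2 := \row_l ((r l)%:C)%C.
  have tz : tor r z.
    by move=> l; rewrite mxE nrm_real gtr0_norm // lexx.
  exact: le_trans (nrm_ge0 _) (xc _ tz).
have x1 z : tor r z -> 1 - x z != 0.
  move=> /xc h; apply/eqP => /eqP; rewrite subr_eq0 => /eqP E.
  by move: h; rewrite -E nrm1; lra.
have Zn z l : tor r z -> Zf z l != 0.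
  move=> /torP zr; rewrite ZfE expf_neq0 // -nrm_gt0 zr //.
pose G (z : 'rV[C]_m.+2) := g (\row_l z 0 (lift ord0 l)).
have nG : nice r r G by apply: nice_last.
have nZ l (i : int) : nice r r (fun z => Zf z l ^ i) by apply: coordXz_nice.
have nZ' l (i : int) : nice (rtail r) (rtail r) (fun z => Zf z l ^ i).
  exact: coordXz_nice.
have ngeo : nice r r (fun z => (1 - x z)^-1).
  exact: (geo_nice ltNL nst (l := ord0) (l' := lift ord0 ord0)).
have nx : nice r r x.
  apply: (nice_ext (f := fun z => Zf z (lift ord0 ord0) ^ 1 * Zf z ord0 ^ (-1))).
    by move=> z _; rewrite expr1z.
  exact: niceM.
pose F z := Zf z ord0 ^ e * (1 - x z)^-1 * G z.
have nF : nice r r F by apply: niceM => //; apply: niceM.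
have [[B HB] _] := nF.
pose tgt := ointn (rtail r) (fun zs => (if 0 <= e then Zf zs ord0 ^ e else 0) * g zs).
have key K : (`|e| < K)%N -> nrm (ointn r F - tgt) <= 2 ^+ m.+2 * ((1 - c) ^+ K * `|B|).
  move=> eK.
  have nterm (k : nat) : nice r r (fun z => Zf z ord0 ^ e * x z ^+ k * G z).
    by apply: niceM => //; apply: niceM => //; apply: niceX.
  have E1 : ointn r (fun z => \sum_(k < K) Zf z ord0 ^ e * x z ^+ k * G z) = tgt.
    rewrite ointn_sum //.
    rewrite (eq_bigr (fun k : 'I_K => if e == k%:Z then
       ointn (rtail r) (fun zs => Zf zs ord0 ^ e * g zs) else 0)); last first.
      move=> k _.
      have := @ointn_shellZ _ r (e - k%:Z) (fun zs => Zf zs ord0 ^ k%:Z * g zs) r0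
        (niceM (nZ' _ _) ng).
      rewrite subr_eq0 => H; rewrite (ointn_ext r0 (g := fun z => Zf z ord0 ^ (e - k%:Z) *
         (Zf (\row_l z 0 (lift ord0 l)) ord0 ^ k%:Z * g (\row_l z 0 (lift ord0 l))))).
        by rewrite H; case: eqP => // ->.
      move=> z tz; rewrite /x expfzDr ?Zn // -tailf_Zf -exprnN -exprnP -exprVn exprMn /tailf /G.
      ring.
    rewrite /tgt; have [e0|e0] := leP 0 e.
      have ek : (absz e < K)%N by [].
      rewrite (bigD1 (Ordinal ek)) //= gez0_abs // eqxx big1 ?addr0 // => k kE.
      case: eqP => // ee; case/eqP: kE; apply: val_inj => /=; lia.
    rewrite big1; last by move=> k _; case: eqP => // ee; lia.
    rewrite -[LHS](ointn_cst0 rt0); apply: ointn_ext => // zs _.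
    by rewrite mul0r.
  rewrite -E1 -ointnB //; last by apply: nice_sum.
  apply: ointn_bound => //.
  - by rewrite mulr_ge0 // exprn_ge0.
  - by apply: niceB => //; apply: nice_sum.
  move=> z tz.
  have -> : F z - \sum_(k < K) Zf z ord0 ^ e * x z ^+ k * G z = x z ^+ K * F z.
    have -> : \sum_(k < K) Zf z ord0 ^ e * x z ^+ k * G z =
       Zf z ord0 ^ e * G z * (\sum_(k < K) x z ^+ k).
      by rewrite mulr_sumr; apply: eq_bigr => k _; ring.
    have h := subrX1 (x z) K.
    have -> : \sum_(k < K) x z ^+ k = (1 - x z ^+ K) / (1 - x z).
      have -> : 1 - x z ^+ K = (1 - x z) * \sum_(k < K) x z ^+ k.
        by rewrite -opprB h -mulNr opprB.
      by rewrite mulrC mulKf ?x1.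
    by rewrite /F; field; rewrite x1.
  rewrite nrmM nrmX; apply: ler_pM; rewrite ?exprn_ge0 ?nrm_ge0 //.
    by rewrite lerXn2r ?nnegrE ?nrm_ge0 ?xc.
  by apply: le_trans (HB _ tz) (ler_norm _).
apply/eqP; rewrite -subr_eq0 -nrm_eq0; apply/eqP/le_anti; rewrite nrm_ge0 andbT.
have cv : 2 ^+ m.+2 * ((1 - c) ^+ K * `|B|) @[K --> \oo] --> (2 ^+ m.+2 * (0 * `|B|) : R).
  apply: cvgM; first exact: cvg_cst.
  apply: cvgM; last exact: cvg_cst.
  by apply: cvg_expr; rewrite ger0_norm //; lra.
rewrite mul0r mulr0 in cv; rewrite -[X in _ <= X](cvg_lim (@Rhausdorff R) cv).
apply: limr_ge; first by apply/cvg_ex; eexists; exact: cv.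
by exists (absz e).+1 => // K /= hK; exact: key.
Qed.

Lemma prod_expfz (Z : C) D (f : {ffun 'I_N -> 'I_D}) :
  \prod_i Z ^+ (f i) = Z ^ (\sum_i f i)%N%:Z.
Proof. by rewrite prodrXr exprnP. Qed.

Lemma prod_expfzN (Z : C) D (f : {ffun 'I_N -> 'I_D}) :
  \prod_i Z ^- (f i) = Z ^ (- (\sum_i f i)%N%:Z).
Proof.
rewrite -exprnN -prodrXr -prodfV //.
Qed.

Section Point.
Variables (y : 'I_N -> int).
Hypothesis y_mono : forall i j : 'I_N, (i <= j)%N -> y i + j%:Z - i%:Z <= y j.
Hypothesis y_per : forall i j : 'I_N, y j - j%:Z + N%:Z <= y i - i%:Z + L%:Z.

Definition vF n (q : 'I_n.+1 -> pt) (r : 'I_n.+1 -> R) : C :=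
  ointn r (fun z => Jint L y q (Zf z)).

(** Only the constant term in Z of the determinant contributes, and it arises from the constant term
    of every row. For a <= y_k these rows form a cyclically unitriangular matrix whose sign cancels
    the prefactor; for y_k < a row k is zero. *)
Lemma vF_base (q : 'I_1 -> pt) (r : 'I_1 -> R) (k : 'I_N) :
  (q ord0).1.1 = k -> ps (q ord0) = 0 -> 0 < r ord0 ->
  vF q r = ((pa (q ord0) <= y k)%R)%:R.
Proof.
move=> qk q0 r0; have r0' l : 0 < r l by rewrite ord1.
have pqk : pk (q ord0) = k%:Z by rewrite /pk qk.
have Zn z : tor r z -> Zf z ord0 != 0.
  by move=> /torP zr; rewrite ZfE expf_neq0 // -nrm_gt0 zr.
have JE z : Jint L y q (Zf z) = (-1) ^+ (k * N.+1) *
    \det (Us L y (q ord0) k (Zf z ord0) *m Hfin R N L).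
  rewrite det_Us ?(ltnW (ltn_ord k)) // /Jint /= mulr1 pqk -exprnP.
  have -> : ord_max = ord0 :> 'I_1 by apply: val_inj.
  by rewrite qk mulrA.
have shell (e : int) (d : C) : ointn r (fun z => Zf z ord0 ^ e * d) = if e == 0 then d else 0.
  by have := ointn_shellZ e r0' (nice_cst _ _ d); move=> ->.
have [ay|ay] := leP (pa (q ord0)) (y k).
  have [E [D [E0 HE]]] := Us_expand_pos N_gt0 ltNL pqk q0 y_mono y_per ay.
  pose dt (f : {ffun 'I_N -> 'I_D.+1}) : C := (-1) ^+ (k * N.+1) *
     \det (\matrix_(i, j) \sum_c E (i, c) (f i) * Hfin R N L c j).
  transitivity (ointn r (fun z => \sum_(f : {ffun 'I_N -> 'I_D.+1})
      Zf z ord0 ^ (\sum_i f i)%N%:Z * dt f)).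
    apply: ointn_ext => // z tz; rewrite JE (det_Us_expand _ (HE _ (Zn _ tz))) mulr_sumr.
    by apply: eq_bigr => f _; rewrite prod_expfz /dt; ring.
  rewrite ointn_sum //; last by move=> f; apply: niceM; [exact: coordXz_nice|exact: nice_cst].
  rewrite (bigD1 [ffun=> ord0]) //= shell.
  have -> : (\sum_i ([ffun=> ord0] : {ffun 'I_N -> 'I_D.+1}) i)%N = 0%N.
    by apply: big1 => i _; rewrite ffunE.
  rewrite eqxx big1 ?addr0; last first.
    move=> f f0; rewrite shell; case: eqP => // - [s0].
    case/eqP: f0; apply/ffunP => i; rewrite ffunE; apply: val_inj => /=.
    by move/eqP: s0; rewrite sum_nat_eq0 => /forallP /(_ i) /eqP.
  rewrite /dt (@det_cyclic_trig _ _ k) //.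
  - by rewrite -exprD addnn -mul2n exprM sqrrN !expr1n.
  - move=> i j jv; rewrite mxE ffunE.
    under eq_bigr do rewrite E0 /=.
    rewrite (lamc0_Hfin N_gt0 ltNL).
    by have [h _] := row_poly_coef N_gt0 ltNL pqk i j ay; exact: h.
  - move=> i j jv; rewrite mxE ffunE.
    under eq_bigr do rewrite E0 /=.
    rewrite (lamc0_Hfin N_gt0 ltNL).
    by have [_ h] := row_poly_coef N_gt0 ltNL pqk i j ay; exact: h.
have [E [D [E0 HE]]] := Us_expand_neg N_gt0 ltNL pqk q0 y_mono y_per ay.
pose dt (f : {ffun 'I_N -> 'I_D.+1}) : C := (-1) ^+ (k * N.+1) *
   \det (\matrix_(i, j) \sum_c E (i, c) (f i) * Hfin R N L c j).
transitivity (ointn r (fun z => \sum_(f : {ffun 'I_N -> 'I_D.+1})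
    Zf z ord0 ^ (- (\sum_i f i)%N%:Z) * dt f)).
  apply: ointn_ext => // z tz; rewrite JE (det_Us_expand (x := fun Z n => Z ^- n) _ (HE _ (Zn _ tz))) mulr_sumr.
  by apply: eq_bigr => f _; rewrite prod_expfzN /dt; ring.
rewrite ointn_sum //; last by move=> f; apply: niceM; [exact: coordXz_nice|exact: nice_cst].
apply: big1 => f _; rewrite shell oppr_eq0; case: eqP => // - [s0].
rewrite /dt (expand_det_row _ k) big1 ?mulr0 // => j _.
rewrite mxE big1 ?mul0r // => c _.
have -> : f k = ord0.
  by apply: val_inj => /=; move/eqP: s0; rewrite sum_nat_eq0 => /forallP /(_ k) /eqP.
by rewrite E0 ?mul0r.
Qed.

(** For a <= y_k, integration over z_1 replaces Z_1 by Z_2 in the row expansion, which then resums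
    to the same determinant at Z_2. For y_k < a only nonpositive powers occur, and the zeroth one
    has a vanishing row. *)
Lemma vF_step n (q : 'I_n.+2 -> pt) (r : 'I_n.+2 -> R) (k : 'I_N) :
  (q ord0).1.1 = k -> ps (q ord0) = 0 -> (forall l, 0 <= ps (q l)) ->
  (forall l, 0 < r l) -> (forall l l' : 'I_n.+2, (l < l')%N -> r l' < r l) ->
  vF q r = ((pa (q ord0) <= y k)%R)%:R * vF (tailf q) (rtail r).
Proof.
move=> qk q0 qs r0 rr; have nst := nested_refl r0 rr.
have rt0 : forall l, 0 < rtail r l by move=> l; exact: r0.
have nstt : nested (rtail r) (rtail r) := nested_tail nst.
have pqk : pk (q ord0) = k%:Z by rewrite /pk qk.
have Zn m (r' : 'I_m -> R) (r'0 : forall l, 0 < r' l) z l : tor r' z -> Zf z l != 0.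
  by move=> /torP zr; rewrite ZfE expf_neq0 // -nrm_gt0 zr.
pose sgn : C := (-1) ^+ ((q ord_max).1.1 * N.+1).
pose rest (zs : 'rV[C]_n.+1) : C := sgn *
  (Zf zs ord0 ^ (pk (tailf q ord0) - pk (q ord0)) * chainS (tailf q) (Zf zs)).
pose W (zs : 'rV[C]_n.+1) : 'M[C]_(L, N) :=
  Hm R N L *m Tm N L (q ord0) (tailf q ord0) (Zf zs ord0) *m chainW N L (tailf q) (Zf zs).
have nrest : nice (rtail r) (rtail r) rest.
  apply: niceZ; apply: niceM; first exact: coordXz_nice.
  exact: (chainS_nice ltNL).
have nW c j : nice (rtail r) (rtail r) (fun zs => W zs c j).
  apply: nice_mulmx => {c j} c j; last by apply: chainW_nice => // l; exact: qs.
  apply: nice_mulmx => {c j} c j; first exact: nice_cst.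
  apply: (nice_ext (f := fun z => mu N L (c%:Z + (j%:Z - pk (tailf q ord0) + pk (q ord0)))
     (pk (tailf q ord0) - pa (tailf q ord0) + pa (q ord0) - pk (q ord0))
     (ps (tailf q ord0)) (z 0 ord0 ^+ L))).
    by move=> z _; rewrite mxE.
  by apply: mu_nice => //; exact: qs.
pose tl (z : 'rV[C]_n.+2) : 'rV[C]_n.+1 := \row_l z 0 (lift ord0 l).
have JE z : Jint L y q (Zf z) = (1 - Zf z (lift ord0 ord0) / Zf z ord0)^-1 *
    (rest (tl z) * \det (Us L y (q ord0) k (Zf z ord0) *m W (tl z))).
  rewrite det_Us ?(ltnW (ltn_ord k)) // /Jint chainS_S chainW_S /rest /W /tl.
  rewrite -!tailf_Zf pqk -exprnP /sgn -[Zf z (lift ord0 ord0)]/(tailf (Zf z) ord0).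
  ring.
pose dt (E : 'I_N * 'I_L -> nat -> C) D (f : {ffun 'I_N -> 'I_D.+1}) zs : C :=
   rest zs * \det (\matrix_(i, j) \sum_c E (i, c) (f i) * W zs c j).
have ndt E D f : nice (rtail r) (rtail r) (@dt E D f).
  apply: niceM => //; apply: nice_det => i j.
  apply: (nice_ext (f := fun zs => \sum_c E (i, c) (f i) * W zs c j)).
    by move=> zs _; rewrite mxE.
  by apply: nice_sum => c; apply: niceZ.
have geo1 E D (f : {ffun 'I_N -> 'I_D.+1}) (e : int) :
   nice r r (fun z => Zf z ord0 ^ e * (1 - Zf z (lift ord0 ord0) / Zf z ord0)^-1
     * dt E D f (tl z)).
  apply: niceM; last exact: nice_last.
  apply: niceM; first exact: coordXz_nice.
  exact: (geo_nice ltNL nst (l := ord0) (l' := lift ord0 ord0)).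
rewrite /vF.
have [ay|ay] := leP (pa (q ord0)) (y k).
  have [E [D [E0 HE]]] := Us_expand_pos N_gt0 ltNL pqk q0 y_mono y_per ay.
  rewrite mul1r; transitivity (ointn r (fun z => \sum_(f : {ffun 'I_N -> 'I_D.+1})
      Zf z ord0 ^ (\sum_i f i)%N%:Z * (1 - Zf z (lift ord0 ord0) / Zf z ord0)^-1 *
      dt E D f (tl z))).
    apply: ointn_ext => // z tz; rewrite JE (det_Us_expand (x := fun Z n => Z ^+ n) _ (HE _ (Zn _ _ r0 _ _ tz))).
    rewrite !mulr_sumr.
    by apply: eq_bigr => f _; rewrite prod_expfz /dt; ring.
  rewrite ointn_sum //.
  transitivity (\sum_(f : {ffun 'I_N -> 'I_D.+1}) ointn (rtail r) (fun zs =>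
      Zf zs ord0 ^ (\sum_i f i)%N%:Z * dt E D f zs)).
    by apply: eq_bigr => f _; rewrite ointn_geo.
  rewrite -ointn_sum //; last by move=> f; apply: niceM => //; exact: coordXz_nice.
  apply: ointn_ext => // zs tzs; have Z1 := Zn _ _ rt0 _ ord0 tzs.
  (* The same expansion, now read backwards at Z_2. *)
  transitivity (rest zs * \det (Us L y (q ord0) k (Zf zs ord0) *m W zs)).
    rewrite (det_Us_expand (x := fun Z n => Z ^+ n) _ (HE _ Z1)) mulr_sumr.
    by apply: eq_bigr => f _; rewrite prod_expfz /dt; ring.
  rewrite det_Us ?(ltnW (ltn_ord k)) // /W !mulmxA (Um_repro N_gt0 ltNL) //; last exact: qs.
  rewrite /Jint /rest /sgn.
  have -> : tailf q ord_max = q ord_max by rewrite /tailf; congr q; apply: val_inj.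
  have -> : Zf zs ord0 ^ pk (tailf q ord0) =
      Zf zs ord0 ^ (pk (tailf q ord0) - pk (q ord0)) * Zf zs ord0 ^+ k.
    by rewrite exprnP -expfzDr // pqk subrK.
  ring.
rewrite mul0r.
have [E [D [E0 HE]]] := Us_expand_neg N_gt0 ltNL pqk q0 y_mono y_per ay.
transitivity (ointn r (fun z => \sum_(f : {ffun 'I_N -> 'I_D.+1})
    Zf z ord0 ^ (- (\sum_i f i)%N%:Z) * (1 - Zf z (lift ord0 ord0) / Zf z ord0)^-1 *
    dt E D f (tl z))).
  apply: ointn_ext => // z tz; rewrite JE (det_Us_expand (x := fun Z n => Z ^- n) _ (HE _ (Zn _ _ r0 _ _ tz))).
  rewrite !mulr_sumr.
  by apply: eq_bigr => f _; rewrite prod_expfzN /dt; ring.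
rewrite ointn_sum //; apply: big1 => f _; rewrite ointn_geo //.
rewrite -[RHS](ointn_cst0 rt0); apply: ointn_ext => // zs _.
case: ifP; last by rewrite mul0r.
rewrite oppr_ge0 => s0; rewrite /dt (expand_det_row _ k) [X in rest zs * X]big1 ?mulr0 // => j _.
rewrite mxE big1 ?mul0r // => c _.
have -> : f k = ord0.
  apply: val_inj => /=; have : (\sum_i f i == 0)%N by move: s0; rewrite (lez_nat _ 0) leqn0.
  by rewrite sum_nat_eq0 => /forallP /(_ k) /eqP.
by rewrite E0 ?mul0r.

Qed.

End Point.
End TimeZeroIntegral.

(** * Evolution in the first time *)

Section Evolution.
Variable R : realType.
Local Notation C := (Cplx R).

Section FirstOrder.
Variables (m : nat) (r : 'I_m -> R) (T : R).
Hypothesis T_ge0 : 0 <= T.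
Implicit Types phi : R -> 'rV[C]_m -> C.

(* [phi'] is the time derivative of [phi], with a remainder of order two that
   is uniform on the torus and on [0, T]. *)
Definition dok phi phi' := exists2 c, 0 <= c & forall z s h, tor r z -> 0 <= s -> 0 <= h ->
  s + h <= T -> [/\ nrm (phi s z) <= c, nrm (phi' s z) <= c &
    nrm (phi (s + h) z - phi s z - (h%:C)%C * phi' s z) <= c * h ^+ 2].

Lemma dok_ext phi phi' psi psi' :
  (forall s z, 0 <= s -> tor r z -> phi s z = psi s z) ->
  (forall s z, 0 <= s -> tor r z -> phi' s z = psi' s z) -> dok phi phi' -> dok psi psi'.
Proof.
move=> E E' [c c0 H]; exists c => // z s h tz s0 h0 sT.
by rewrite -!E ?addr_ge0 // -E' //; exact: H.
Qed.

Lemma dok_cst f : nice r r f -> dok (fun _ => f) (fun _ _ => 0).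
Proof.
move=> [[B HB] _]; exists `|B| => // z s h tz s0 h0 sT.
rewrite nrm0 subrr mulr0 subrr nrm0; split=> //.
  by apply: le_trans (HB _ tz) (ler_norm _).
by rewrite mulr_ge0 // sqr_ge0.
Qed.

Lemma dokD phi phi' psi psi' : dok phi phi' -> dok psi psi' ->
  dok (fun s z => phi s z + psi s z) (fun s z => phi' s z + psi' s z).
Proof.
move=> [c c0 H] [d d0 H2]; exists (c + d); first exact: addr_ge0.
move=> z s h tz s0 h0 sT; have [h1 h2 h3] := H z s h tz s0 h0 sT.
have [g1 g2 g3] := H2 z s h tz s0 h0 sT; split.
- by apply: le_trans (nrmD _ _) _; exact: lerD.
- by apply: le_trans (nrmD _ _) _; exact: lerD.
have -> : phi (s + h) z + psi (s + h) z - (phi s z + psi s z)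
   - (h%:C)%C * (phi' s z + psi' s z) =
   (phi (s + h) z - phi s z - (h%:C)%C * phi' s z) +
   (psi (s + h) z - psi s z - (h%:C)%C * psi' s z) by ring.
by apply: le_trans (nrmD _ _) _; rewrite mulrDl; exact: lerD.
Qed.

Lemma dokM phi phi' psi psi' : dok phi phi' -> dok psi psi' ->
  dok (fun s z => phi s z * psi s z) (fun s z => phi' s z * psi s z + phi s z * psi' s z).
Proof.
move=> [c1 c10 H] [c2 c20 H2]; pose c := c1 + c2 + 1.
have c0 : 0 <= c by rewrite !addr_ge0.
have c1c : c1 <= c by rewrite /c; lra.
have c2c : c2 <= c by rewrite /c; lra.
(* Three error terms are quadratic in h, a fourth is cubic and uses h <= T; the rest is slack. *)
exists (c * c * (4 + T)); first by rewrite !mulr_ge0 ?addr_ge0.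
move=> z s h tz s0 h0 sT.
have hT : h <= T by lra.
have sT0 : s + h + 0 <= T by rewrite addr0.
have [h1 h2 h3] := H z s h tz s0 h0 sT; have [g1 g2 g3] := H2 z s h tz s0 h0 sT.
(* The bound on [psi] at the later time is the instance with increment zero. *)
have [g4 _ _] := H2 z (s + h) 0 tz (addr_ge0 s0 h0) (lexx _) sT0.
have cc : 0 <= c * c by rewrite mulr_ge0.
have hh := sqr_ge0 h.
have M (u v : C) x y : nrm u <= x -> nrm v <= y -> nrm (u * v) <= x * y.
  by move=> ux vy; rewrite nrmM; apply: ler_pM; rewrite ?nrm_ge0.
split.
- apply: le_trans (M _ _ _ _ (le_trans h1 c1c) (le_trans g1 c2c)) _.
  by rewrite ler_peMr //; lra.
- apply: le_trans (nrmD _ _) _.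
  have := M _ _ _ _ (le_trans h2 c1c) (le_trans g1 c2c).
  have := M _ _ _ _ (le_trans h1 c1c) (le_trans g2 c2c).
  have : 0 <= c * c * T by rewrite mulr_ge0.
  have -> : c * c * (4 + T) = c * c * 4 + c * c * T by ring.
  lra.
set hc := (h%:C)%C.
have -> : phi (s + h) z * psi (s + h) z - phi s z * psi s z
   - hc * (phi' s z * psi s z + phi s z * psi' s z) =
   (phi (s + h) z - phi s z - hc * phi' s z) * psi (s + h) z +
   phi s z * (psi (s + h) z - psi s z - hc * psi' s z) +
   (hc * phi' s z) * (hc * psi' s z) +
   (hc * phi' s z) * (psi (s + h) z - psi s z - hc * psi' s z) by ring.
have nh : nrm hc = h by rewrite nrm_real ger0_norm.
have ch1 : nrm (hc * phi' s z) <= h * c.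
  by apply: M; [rewrite nh | exact: le_trans c1c].
have ch2 : nrm (hc * psi' s z) <= h * c.
  by apply: M; [rewrite nh | exact: le_trans c2c].
have e1 : nrm (phi (s + h) z - phi s z - hc * phi' s z) <= c * h ^+ 2.
  by apply: le_trans h3 _; rewrite ler_wpM2r.
have e2 : nrm (psi (s + h) z - psi s z - hc * psi' s z) <= c * h ^+ 2.
  by apply: le_trans g3 _; rewrite ler_wpM2r.
have t1 := M _ _ _ _ e1 (le_trans g4 c2c).
have t2 := M _ _ _ _ (le_trans h1 c1c) e2.
have t3 := M _ _ _ _ ch1 ch2.
have t4 := M _ _ _ _ ch1 e2.
have t5 : h * c * (c * h ^+ 2) <= c * c * T * h ^+ 2.
  have -> : h * c * (c * h ^+ 2) = (c * c * h ^+ 2) * h by ring.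
  have -> : c * c * T * h ^+ 2 = (c * c * h ^+ 2) * T by ring.
  by rewrite ler_wpM2l // mulr_ge0.
apply: le_trans (nrmD _ _) _; apply: le_trans (lerD (nrmD _ _) (lexx _)) _.
apply: le_trans (lerD (lerD (nrmD _ _) (lexx _)) (lexx _)) _.
have -> : c * c * (4 + T) * h ^+ 2 = c * h ^+ 2 * c + c * (c * h ^+ 2) + h * c * (h * c)
   + c * c * T * h ^+ 2 + c * c * h ^+ 2 by ring.
have : 0 <= c * c * h ^+ 2 by rewrite mulr_ge0.
lra.
Qed.

Lemma dokZ f phi phi' : nice r r f -> dok phi phi' ->
  dok (fun s z => f z * phi s z) (fun s z => f z * phi' s z).
Proof.
move=> nf dphi; apply: dok_ext (dokM (dok_cst nf) dphi) => // s z _ _.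
by rewrite mul0r add0r.
Qed.

Lemma dok0 : dok (fun _ _ => 0) (fun _ _ => 0).
Proof. exact: dok_cst (nice_cst _ _ 0). Qed.

Lemma dok_sum (I : Type) (s : seq I) (P : pred I) (F F' : I -> R -> 'rV[C]_m -> C) :
  (forall i, dok (F i) (F' i)) ->
  dok (fun u z => \sum_(i <- s | P i) F i u z) (fun u z => \sum_(i <- s | P i) F' i u z).
Proof.
move=> dF; elim: s => [|i s IH].
  by apply: dok_ext dok0 => u z _ _; rewrite big_nil.
case Pi : (P i).
  by apply: dok_ext (dokD (dF i) IH) => u z _ _; rewrite big_cons Pi.
by apply: dok_ext IH => u z _ _; rewrite big_cons Pi.
Qed.

Lemma dok_prod_seq (I : eqType) (s : seq I) (F F' : I -> R -> 'rV[C]_m -> C) :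
  uniq s -> (forall i, dok (F i) (F' i)) ->
  dok (fun u z => \prod_(i <- s) F i u z)
   (fun u z => \sum_(j <- s) \prod_(i <- s) (if i == j then F' i u z else F i u z)).
Proof.
move=> us dF; elim: s us => [|i s IH] /= => [_|/andP[is_ us]].
  by apply: dok_ext (dok_cst (nice_cst _ _ 1)) => u z _ _; rewrite big_nil.
apply: dok_ext (dokM (dF i) (IH us)) => u z _ _; rewrite big_cons //.
rewrite big_cons eqxx; congr (_ * _ + _).
  apply: eq_big_seq => j js; case: eqP => // ji; by rewrite -ji js in is_.
rewrite mulr_sumr; apply: eq_big_seq => j js; rewrite big_cons.
by case: eqP => // ij; rewrite ij js in is_.
Qed.

Lemma dok_det p (A A' : R -> 'rV[C]_m -> 'M[C]_p) :
  (forall i j, dok (fun u z => A u z i j) (fun u z => A' u z i j)) ->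
  dok (fun u z => \det (A u z))
   (fun u z => \sum_k \det (\matrix_(i, j) if i == k then A' u z i j else A u z i j)).
Proof.
move=> dA; rewrite /determinant.
apply: (dok_ext (phi' := fun u z => \sum_(s : 'S_p) (-1) ^+ s *
   \sum_(k <- index_enum 'I_p) \prod_(i <- index_enum 'I_p)
     (if i == k then A' u z i (s i) else A u z i (s i)))) => //.
  move=> u z _ _; under eq_bigr do rewrite mulr_sumr.
  rewrite exchange_big /=; apply: eq_bigr => k _; apply: eq_bigr => s _.
  by congr (_ * _); apply: eq_bigr => i _; rewrite mxE.
apply: dok_sum => s; apply: dokZ; first exact: nice_cst.
apply: (dok_prod_seq (F := fun i u z => A u z i (s i)) (F' := fun i u z => A' u z i (s i))) => //.
exact: index_enum_uniq.
Qed.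

End FirstOrder.
End Evolution.

(** * Spacing of configurations and blocked jumps *)

Section Configurations.
Variables (N L : nat).
Hypotheses (N_gt0 : (0 < N)%N) (ltNL : (N < L)%N).
Implicit Types (x : conf N L).

Lemma conf_lt x (i j : 'I_N) : (i < j)%N -> val x i < val x j.
Proof.
move=> ij; have /andP[/forallP h _] := valP x.
by have /forallP /(_ j) /implyP := h i; apply.
Qed.

Lemma conf_last x (i j : 'I_N) : i = 0%N :> nat -> j.+1 = N -> val x j < val x i + L%:Z.
Proof.
move=> i0 jN; have /andP[_ /forallP h] := valP x.
by have /forallP /(_ j) /implyP := h i; apply; rewrite i0 jN !eqxx.
Qed.

Lemma conf_mono x (i j : 'I_N) : (i <= j)%N -> val x i + j%:Z - i%:Z <= val x j.
Proof.
move=> ij; have [d dE] : exists d, (j : nat) = (i + d)%N by exists (j - i)%N; rewrite subnKC.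
elim: d j dE {ij} => [|d IH] j dE.
  have -> : j = i by apply: val_inj; rewrite /= dE addn0.
  lia.
have hj : (i + d < N)%N by have := ltn_ord j; lia.
have := IH (Ordinal hj) erefl; have : (Ordinal hj < j)%N by rewrite /= dE addnS.
by move=> /(conf_lt x) /=; lia.
Qed.

Lemma conf_per x (i j : 'I_N) : val x j - j%:Z + N%:Z <= val x i - i%:Z + L%:Z.
Proof.
have h0 : (0 < N)%N by [].
have hN : (N.-1 < N)%N by rewrite prednK.
have h1 := @conf_mono x (Ordinal h0) i (leq0n _).
have h2 : val x j + (Ordinal hN : nat)%:Z - j%:Z <= val x (Ordinal hN).
  by apply: conf_mono => /=; have := ltn_ord j; lia.
have h3 : val x (Ordinal hN) < val x (Ordinal h0) + L%:Z.
  by apply: conf_last => //=; rewrite prednK.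
move: h1 h2 h3 => /=; lia.
Qed.

(** Only the particle directly ahead can block; for the last particle this is the periodic image of
    the first. *)
Lemma not_in_conf_jump x (i : 'I_N) : ~~ @in_conf N L (jump (val x) i) ->
  (exists2 j : 'I_N, (j : nat) = i.+1 & val x j = val x i + 1) \/
  (exists2 j : 'I_N, (j : nat) = 0%N & i.+1 = N /\ val x i + 1 = val x j + L%:Z).
Proof.
rewrite negb_and => /orP[] /forallPn [a /forallPn [b]]; rewrite negb_imply -leNgt !ffunE.
  move=> /andP[ab hb]; left.
  have hlt := conf_lt x ab; have h1 := conf_mono x (ltnW ab).
  have ai : a = i.
    by apply/eqP; move: hb hlt; move: (val x b) (val x a) => xb xa;
      case: (a == i); case: (b == i) => //=; lia.
  have bi : (b == i) = false by apply/eqP => bi; move: ab; rewrite ai bi ltnn.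
  move: hb hlt h1; rewrite bi ai eqxx; rewrite ai in ab.
  have aux (xb xi : int) : xi + true%:Z >= xb + false%:Z -> xi < xb -> xi + b%:Z - i%:Z <= xb ->
      (b : nat) = i.+1 /\ xb = xi + 1 by move=> /=; lia.
  by move=> u v w; have [e1 e2] := aux _ _ u v w; exists b.
move=> /andP[/andP[/eqP a0 /eqP bN] hb]; have h1 := conf_last x a0 bN; right.
have bi : b = i.
  by apply/eqP; move: hb h1; move: (val x b) (val x a) => xb xa;
    case: (a == i); case: (b == i) => //=; lia.
exists a => //; split; first by rewrite -bi.
by move: hb h1; rewrite bi eqxx; move: (val x i) (val x a) => xb xa;
  case: (a == i) => /=; lia.
Qed.

End Configurations.

Section DetRow.
Variable F : comNzRingType.

Lemma det_replace_sub n (A B B' : 'M[F]_n) (i : 'I_n) :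
  row i A = row i B - row i B' -> row' i B = row' i A -> row' i B' = row' i A ->
  \det A = \det B - \det B'.
Proof.
move=> h1 h2 h3; rewrite (determinant_multilinear (i0 := i) (b := 1) (c := -1) (B := B) (C := B')) //.
  by rewrite mul1r mulN1r.
by rewrite h1 scale1r scaleN1r.
Qed.

Lemma det_add_row n (A B : 'M[F]_n) (i j : 'I_n) c : i != j ->
  row i A = row i B + c *: row j B -> row' i A = row' i B -> \det A = \det B.
Proof.
move=> ij h1 h2; pose D : 'M[F]_n := \matrix_(u, v) if u == i then B j v else B u v.
rewrite (determinant_multilinear (i0 := i) (b := 1) (c := c) (B := B) (C := D)).
- rewrite (determinant_alternate (A := D) ij) ?mulr0 ?addr0 ?mul1r // => v.
  by rewrite !mxE eqxx eq_sym (negPf ij).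
- rewrite h1 scale1r; congr (_ + _ *: _).
  by apply/rowP => v; rewrite !mxE eqxx.
- by rewrite h2.
- rewrite h2; apply/matrixP => u v; rewrite !mxE.
  by rewrite eq_sym (negPf (neq_lift i u)).
Qed.
End DetRow.

(** * The contour integral as a function of the initial positions and the first time *)

Section VEvolution.
Variable R : realType.
Local Notation C := (Cplx R).
Variables (N L : nat).
Hypotheses (N_gt0 : (0 < N)%N) (ltNL : (N < L)%N).
Local Notation pt := (pt R).
Local Notation Um := (@Um R N L).
Local Notation Zf := (@Zf R L _).
Local Notation mu := (@mu R N L).

Lemma mu_dok m (r : 'I_m -> R) (T : R) (l : 'I_m) a b : 0 < r l -> 0 <= T ->
  dok r T (fun s z => mu a b s (z 0 l ^+ L)) (fun s z => mu (a + 1) b s (z 0 l ^+ L)).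
Proof.
move=> r0 T0; have rL : 0 < r l ^+ L by rewrite exprn_gt0.
have [c c0 H] := mu_taylor N_gt0 ltNL a b (r l ^+ L) T rL.
set B := radius (pNL R N L) L (r l ^+ L).
have B0 : 0 <= B by apply: radius_ge0; exact: ltW.
set K := mu_base N L (r l ^+ L) (r l ^+ L).
have K0 : 0 <= K by rewrite mulr_ge0 ?invr_ge0 ?(ltW rL) // exprn_ge0 // addr_ge0.
pose D (a : int) := K ^+ (`|a| + `|b|) * expR (T * B).
have D0 a' : 0 <= D a' by rewrite mulr_ge0 ?exprn_ge0 ?expR_ge0.
exists (c + D a + D (a + 1)); first by rewrite !addr_ge0.
move=> z s h /torP tz s0 h0 sT.
have nz : nrm (z 0 l ^+ L) = r l ^+ L by rewrite nrmX tz.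
have bnd a' : nrm (mu a' b s (z 0 l ^+ L)) <= D a'.
  apply: le_trans (mu_bound N_gt0 ltNL a' b rL _ _ s0) _; rewrite ?nz //.
  rewrite ler_wpM2l ?exprn_ge0 // ler_expR ler_wpM2r //; lra.
have h1 := bnd a; have h2 := bnd (a + 1); have d1 := D0 a; have d2 := D0 (a + 1).
split; [lra|lra|].
apply: le_trans (H _ s h _ _ s0 h0 sT) _; rewrite ?nz //.
by rewrite ler_wpM2r ?sqr_ge0 //; lra.
Qed.

Definition settime n (q : 'I_n.+1 -> pt) s : 'I_n.+1 -> pt :=
  fun l => if l == ord0 then ((q ord0).1, s) else q l.

Lemma settimeE n (q : 'I_n.+1 -> pt) : settime q (ps (q ord0)) = q.
Proof.
apply/funext => l; rewrite /settime; case: eqP => // ->.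
by rewrite /ps; case: (q ord0).
Qed.

Lemma settime0 n (q : 'I_n.+1 -> pt) s : settime q s ord0 = ((q ord0).1, s).
Proof. by []. Qed.

Lemma tailf_settime n (q : 'I_n.+2 -> pt) s : tailf (settime q s) = tailf q.
Proof. by []. Qed.

Lemma chainW_settime n (q : 'I_n.+1 -> pt) s Z : chainW N L (settime q s) Z = chainW N L q Z.
Proof. by case: n q Z. Qed.

Lemma chainS_settime n (q : 'I_n.+1 -> pt) s Z : chainS (settime q s) Z = chainS q Z.
Proof. by case: n q Z. Qed.

Lemma settime_last n (q : 'I_n.+1 -> pt) s : (settime q s ord_max).1 = (q ord_max).1.
Proof. by rewrite /settime; case: eqP => // ->. Qed.

(** A jump without exclusion: the result need not be a configuration, but the integral makes sense
    for every integer vector. *)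
Definition push (y : 'I_N -> int) (i : 'I_N) : 'I_N -> int := fun j => y j + (j == i)%:Z.

Lemma Um_push_row y i Z (s : R) (k : nat * int) : Z != 0 -> 0 <= s ->
  forall b, Um (push y i) (k, s) Z i b =
    mu (i%:Z - pk (k, s) + b%:Z + 1) (y i - i%:Z - pa (k, s) + pk (k, s)) s Z
    + Um y (k, s) Z i b.
Proof.
move=> Z0 s0 b; rewrite !mxE /push eqxx /=.
have -> : y i + 1 - i%:Z - pa (k, s) + pk (k, s) =
  (y i - i%:Z - pa (k, s) + pk (k, s)) + 1 by ring.
by rewrite (mu_split N_gt0 ltNL).
Qed.

Lemma Um_push_row' y i (q : pt) Z : row' i (Um (push y i) q Z) = row' i (Um y q Z).
Proof.
apply/matrixP => j b; rewrite !mxE /push.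
by rewrite eq_sym (negPf (neq_lift i j)) addr0.
Qed.

Lemma row'_mulmx (F : comNzRingType) a b c (A : 'M[F]_(a, b)) (B : 'M[F]_(b, c)) i :
  row' i (A *m B) = row' i A *m B.
Proof. by apply/matrixP => u v; rewrite !mxE; apply: eq_bigr => w _; rewrite mxE. Qed.

Section Fixed.
Variables (n : nat) (q : 'I_n.+1 -> pt) (r : 'I_n.+1 -> R).
Hypotheses (qs : forall l, 0 <= ps (q l)) (r0 : forall l, 0 < r l).
Hypothesis rr : forall l l' : 'I_n.+1, (l < l')%N -> r l' < r l.
Local Notation k0 := (q ord0).1.

Let nst : nested r r. Proof. exact: nested_refl. Qed.

Definition vs (y : 'I_N -> int) s : C := vF L y (settime q s) r.

Let pref (z : 'rV[C]_n.+1) : C :=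
  (-1) ^+ ((q ord_max).1.1 * N.+1) * Zf z ord0 ^ pk (q ord0) * chainS q (Zf z).
Let W (z : 'rV[C]_n.+1) : 'M[C]_(L, N) := chainW N L q (Zf z).
Let A (y : 'I_N -> int) s z : 'M[C]_N := Um y (k0, s) (Zf z ord0) *m W z.

Let pref_nice : nice r r pref.
Proof.
apply: niceM; first by apply: niceM; [exact: nice_cst | exact: coordXz_nice].
exact: (chainS_nice ltNL).
Qed.

Let W_nice b j : nice r r (fun z => W z b j).
Proof. exact: chainW_nice. Qed.

Let Z_neq0 z : tor r z -> Zf z ord0 != 0.
Proof. by move=> /torP zr; rewrite ZfE expf_neq0 // -nrm_gt0 zr. Qed.

Lemma vsE y s : vs y s = ointn r (fun z => pref z * \det (A y s z)).
Proof.
rewrite /vs /vF; congr ointn; apply/funext => z.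
by rewrite /Jint chainW_settime chainS_settime settime_last settime0.
Qed.

Let A_nice y s i j : 0 <= s -> nice r r (fun z => A y s z i j).
Proof.
move=> s0; apply: nice_mulmx => {i j} i j; last exact: W_nice.
by apply: (Um_nice ltNL).
Qed.

Let F_nice y s : 0 <= s -> nice r r (fun z => pref z * \det (A y s z)).
Proof. by move=> s0; apply: niceM => //; apply: nice_det => i j; exact: A_nice. Qed.

Let A' y s z : 'M[C]_N :=
  \matrix_(i, j) (A (push y i) s z i j - A y s z i j).

Let det_A' y s z k : \det (\matrix_(i, j) if i == k then A' y s z i j else A y s z i j)
  = \det (A (push y k) s z) - \det (A y s z).
Proof.
apply: (det_replace_sub (i := k)).
- by apply/rowP => j; rewrite !mxE eqxx ?mxE.
- rewrite !row'_mulmx Um_push_row' -row'_mulmx; apply/matrixP => i j; rewrite !mxE.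
  by rewrite [lift k i == k]eq_sym (negPf (neq_lift k i)) ?mxE.
- apply/matrixP => i j; rewrite !mxE.
  by rewrite [lift k i == k]eq_sym (negPf (neq_lift k i)) ?mxE.
Qed.

(** Here every particle jumps freely. The second-order remainder is uniform on the torus and
    therefore survives integration. *)
Lemma vs_taylor y T : 0 <= T -> exists2 c, 0 <= c &
  forall s h, 0 <= s -> 0 <= h -> s + h <= T ->
  nrm (vs y (s + h) - vs y s - (h%:C)%C * \sum_i (vs (push y i) s - vs y s)) <= c * h ^+ 2.
Proof.
move=> T0.
have dA i j : dok r T (fun s z => A y s z i j) (fun s z => A' y s z i j).
  apply: (dok_ext (phi := fun s z => \sum_b W z b j *
       mu (i%:Z - pk (q ord0) + b%:Z) (y i - i%:Z - pa (q ord0) + pk (q ord0)) s (z 0 ord0 ^+ L))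
    (phi' := fun s z => \sum_b W z b j *
       mu (i%:Z - pk (q ord0) + b%:Z + 1) (y i - i%:Z - pa (q ord0) + pk (q ord0)) s (z 0 ord0 ^+ L))).
  - by move=> s z s0 tz; rewrite mxE; apply: eq_bigr => b _; rewrite mxE mulrC.
  - move=> s z s0 tz; rewrite mxE [A (push y i) s z i j]mxE [A y s z i j]mxE -sumrB.
    apply: eq_bigr => b _; rewrite Um_push_row ?Z_neq0 //.
    have E (u v w : C) : w * u = (u + v) * w - v * w by ring.
    exact: E.
  have D : forall c : 'I_L, dok r T (fun s z => W z c j *
       mu (i%:Z - pk (q ord0) + c%:Z) (y i - i%:Z - pa (q ord0) + pk (q ord0)) s (z 0 ord0 ^+ L))
     (fun s z => W z c j *
       mu (i%:Z - pk (q ord0) + c%:Z + 1) (y i - i%:Z - pa (q ord0) + pk (q ord0)) s (z 0 ord0 ^+ L)).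
    by move=> c; apply: dokZ => //; exact: mu_dok.
  exact: (dok_sum _ _ D).
have dF : dok r T (fun s z => pref z * \det (A y s z))
    (fun s z => \sum_i (pref z * \det (A (push y i) s z) - pref z * \det (A y s z))).
  apply: dok_ext (dokZ T0 pref_nice (dok_det T0 dA)) => // s z s0 tz.
  rewrite mulr_sumr; apply: eq_bigr => k _.
  by rewrite det_A' mulrBr.
have [c c0 H] := dF; exists (2 ^+ n.+1 * c); first by rewrite mulr_ge0 // exprn_ge0.
move=> s h s0 h0 sT; rewrite -mulrA !vsE.
under eq_bigr do rewrite !vsE.
have F1 := F_nice y s0; have F2 := F_nice y (addr_ge0 s0 h0).
have Fb i := F_nice (push y i) s0.
pose G i z := pref z * \det (A (push y i) s z) - pref z * \det (A y s z).
have nG i : nice r r (G i) := niceB (Fb i) F1.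
have -> : \sum_i (ointn r (fun z => pref z * \det (A (push y i) s z))
    - ointn r (fun z => pref z * \det (A y s z))) = ointn r (fun z => \sum_i G i z).
  rewrite (ointn_sum r0 _ _ nG).
  by apply: eq_bigr => i _; rewrite /G (ointnB r0 (Fb i) F1).
have nS : nice r r (fun z => \sum_i G i z) by apply: nice_sum.
rewrite -(ointnZ r0 _ nS) -(ointnB r0 F2 F1) -(ointnB r0 (niceB F2 F1) (niceZ _ nS)).
apply: ointn_bound => //.
- by rewrite mulr_ge0 // sqr_ge0.
- exact: (niceB (niceB F2 F1) (niceZ _ nS)).
- by move=> z tz; have [_ _] := H z s h tz s0 h0 sT.
Qed.

(** Only row i depends on y_i, with growth K^|y_i|, and each term of the determinant takes one entry
    from every row. *)
Lemma vs_growth T : 0 <= T -> exists K c : R, [/\ 1 <= K, 0 <= c &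
  forall y s, 0 <= s -> s <= T -> nrm (vs y s) <= c * K ^+ (\sum_i `|y i|)%N].
Proof.
move=> T0.
have rL : 0 < r ord0 ^+ L by rewrite exprn_gt0.
pose B := radius (pNL R N L) L (r ord0 ^+ L).
have B0 : 0 <= B by apply: radius_ge0; exact: ltW.
pose K := mu_base N L (r ord0 ^+ L) (r ord0 ^+ L) + 1.
have K1' : 0 <= mu_base N L (r ord0 ^+ L) (r ord0 ^+ L).
  by rewrite mulr_ge0 ?invr_ge0 ?(ltW rL) // exprn_ge0 // addr_ge0.
have K1 : 1 <= K by rewrite lerDr.
have K0 : 0 <= K by apply: le_trans K1.
have [bW HbW] : exists bW : 'I_L * 'I_N -> R, forall bj z, tor r z -> nrm (W z bj.1 bj.2) <= bW bj.
  have H (bj : 'I_L * 'I_N) : exists b : R, forall z, tor r z -> nrm (W z bj.1 bj.2) <= b.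
    by have [[b Hb] _] := W_nice bj.1 bj.2; exists b => z; exact: Hb.
  by have [f Hf] := choice H; exists f.
have [[bp Hbp] _] := pref_nice.
(* Bounds the part of the exponents in [Um] that does not come from y_i. *)
pose M0 := (N + absz (pk (q ord0)) + L + (N + absz (pa (q ord0)) + absz (pk (q ord0))))%N.
pose c1 := K ^+ M0 * expR (T * B) * \sum_(bj : 'I_L * 'I_N) `|bW bj|.
have c10 : 0 <= c1 by rewrite !mulr_ge0 ?exprn_ge0 ?expR_ge0 ?sumr_ge0.
exists K, (2 ^+ n.+1 * (`|bp| * (\sum_(s : 'S_N) c1 ^+ N))); split => //.
  by rewrite !mulr_ge0 ?exprn_ge0 ?sumr_ge0 // => *; rewrite exprn_ge0.
move=> y s s0 sT; rewrite vsE -mulrA; apply: ointn_bound => //.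
- by rewrite !mulr_ge0 ?exprn_ge0 ?sumr_ge0 // => *; rewrite exprn_ge0.
- exact: F_nice.
move=> z tz; rewrite nrmM -mulrA; apply: ler_pM; rewrite ?nrm_ge0 //.
  by apply: le_trans (Hbp _ tz) (ler_norm _).
have nz : nrm (z 0 ord0 ^+ L) = r ord0 ^+ L by move/torP: tz => tz; rewrite nrmX tz.
have hA i j : nrm (A y s z i j) <= c1 * K ^+ `|y i|%N.
  rewrite mxE; apply: le_trans (nrm_sum _ _ _) _.
  apply: (@le_trans _ _ (\sum_(b < L) K ^+ M0 * K ^+ `|y i|%N * expR (T * B) * `|bW (b, j)|)).
    apply: ler_sum => b _; rewrite nrmM; apply: ler_pM; rewrite ?nrm_ge0 //; last first.
      by apply: le_trans (HbW (b, j) z tz) (ler_norm _).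
    rewrite mxE; apply: le_trans (mu_bound N_gt0 ltNL _ _ rL _ _ s0) _; rewrite ?nz //.
    apply: ler_pM; rewrite ?exprn_ge0 ?expR_ge0 //; last first.
      by rewrite ler_expR ler_wpM2r.
    rewrite -exprD; apply: (@le_trans _ _ (K ^+ (absz (i%:Z - pk (k0, s) + b%:Z)%R +
        absz (y i - i%:Z - pa (k0, s) + pk (k0, s))%R)%N)).
      by rewrite lerXn2r ?nnegrE // lerDl.
    apply: ler_weXn2l => //; rewrite /M0 /pk /pa /=.
    by have := ltn_ord i; have := ltn_ord b; lia.
  have -> : c1 * K ^+ `|y i|%N = \sum_(bj : 'I_L * 'I_N)
       K ^+ M0 * K ^+ `|y i|%N * expR (T * B) * `|bW bj|.
    by rewrite -mulr_sumr /c1; ring.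
  have -> : \sum_(bj : 'I_L * 'I_N) K ^+ M0 * K ^+ `|y i|%N * expR (T * B) * `|bW bj| =
      \sum_(b < L) \sum_(j < N) K ^+ M0 * K ^+ `|y i|%N * expR (T * B) * `|bW (b, j)|.
    by rewrite pair_bigA; apply: eq_bigr => -[].
  apply: ler_sum => b _; rewrite (bigD1 j) //= lerDl sumr_ge0 // => *.
  by rewrite !mulr_ge0 ?exprn_ge0 ?expR_ge0.
rewrite /determinant; apply: le_trans (nrm_sum _ _ _) _.
rewrite mulr_suml; apply: ler_sum => sg _.
rewrite nrmM nrmX nrmN nrm1 expr1n mul1r nrm_prod.
apply: (@le_trans _ _ (\prod_(i < N) (c1 * K ^+ `|y i|%N))).
  by apply: ler_prod => i _; rewrite nrm_ge0 hA.
by rewrite big_split /= prodr_const card_ord prodrXr.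
Qed.

(** Pushing particle i adds w times its row, with weight w^(i+1-k) (w+1)^(y_i-i-a+k); for j = i + 1
    and y_j = y_i + 1 this is row j. *)
Lemma vs_blocked_adj y (i j : 'I_N) s : 0 <= s -> (j : nat) = i.+1 -> y j = y i + 1 ->
  vs (push y i) s = vs y s.
Proof.
move=> s0 ji yj; rewrite !vsE; apply: ointn_ext => // z tz; congr (_ * _).
have ij : i != j by apply/eqP => /(congr1 val) /= ; lia.
apply: (det_add_row (j := j) (c := 1) ij); last by rewrite !row'_mulmx Um_push_row'.
rewrite /A !row_mul scalemxAl -mulmxDl; congr (_ *m _); apply/rowP => b.
rewrite !mxE -[mu _ _ _ _]/(mu _ _ _ _).
have -> : push y i i - i%:Z - pa (k0, s) + pk (k0, s) =
  (y i - i%:Z - pa (k0, s) + pk (k0, s)) + 1 by rewrite /push eqxx /=; ring.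
rewrite (mu_split N_gt0 ltNL) ?Z_neq0 // addrC mul1r; congr (_ + _).
by rewrite yj ji -[i.+1]addn1 PoszD; congr (mu _ _ _ _); ring.
Qed.

(** The added row has i + 1 = N and y_i - i = y_j + L - N, so its weight is that of row 0 times w^N
    (w+1)^(L-N), which equals Z. *)
Lemma vs_blocked_per y (i j : 'I_N) s : 0 <= s -> (j : nat) = 0%N -> i.+1 = N ->
  y i + 1 = y j + L%:Z -> i != j -> vs (push y i) s = vs y s.
Proof.
move=> s0 j0 iN yj ij; rewrite !vsE; apply: ointn_ext => // z tz; congr (_ * _).
apply: (det_add_row (j := j) (c := Zf z ord0) ij); last by rewrite !row'_mulmx Um_push_row'.
rewrite /A !row_mul scalemxAl -mulmxDl; congr (_ *m _); apply/rowP => b.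
rewrite !mxE.
have -> : push y i i - i%:Z - pa (k0, s) + pk (k0, s) =
  (y i - i%:Z - pa (k0, s) + pk (k0, s)) + 1 by rewrite /push eqxx /=; ring.
rewrite (mu_split N_gt0 ltNL) ?Z_neq0 // addrC; congr (_ + _).
rewrite -(mu_shift N_gt0 ltNL) ?Z_neq0 // j0.
have hN : N%:Z = i%:Z + 1 by lia.
have hLN : (L - N)%:Z = L%:Z - N%:Z by rewrite subzn // ltnW.
have hy : y i = y j + L%:Z - 1 by rewrite -yj; ring.
by congr (mu _ _ _ _); rewrite ?hLN ?hN ?hy; ring.
Qed.

End Fixed.
End VEvolution.

(** * The semigroup and uniqueness *)

Section CountableSums.
Variables (R : realType) (T : countType).
Local Open Scope ereal_scope.
Implicit Types (a b : T -> \bar R).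

(** Transfers a family to the natural numbers along [pickle], with [d] at the codes of no element,
    so that results on series apply. *)
Definition enumT (U : Type) (d : U) (a : T -> U) (n : nat) : U := oapp a d (pickle_inv n).

Lemma esum_pickle a : (forall x, 0 <= a x) ->
  \esum_(x in [set: T]) a x = \sum_(n <oo) enumT 0 a n.
Proof.
move=> a0; have e0 n : 0 <= enumT 0 a n by rewrite /enumT; case: pickle_inv => //= x.
rewrite nneseries_esumT // (esumID (pickle @` [set: T])) // setTI.
rewrite esum_image; last by move=> x y _ _; exact: (pcan_inj pickleK_inv).
rewrite [X in _ + X]esum1 ?adde0.
  by apply: eq_esum => x _; rewrite /enumT pickleK_inv.
move=> n [_ /= nI]; rewrite /enumT; case E : (pickle_inv n) => [x|] //=.
by case: nI; exists x => //; have := @pickle_invK T n; rewrite /= E.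
Qed.

Lemma esumZ (c : R) a : (0 <= c)%R -> (forall x, 0 <= a x) ->
  \esum_(x in [set: T]) (c%:E * a x) = c%:E * \esum_(x in [set: T]) a x.
Proof.
move=> c0 a0; rewrite !esum_pickle //; last by move=> x; rewrite mule_ge0.
rewrite -nneseriesZl //; last by move=> n _; rewrite /enumT; case: pickle_inv => //= x.
by apply: eq_eseriesr => n _; rewrite /enumT; case: pickle_inv => //=; rewrite mule0.
Qed.

Lemma esum_exchange (f : T -> T -> \bar R) : (forall x y, 0 <= f x y) ->
  \esum_(x in [set: T]) \esum_(y in [set: T]) f x y =
  \esum_(y in [set: T]) \esum_(x in [set: T]) f x y.
Proof.
move=> f0; have g0 n m : 0 <= enumT 0 (fun x => enumT 0 (f x) m) n.
  by rewrite /enumT; case: (@pickle_inv T n) => [x|] //=; case: (@pickle_inv T m) => //=.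
rewrite esum_pickle; last by move=> x; exact: esum_ge0.
rewrite [RHS]esum_pickle; last by move=> x; exact: esum_ge0.
transitivity (\sum_(n <oo) \sum_(m <oo) enumT 0 (fun x => enumT 0 (f x) m) n).
  apply: eq_eseriesr => n _; rewrite {1}/enumT; case E : (pickle_inv n) => [x|] /=.
    rewrite esum_pickle //; apply: eq_eseriesr => m _.
    by rewrite [RHS]/enumT E.
  by rewrite eseries0 // => m _ _; rewrite /enumT E.
rewrite nneseries_interchange //; apply: eq_eseriesr => m _.
rewrite [RHS]/enumT; case E : (pickle_inv m) => [y|] /=.
  rewrite esum_pickle //; apply: eq_eseriesr => n _.
  by rewrite /enumT E.
rewrite eseries0 // => n _ _; rewrite /enumT E.
by case: pickle_inv.
Qed.

Lemma measure_esum d (S : measurableType d) (P : {measure set S -> \bar R}) (A : T -> set S) :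
  (forall x, measurable (A x)) -> (forall x y w, A x w -> A y w -> x = y) ->
  P (\bigcup_x A x) = \esum_(x in [set: T]) P (A x).
Proof.
move=> mA dA; rewrite esum_pickle // (_ : \bigcup_x A x = \bigcup_n enumT set0 A n).
  rewrite measure_bigcup.
  - rewrite (@eq_eseriesl _ _ xpredT); last first.
      by move=> n; exact: mem_set.
    by apply: eq_eseriesr => n _; rewrite /enumT; case: pickle_inv => //=; rewrite measure0.
  - by move=> n _; rewrite /enumT; case: pickle_inv => //=.
  apply/trivIsetP => n m _ _ nm; rewrite /enumT.
  case En : (pickle_inv n) => [x|] /=; last by rewrite set0I.
  case Em : (pickle_inv m) => [y|] /=; last by rewrite setI0.
  apply/seteqP; split=> // w [Ax Ay]; have xy := dA _ _ _ Ax Ay.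
  have := @pickle_invK T n; have := @pickle_invK T m; rewrite En Em /= xy => e1 e2.
  by move/eqP: nm; rewrite -e1 -e2.
apply/seteqP; split=> w.
  by move=> [x _ Ax]; exists (pickle x) => //; rewrite /enumT pickleK_inv.
by move=> [n _]; rewrite /enumT; case: pickle_inv => //= x Ax; exists x.
Qed.

Lemma esum_fin_split a (zs : seq T) : uniq zs -> (forall x, 0 <= a x) ->
  \esum_(x in [set: T]) a x =
  \sum_(z <- zs) a z + \esum_(x in [set x | x \notin zs]) a x.
Proof.
move=> uz a0; rewrite (esumID [set x | x \in zs]) // !setTI; congr (_ + _).
  rewrite esum_fset //; last exact: finite_seq.
  rewrite -fsbig_seq //.
congr (esum _ _); apply/seteqP; split=> x /=; by move/negP.
Qed.

End CountableSums.

Section Semigroup.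
Variables (R : realType) (N L : nat).
Hypotheses (N_gt0 : (0 < N)%N) (ltNL : (N < L)%N).
Local Notation S := (conf N L).
Variable p : R -> S -> S -> R.
Hypothesis hp : tasep_transition p.
Implicit Types (g w : S -> R) (s h : R) (x : S).

Definition unitf g := forall x, 0 <= g x <= 1.

(** For [unitf g] and s >= 0 the sum lies between 0 and 1, so [fine] loses nothing. *)
Definition expect g s x : R := fine (\esum_(y in [set: S]) (p s x y * g y)%:E)%E.

Lemma expectE g s x : unitf g -> 0 <= s ->
  (\esum_(y in [set: S]) (p s x y * g y)%:E = (expect g s x)%:E)%E /\ 0 <= expect g s x <= 1.
Proof.
move=> ug s0.
have h1 : (\esum_(y in [set: S]) (p s x y * g y)%:E <= 1)%E.
  rewrite -(transition_sum hp x s0); apply: le_esum => y _.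
  have /andP[_ g1] := ug y; rewrite lee_fin -[X in _ <= X]mulr1.
  by rewrite ler_wpM2l // (transition_ge0 hp).
have h0 : (0 <= \esum_(y in [set: S]) (p s x y * g y)%:E)%E.
  apply: esum_ge0 => y _; have /andP[g0 _] := ug y.
  by rewrite lee_fin mulr_ge0 // (transition_ge0 hp).
have fn : (\esum_(y in [set: S]) (p s x y * g y)%:E \is a fin_num)%E.
  by rewrite ge0_fin_numE // (le_lt_trans h1) // ltry.
split; first by rewrite /expect fineK.
by rewrite -!lee_fin /expect fineK // h0.
Qed.

Lemma expect_unit g s : unitf g -> 0 <= s -> unitf (expect g s).
Proof. by move=> ug s0 x; have [] := expectE x ug s0. Qed.

(** Chapman-Kolmogorov with the increment h taken first: the form that leads to the backward
    equation. *)
Lemma expect_semigroup g s h x : unitf g -> 0 <= s -> 0 <= h ->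
  expect g (h + s) x = expect (expect g s) h x.
Proof.
move=> ug s0 h0; have us := expect_unit ug s0.
apply: EFin_inj; rewrite -(proj1 (expectE x ug (addr_ge0 h0 s0))) -(proj1 (expectE x us h0)).
have p0 t y z : 0 <= t -> 0 <= p t y z by move=> t0; exact: (transition_ge0 hp).
have g0 y : 0 <= g y by have /andP[] := ug y.
transitivity (\esum_(y in [set: S]) \esum_(z in [set: S]) (g y * (p h x z * p s z y))%:E)%E.
  apply: eq_esum => y _; rewrite EFinM (transition_semigroup hp _ _ h0 s0) muleC.
  rewrite -esumZ //; last by move=> z; rewrite lee_fin mulr_ge0 // p0.
rewrite esum_exchange; last by move=> y z; rewrite lee_fin !mulr_ge0 // p0.
apply: eq_esum => z _; rewrite EFinM -(proj1 (expectE z ug s0)) -esumZ ?p0 //; last first.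
  by move=> y; rewrite lee_fin mulr_ge0 // p0.
by apply: eq_esum => y _; rewrite -EFinM; congr EFin; ring.
Qed.

(** Since 0 <= g <= 1, the states outside [zs] contribute at most their total probability. *)
Lemma expect_fin g s x (zs : seq S) : uniq zs -> unitf g -> 0 <= s ->
  `|expect g s x - \sum_(z <- zs) p s x z * g z| <= 1 - \sum_(z <- zs) p s x z.
Proof.
move=> uz ug s0.
have p0 z : 0 <= p s x z by exact: (transition_ge0 hp).
have g0 y : 0 <= g y by have /andP[] := ug y.
have gl1 y : g y <= 1 by have /andP[] := ug y.
have h1 := transition_sum hp x s0.
rewrite (esum_fin_split uz) in h1; last by move=> z; rewrite lee_fin.
have h2 := proj1 (expectE x ug s0).
rewrite (esum_fin_split uz) in h2; last by move=> z; rewrite lee_fin mulr_ge0.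
rewrite sumEFin in h1; rewrite sumEFin in h2.
set A := (esum _ _) in h1; set B := (esum _ _) in h2.
have B0 : (0 <= B)%E by apply: esum_ge0 => y _; rewrite lee_fin mulr_ge0.
have BA : (B <= A)%E.
  by apply: le_esum => y _; rewrite lee_fin -[X in _ <= X]mulr1 ler_wpM2l.
move: A B h1 h2 B0 BA => [a| |] [b| |] //=.
rewrite -!EFinD !lee_fin => -[h1] [h2] b0 ba.
rewrite -h1 -h2 addrAC subrr add0r addrAC subrr add0r ger0_norm //.
Qed.

Lemma expect0 g x : unitf g -> expect g 0 x = g x.
Proof.
move=> ug; have := @expect_fin g 0 x [:: x] isT ug (lexx _).
rewrite !big_seq1 (transition_init hp) eqxx mul1r subrr => h.
by apply/eqP; rewrite -subr_eq0 -normr_eq0; apply/eqP/le_anti; rewrite h normr_ge0.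
Qed.

Lemma generator_sum w x (zs : seq S) : uniq zs -> x \in zs ->
  (forall i, attempt x i \in zs) ->
  \sum_(z <- zs) qrate x z * w z = tasep_generator w x.
Proof.
move=> uz xz az; rewrite /qrate /tasep_generator.
under eq_bigr do rewrite mulr_suml.
rewrite exchange_big /=; apply: eq_bigr => i _.
have pick (a : S) : a \in zs -> \sum_(z <- zs) (a == z)%:R * w z = w a :> R.
  move=> ain; rewrite (bigD1_seq a) //= eqxx mul1r big1 ?addr0 // => z za.
  by rewrite eq_sym (negPf za) mul0r.
under eq_bigr do rewrite mulrBl.
by rewrite sumrB !pick.
Qed.

(** The rates are limits for each target separately, so only finitely many targets can be controlled
    together: x and its successors. The rates from x sum to zero over these, hence the mass outside
    is o(h), and the estimate becomes uniform in [w]. *)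
Lemma expect_first_order x e : 0 < e -> exists2 d, 0 < d & forall h w, 0 < h -> h < d ->
  unitf w -> `|expect w h x - w x - h * tasep_generator w x| <= e * h.
Proof.
move=> e0; pose zs := undup (x :: [seq attempt x i | i <- enum 'I_N]).
have uz : uniq zs by exact: undup_uniq.
have xz : x \in zs by rewrite mem_undup inE eqxx.
have az i : attempt x i \in zs.
  by rewrite mem_undup inE; apply/orP; right; apply/mapP; exists i => //; rewrite mem_enum.
(* The error over [zs] is counted twice, once for the escaping mass; the extra 1 keeps [m]
   positive. *)
pose m : R := (size zs).*2.+1%:R.
have em : 0 < e / m by rewrite divr_gt0.
have near1 : \forall h \near 0^'+, forall z, z \in zs ->
    `|p h x z - (x == z)%:R - h * qrate x z| <= e / m * h.
  elim: (zs) => [|z l IH]; first by near=> h.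
  have /cvgrPdist_le /(_ _ em) H := @transition_rate _ _ _ _ hp x z.
  near=> h.
  have Hl : forall z, z \in l -> `|p h x z - (x == z)%:R - h * qrate x z| <= e / m * h.
    by near: h; exact: IH.
  move=> z'; rewrite inE => /orP[/eqP ->|]; last exact: Hl.
  have h0 : 0 < h by near: h; exact: nbhs_right_gt.
  have Hh : `|qrate x z - (p h x z - (x == z)%:R) / h| <= e / m by near: h; exact: H.
  have -> : p h x z - (x == z)%:R - h * qrate x z =
      - (qrate x z - (p h x z - (x == z)%:R) / h) * h by field; rewrite gt_eqF.
  by rewrite normrM normrN (gtr0_norm h0) ler_wpM2r // ltW.
move: near1; rewrite /at_right => -[d /= d0 Hd].
exists d => // h w h0 hd uw.
have {}Hd : forall z, z \in zs -> `|p h x z - (x == z)%:R - h * qrate x z| <= e / m * h.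
  by apply: Hd => //=; rewrite sub0r normrN gtr0_norm.
have h0' := ltW h0.
have E1 := expect_fin x uz uw h0'.
have S1 : \sum_(z <- zs) (x == z)%:R * w z = w x.
  rewrite (bigD1_seq x) //= eqxx mul1r big1 ?addr0 // => z za.
  by rewrite eq_sym (negPf za) mul0r.
have S2 : \sum_(z <- zs) (x == z)%:R = 1 :> R.
  by rewrite (bigD1_seq x) //= eqxx big1 ?addr0 // => z za; rewrite eq_sym (negPf za).
have S3 := generator_sum w uz xz az.
have S4 : \sum_(z <- zs) qrate x z = 0 :> R.
  have := generator_sum (fun=> 1) uz xz az; under eq_bigr do rewrite mulr1.
  by move=> ->; rewrite /tasep_generator big1 // => i _; rewrite subrr.
pose D := \sum_(z <- zs) `|p h x z - (x == z)%:R - h * qrate x z|.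
have DB : D <= (size zs)%:R * (e / m * h).
  have -> : (size zs)%:R * (e / m * h) = \sum_(z <- zs) (e / m * h).
    by rewrite big_const_seq count_predT iter_addr_0 mulr_natl.
  rewrite /D big_seq [X in _ <= X]big_seq.
  by apply: ler_sum => z zz; exact: Hd.
have D1 : 1 - \sum_(z <- zs) p h x z <= D.
  have -> : 1 - \sum_(z <- zs) p h x z = - \sum_(z <- zs) (p h x z - (x == z)%:R - h * qrate x z).
    by rewrite !sumrB -mulr_sumr S2 S4; ring.
  apply: le_trans (ler_norm _) _; rewrite normrN; exact: ler_norm_sum.
have D2 : `|\sum_(z <- zs) p h x z * w z - w x - h * tasep_generator w x| <= D.
  have -> : \sum_(z <- zs) p h x z * w z - w x - h * tasep_generator w x =
     \sum_(z <- zs) (p h x z - (x == z)%:R - h * qrate x z) * w z.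
    under [RHS]eq_bigr do rewrite !mulrBl -mulrA.
    by rewrite !sumrB -mulr_sumr S1 S3.
  apply: le_trans (ler_norm_sum _ _ _) _; apply: ler_sum => z _.
  rewrite normrM -[X in _ <= X]mulr1 ler_wpM2l //.
  by have /andP[a b] := uw z; rewrite ger0_norm.
have -> : expect w h x - w x - h * tasep_generator w x =
  (expect w h x - \sum_(z <- zs) p h x z * w z) +
  (\sum_(z <- zs) p h x z * w z - w x - h * tasep_generator w x) by ring.
apply: le_trans (ler_normD _ _) _.
apply: le_trans (lerD (le_trans E1 D1) D2) _.
apply: le_trans (lerD DB DB) _.
have -> : (size zs)%:R * (e / m * h) + (size zs)%:R * (e / m * h) =
   ((size zs).*2%:R / m) * (e * h) by rewrite -addnn natrD; ring.
rewrite -[X in _ <= X]mul1r ler_wpM2r ?mulr_ge0 ?(ltW e0) //.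
by rewrite ler_pdivrMr // mul1r ler_nat.
Unshelve. all: by end_near. Qed.

End Semigroup.

(** * Uniqueness for the backward equation *)

Section Uniqueness.
Variables (R : realType) (N L : nat).
Hypotheses (N_gt0 : (0 < N)%N) (ltNL : (N < L)%N).
Local Notation S := (conf N L).
Local Notation C := (Cplx R).

(** A jump raises it by at most one; hence the generator is bounded on functions of growth
    [K ^+ weight x]. *)
Definition weight (x : S) : nat := (\sum_i `|val x i|)%N.

Lemma val_attempt (x : S) i : val (attempt x i) = jump (val x) i \/
  (~~ @in_conf N L (jump (val x) i) /\ attempt x i = x).
Proof.
rewrite /attempt /insubd; case: insubP => [u _ ->|h]; first by left.
by right.
Qed.

Lemma weight_attempt (x : S) i : (weight (attempt x i) <= (weight x).+1)%N.
Proof.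
case: (val_attempt x i) => [E|[_ ->]]; last exact: leqnSn.
rewrite /weight E (bigD1 i) //= [X in (_ <= X.+1)%N](bigD1 i) //= -addSn.
apply: leq_add; first by rewrite ffunE eqxx; move: (_ x) => f; lia.
apply: leq_sum => j ji; rewrite ffunE (negPf ji) /= addr0 //.
Qed.

Section Vanish.
Variable D : R -> S -> C.
Let GD s x : C := \sum_i (D s (attempt x i) - D s x).
Hypothesis D_init : forall x, D 0 x = 0.
Hypothesis D_evol : forall x T e, 0 < e -> exists2 d, 0 < d &
  forall s h, 0 <= s -> 0 < h -> h < d -> s + h <= T ->
  nrm (D (s + h) x - D s x - (h%:C)%C * GD s x) <= e * h.
Hypothesis D_growth : forall T, 0 <= T -> exists K c : R, [/\ 1 <= K, 0 <= c &
  forall s x, 0 <= s -> s <= T -> nrm (D s x) <= c * K ^+ weight x].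

(** The generator enlarges the weighted bound [c] by at most the factor N (K + 1). Starting from
    zero at time a, Euler steps of vanishing size bound the solution by elapsed time times this, and
    the interval is short enough to make that at most c / 2. *)
Let halving T K c a b : 0 <= a -> a <= b -> b <= T -> 1 <= K -> 0 <= c ->
  (b - a) * (N%:R * (K + 1)) <= 2^-1 -> (forall x, D a x = 0) ->
  (forall s x, a <= s -> s <= b -> nrm (D s x) <= c * K ^+ weight x) ->
  forall s x, a <= s -> s <= b -> nrm (D s x) <= c / 2 * K ^+ weight x.
Proof.
move=> a0 ab bT K1 c0 small Da Dc s x as_ sb.
have K0 : 0 <= K by apply: le_trans K1.
have W0 : 0 <= K ^+ weight x by rewrite exprn_ge0.
pose G := N%:R * (c * K ^+ weight x * (K + 1)).
have G0 : 0 <= G by rewrite !mulr_ge0 // addr_ge0.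
have GDb u : a <= u -> u <= b -> nrm (GD u x) <= G.
  move=> au ub; apply: le_trans (nrm_sum _ _ _) _.
  apply: (@le_trans _ _ (\sum_(i < N) (c * K ^+ weight x * (K + 1)))); last first.
    by rewrite sumr_const card_ord -mulr_natl.
  apply: ler_sum => i _; apply: le_trans (nrmB _ _) _.
  rewrite mulrDr mulr1; apply: lerD; last exact: Dc.
  apply: le_trans (Dc _ _ au ub) _; rewrite -mulrA ler_wpM2l // -exprSr.
  by apply: ler_weXn2l => //; exact: weight_attempt.
suff H e : 0 < e -> nrm (D s x) <= (s - a) * (e + G).
  apply/ler_addgt0Pr => e e0.
  have [->|sa] := eqVneq s a.
    by rewrite Da nrm0 addr_ge0 ?(ltW e0) // !mulr_ge0.
  have sa0 : 0 < s - a by rewrite subr_gt0 lt_neqAle eq_sym sa.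
  apply: le_trans (H (e / (s - a)) (divr_gt0 e0 sa0)) _.
  rewrite mulrDr [(s - a) * (e / _)]mulrC divfK ?gt_eqF // addrC lerD2r.
  have -> : (s - a) * G = ((s - a) * (N%:R * (K + 1))) * (c * K ^+ weight x) by rewrite /G; ring.
  have -> : c / 2 * K ^+ weight x = 2^-1 * (c * K ^+ weight x) by ring.
  rewrite ler_wpM2r ?mulr_ge0 //; apply: le_trans small.
  by rewrite ler_wpM2r ?mulr_ge0 ?addr_ge0 // lerD2r.
move=> e0; have [d d0 Hd] := @D_evol x T e e0.
have [->|sa] := eqVneq s a; first by rewrite Da nrm0 subrr mul0r.
have sa0 : 0 < s - a by rewrite subr_gt0 lt_neqAle eq_sym sa.
(* Enough equal steps to make each shorter than [d]. *)
have [n nn] : exists n : nat, (s - a) / d < n.+1%:R.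
  exists (Num.bound ((s - a) / d)); apply: lt_le_trans (archi_boundP _) _.
    by rewrite divr_ge0 // ltW.
  by rewrite ler_nat.
pose h := (s - a) / n.+1%:R.
have n0 : 0 < n.+1%:R :> R by rewrite ltr0n.
have h0 : 0 < h by rewrite divr_gt0.
have hd : h < d by rewrite ltr_pdivrMr // mulrC -ltr_pdivrMr.
have nh : n.+1%:R * h = s - a by rewrite mulrC divfK ?gt_eqF.
have key i : (i <= n.+1)%N -> nrm (D (a + i%:R * h) x) <= i%:R * h * (e + G).
  elim: i => [|i IH] iN; first by rewrite !mul0r addr0 Da nrm0.
  have IHi := IH (ltnW iN).
  have ih : i%:R * h + h <= s - a.
    by rewrite -nh -{2}[h]mul1r -mulrDl ler_wpM2r ?(ltW h0) // natr1 ler_nat.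
  have ih0 : 0 <= i%:R * h by rewrite mulr_ge0 // ltW.
  have au : a <= a + i%:R * h by rewrite lerDl.
  have ub : a + i%:R * h <= b by lra.
  have uh : a + i%:R * h + h <= T by lra.
  have h1 := Hd (a + i%:R * h) h (le_trans a0 au) h0 hd uh.
  have -> : a + i.+1%:R * h = a + i%:R * h + h by rewrite -natr1 mulrDl mul1r addrA.
  set u := a + i%:R * h in h1 au ub uh IHi *.
  have -> : D (u + h) x = (D (u + h) x - D u x - (h%:C)%C * GD u x) + (h%:C)%C * GD u x + D u x.
    by ring.
  apply: le_trans (nrmD _ _) _; apply: le_trans (lerD (nrmD _ _) (lexx _)) _.
  have h2 : nrm ((h%:C)%C * GD u x) <= h * G.
    by rewrite nrmM nrm_real gtr0_norm // ler_wpM2l ?(ltW h0) // GDb.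
  rewrite -natr1 mulrDl mul1r; move: IHi h1 h2; rewrite mulrDl; lra.
have := key n.+1 (leqnn _); rewrite nh addrCA subrr addr0 //.
Qed.

Let vanish_step T K a b : 0 <= a -> a <= b -> b <= T -> 1 <= K ->
  (b - a) * (N%:R * (K + 1)) <= 2^-1 -> (forall x, D a x = 0) ->
  (exists2 c, 0 <= c & forall s x, 0 <= s -> s <= T -> nrm (D s x) <= c * K ^+ weight x) ->
  forall s x, a <= s -> s <= b -> D s x = 0.
Proof.
move=> a0 ab bT K1 small Da [c c0 Dc] s x as_ sb.
have K0 : 0 <= K by apply: le_trans K1.
have H j : forall s x, a <= s -> s <= b -> nrm (D s x) <= c / 2 ^+ j * K ^+ weight x.
  elim: j => [|j IH].
    by move=> s' x' h1 h2; rewrite expr0 divr1; apply: Dc; lra.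
  have := halving a0 ab bT K1 _ small Da IH.
  have -> : c / 2 ^+ j.+1 = c / 2 ^+ j / 2 by rewrite exprSr invfM mulrA.
  by apply; rewrite divr_ge0 // exprn_ge0.
apply/eqP; rewrite -nrm_eq0; apply/eqP/le_anti; rewrite nrm_ge0 andbT.
have cv : c / 2 ^+ j * K ^+ weight x @[j --> \oo] --> (c * 0 * K ^+ weight x : R).
  apply: cvgM; last exact: cvg_cst.
  apply: cvgM; first exact: cvg_cst.
  have := @cvg_expr R 2^-1; rewrite ger0_norm // => /(_ _) cv.
  have -> : (fun j => (2 ^+ j)^-1) = (fun j => 2^-1 ^+ j) :> (nat -> R).
    by apply/funext => j; rewrite exprVn.
  by apply: cv; rewrite invf_lt1 // ltr1n.
rewrite mulr0 mul0r in cv; rewrite -[X in _ <= X](cvg_lim (@Rhausdorff R) cv).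
apply: limr_ge; first by apply/cvg_ex; eexists; exact: cv.
by near=> j; exact: H.
Unshelve. all: by end_near. Qed.

(** The growth constant [K] is chosen once for the whole interval [0, s], so all subintervals have
    the same admissible length and finitely many of them reach s. *)
Lemma evolution_vanish s x : 0 <= s -> D s x = 0.
Proof.
move=> s0; have [K [c [K1 c0 Dc]]] := D_growth s0.
pose B : R := N%:R * (K + 1).
have B0 : 0 <= B by rewrite mulr_ge0 // addr_ge0 // (le_trans ler01 K1).
have [n nn] : exists n : nat, 2 * s * B < n.+1%:R.
  exists (Num.bound (2 * s * B)); apply: lt_le_trans (archi_boundP _) _.
    by do 2 (apply: mulr_ge0 => //).
  by rewrite ler_nat.
pose h := s / n.+1%:R.
have h0 : 0 <= h by rewrite divr_ge0 // ltW.
have hB : h * B <= 2^-1.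
  by rewrite /h mulrAC ler_pdivrMr //; lra.
have nh : n.+1%:R * h = s by rewrite mulrC divfK ?gt_eqF.
have key i : (i <= n.+1)%N -> forall x, D (i%:R * h) x = 0.
  elim: i => [|i IH] iN x'; first by rewrite mul0r.
  have ih : i%:R * h + h <= s.
    by rewrite -nh -{2}[h]mul1r -mulrDl ler_wpM2r // natr1 ler_nat.
  have ih0 : 0 <= i%:R * h by rewrite mulr_ge0.
  rewrite -natr1 mulrDl mul1r.
  apply: (@vanish_step s K (i%:R * h) (i%:R * h + h)) => //.
  - by rewrite lerDl.
  - by rewrite addrAC subrr add0r.
  - exact: IH (ltnW iN).
  - by exists c.
  - by rewrite lerDl.
by rewrite -nh; exact: key.
Qed.

End Vanish.
End Uniqueness.

(** * Finite-dimensional distributions *)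

Section MultiTime.
Variables (R : realType) (N L : nat).
Hypotheses (N_gt0 : (0 < N)%N) (ltNL : (N < L)%N).
Local Notation S := (conf N L).
Local Notation C := (Cplx R).
Local Notation pt := (pt R).
Variable p : R -> S -> S -> R.
Hypothesis hp : tasep_transition p.

(** The particle index in [pt] is a natural number, hence the quantifier over the coordinates that
    match it. *)
Definition chi (q : pt) (y : S) : R :=
  [forall i : 'I_N, (i == q.1.1 :> nat) ==> (pa q <= val y i)]%:R.

Lemma chiE (q : pt) (k : 'I_N) y : q.1.1 = k -> chi q y = ((pa q <= val y k)%R)%:R.
Proof.
move=> qk; rewrite /chi qk; congr (nat_of_bool _)%:R.
apply/forallP/idP => [/(_ k)|h i]; first by rewrite eqxx.
by apply/implyP => /eqP ik; rewrite (val_inj ik).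
Qed.

Lemma chi_unit q : unitf (chi q).
Proof. by move=> y; rewrite /chi; case: [forall _, _]; rewrite /= ?lexx ?ler01. Qed.

Lemma unitfM (g w : S -> R) : unitf g -> unitf w -> unitf (fun x => g x * w x).
Proof.
move=> ug uw x; have /andP[a b] := ug x; have /andP[c d] := uw x.
by rewrite mulr_ge0 //= mulr_ile1.
Qed.

(** The joint probability from a given state, by conditioning on the state at the first of the
    times. *)
Fixpoint fval n : ('I_n.+1 -> pt) -> S -> R :=
  if n is n'.+1 then fun q =>
    expect p (fun y => chi (q ord0) y * fval (tailf q) y) (ps (q ord0))
  else fun q => expect p (chi (q ord0)) (ps (q ord0)).

Lemma fval_unit n (q : 'I_n.+1 -> pt) : (forall l, 0 <= ps (q l)) -> unitf (fval q).
Proof.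
elim: n q => [|n IH] q q0 /=; first exact: (expect_unit hp (chi_unit _)).
apply: (expect_unit hp) => //; apply: unitfM; first exact: chi_unit.
by apply: IH => l; exact: q0.
Qed.

Lemma vs_attempt n (q : 'I_n.+1 -> pt) r (x : S) i s : 0 <= s -> (forall l, 0 < r l) ->
  vs L q r (push (val x) i) s = vs L q r (val (attempt x i)) s.
Proof.
move=> s0 r0; have bE : push (val x) i = jump (val x) i.
  by apply/funext => j; rewrite ffunE.
case: (val_attempt x i) => [->|[h ->]]; first by rewrite bE.
case: (not_in_conf_jump N_gt0 ltNL h) => [[j ji xj]|[j j0 [iN xi]]].
  exact: (vs_blocked_adj N_gt0 ltNL q r0 s0 ji xj).
apply: (vs_blocked_per N_gt0 ltNL _ r0 s0 j0) => //.
(* For a single particle, being blocked by its own image would force L = 1. *)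
apply/eqP => ij; rewrite ij in xi iN; move: xi; rewrite j0 in iN.
by move: (val x j) => t; lia.
Qed.

Lemma increment_split (V1 V0 : C) (V : 'I_N -> C) (a1 a0 : R) (a : 'I_N -> R) (h : R) :
  (V1 - (a1%:C)%C) - (V0 - (a0%:C)%C)
    - (h%:C)%C * \sum_i ((V i - ((a i)%:C)%C) - (V0 - (a0%:C)%C)) =
  (V1 - V0 - (h%:C)%C * \sum_i (V i - V0))
    - ((a1 - a0 - h * \sum_i (a i - a0))%:C)%C.
Proof.
have -> : \sum_i ((V i - ((a i)%:C)%C) - (V0 - (a0%:C)%C)) =
    \sum_i (V i - V0) - ((\sum_i (a i - a0))%:C)%C.
  rewrite real_complex_sum -sumrB; apply: eq_bigr => i _.
  by rewrite real_complexD real_complexN; ring.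
rewrite [in RHS]real_complexD [in RHS]real_complexD !real_complexN real_complexM.
ring.
Qed.

(** The difference [D] of both sides has zero initial value and satisfies the backward equation up
    to o(h); its growth is that of the integral, the expectation being at most 1. *)
Lemma expect_vF n (q : 'I_n.+1 -> pt) (r : 'I_n.+1 -> R) (g : S -> R) :
  (forall l, 0 <= ps (q l)) -> (forall l, 0 < r l) ->
  (forall l l' : 'I_n.+1, (l < l')%N -> r l' < r l) -> unitf g ->
  (forall x : S, vF L (val x) (settime q 0) r = ((g x)%:C)%C) ->
  forall x : S, ((expect p g (ps (q ord0)) x)%:C)%C = vF L (val x) q r.
Proof.
move=> q0 r0 rr ug gE x.
pose D s (x : S) : C := vs L q r (val x) s - ((expect p g s x)%:C)%C.
suff H : D (ps (q ord0)) x = 0.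
  by apply/eqP; rewrite eq_sym -subr_eq0 -[X in vF _ _ X _](settimeE q); apply/eqP.
apply: (@evolution_vanish _ _ _ N_gt0 ltNL D) => //.
- by move=> y; rewrite /D (expect0 hp) // -gE subrr.
- move=> y T e e0.
  have [T0|T0] := ltP T 0.
    by exists 1 => // s h s0 h0 _ sT; lra.
  have [c c0 Hc] := vs_taylor N_gt0 ltNL q0 r0 rr (val y) T0.
  have e2 : 0 < e / 2 by rewrite divr_gt0.
  have [d d0 Hd] := expect_first_order hp y e2.
  have c1 : 0 < c + 1 by rewrite ltr_wpDl.
  (* Half of [e] pays for the transition probabilities, half for the remainder c h^2, as c h <= e /
     2 below this bound. *)
  exists (Num.min d (e / 2 / (c + 1))); first by rewrite lt_min d0 !divr_gt0.
  move=> s h s0 h0; rewrite lt_min => /andP[hd hc] sT.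
  have us := expect_unit hp ug s0.
  have h1 := Hd h (expect p g s) h0 hd us.
  have h2 := Hc s h s0 (ltW h0) sT.
  have E : \sum_i (vs L q r (push (val y) i) s - vs L q r (val y) s) =
     \sum_i (vs L q r (val (attempt y i)) s - vs L q r (val y) s).
    by apply: eq_bigr => i _; rewrite vs_attempt.
  rewrite E in h2.
  have sg := expect_semigroup hp y ug s0 (ltW h0).
  rewrite [h + s]addrC in sg.
  rewrite /D sg increment_split.
  apply: le_trans (nrmB _ _) _; rewrite nrm_real.
  apply: le_trans (lerD h2 h1) _.
  have h3 : c * h ^+ 2 <= e / 2 * h.
    clear -hc h0 c1 c0.
    have ch : c * h <= e / 2.
      by move: hc; rewrite ltr_pdivlMr // => hc; apply: ltW; apply: le_lt_trans hc;
        rewrite mulrDr mulr1 mulrC lerDl ltW.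
    by rewrite expr2 mulrA; apply: ler_wpM2r => //; exact: ltW.
  clear -h3 e0; set u := e / 2 * h in h3 *.
  have -> : e * h = u + u by rewrite -mulrDl -splitr.
  by apply: lerD.
- move=> T T0; have [K [c [K1 c0 Hc]]] := vs_growth N_gt0 ltNL q0 r0 rr T0.
  exists K, (c + 1); split; rewrite ?addr_ge0 // => s y s0 sT.
  apply: le_trans (nrmB _ _) _; rewrite mulrDl mul1r; apply: lerD; first exact: Hc.
  rewrite nrm_real; have /andP[a b] := expect_unit hp ug s0 y.
  by rewrite ger0_norm //; apply: le_trans b _; rewrite exprn_ege1.
Qed.

Lemma fval_vF n (q : 'I_n.+1 -> pt) (r : 'I_n.+1 -> R) :
  (forall l, (q l).1.1 < N)%N -> (forall l, 0 <= ps (q l)) -> (forall l, 0 < r l) ->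
  (forall l l' : 'I_n.+1, (l < l')%N -> r l' < r l) ->
  forall x : S, ((fval q x)%:C)%C = vF L (val x) q r.
Proof.
elim: n q r => [|n IH] q r kN q0 r0 rr x.
  apply: expect_vF => //; first exact: chi_unit.
  move=> y; rewrite (vF_base N_gt0 ltNL (@conf_mono _ _ N_gt0 ltNL y) (conf_per N_gt0 ltNL y) (k := Ordinal (kN ord0))) //.
  by rewrite (@chiE _ (Ordinal (kN ord0))) // real_complex_nat.
have q0' l : 0 <= ps (tailf q l) by exact: q0.
apply: expect_vF => //.
  by apply: unitfM; [exact: chi_unit | exact: fval_unit].
move=> y; rewrite (vF_step N_gt0 ltNL (@conf_mono _ _ N_gt0 ltNL y) (conf_per N_gt0 ltNL y) (k := Ordinal (kN ord0))) //.
  rewrite real_complexM (@chiE _ (Ordinal (kN ord0))) // real_complex_nat tailf_settime.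
  rewrite (IH _ (rtail r)) //; first by move=> l; exact: kN.
    by move=> l; exact: r0.
  by move=> l l' ll; apply: rr.
by move=> l; rewrite /settime; case: eqP => _ //; rewrite /ps /=.
Qed.

End MultiTime.

(** * Joint probabilities from the Markov property *)

Section Markov.
Variables (R : realType) (N L : nat).
Hypotheses (N_gt0 : (0 < N)%N) (ltNL : (N < L)%N).
Local Notation S := (conf N L).
Local Notation pt := (pt R).
Variables (d : measure_display) (T : measurableType d) (P : probability T R).
Variables (Y : S) (X : R -> T -> S).
Variable p : R -> S -> S -> R.
Hypothesis hp : tasep_transition p.
Hypothesis mX : forall (t : R) x, 0 <= t -> measurable [set w | X t w = x].
Hypothesis markov : forall (n : nat) (s : 'I_n -> R) (c : 'I_n -> S) (t h : R) (x y : S),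
  (forall i, 0 <= s i <= t) -> 0 <= t -> 0 <= h ->
  P [set w | (forall i, X (s i) w = c i) /\ X t w = x /\ X (t + h) w = y]
  = (P [set w | (forall i, X (s i) w = c i) /\ X t w = x] * (p h x y)%:E)%E.

Definition past m (s : 'I_m -> R) (c : 'I_m -> S) t x : set T :=
  [set w | (forall i, X (s i) w = c i) /\ X t w = x].

Definition future n (k : 'I_n -> 'I_N) (a : 'I_n -> int) (t : 'I_n -> R) : set T :=
  [set w | forall l, a l <= val (X (t l) w) (k l)].

Lemma forall_measurable n (A : 'I_n -> set T) : (forall i, measurable (A i)) ->
  measurable [set w | forall i, A i w].
Proof.
move=> mA; rewrite (_ : [set w | _] = \bigcap_(i in [set: 'I_n]) A i).
  by apply: fin_bigcap_measurable => //; exact: finite_finset.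
by apply/seteqP; split=> w /= h i; [move=> _|]; exact: h.
Qed.

Lemma past_measurable m (s : 'I_m -> R) c t x : (forall i, 0 <= s i) -> 0 <= t ->
  measurable (past s c t x).
Proof.
move=> s0 t0; apply: measurableI; last exact: mX.
by apply: forall_measurable => i; apply: mX; exact: s0.
Qed.

Lemma future_measurable n (k : 'I_n -> 'I_N) a (t : 'I_n -> R) : (forall l, 0 <= t l) ->
  measurable (future k a t).
Proof.
move=> t0; apply: forall_measurable => l.
rewrite (_ : (fun _ => _) = \bigcup_(y : S) (if a l <= val y (k l) then [set w | X (t l) w = y] else set0)).
  apply: countable_bigcupT_measurable; first exact: countableP.
  move=> y; case: ifP => // _; exact: mX.
apply/seteqP; split=> w.
  by move=> h; exists (X (t l) w) => //; rewrite ifT.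
by move=> [y _]; case: ifP => // h /= ->.
Qed.

(** Converts absolute times into increments, the first one counted from the current time [t0]. *)
Definition spec n (k : 'I_n.+1 -> 'I_N) (a : 'I_n.+1 -> int) (t : 'I_n.+1 -> R) t0 :
    'I_n.+1 -> pt :=
  fun l => ((k l : nat, a l), t l - (if l == ord0 then t0 else t (predo l))).

Lemma predo_lift0 n (l : 'I_n.+1) : l != ord0 -> predo (lift ord0 l) = lift ord0 (predo l).
Proof.
case: l => [[|l] hl] // _; apply: val_inj; rewrite /predo /= inordK; last by rewrite ltnS ltnW.
by rewrite /bump /= inordK // ltnW.
Qed.

Lemma spec_tail n (k : 'I_n.+2 -> 'I_N) a t t0 :
  tailf (spec k a t t0) = spec (tailf k) (tailf a) (tailf t) (t ord0).
Proof.
apply/funext => l; rewrite /tailf /spec /=; congr (_, _ - _).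
case: eqP => [->|/eqP l0].
  by congr t; apply: val_inj; rewrite /predo /= inordK.
by rewrite predo_lift0.
Qed.

Lemma spec_ge0 n (k : 'I_n.+1 -> 'I_N) (a : 'I_n.+1 -> int) (t : 'I_n.+1 -> R) :
  (forall l, 0 <= t l) -> (forall l l' : 'I_n.+1, (l <= l')%N -> t l <= t l') ->
  forall l, 0 <= ps (spec k a t 0 l).
Proof.
move=> t0 tm l; rewrite /spec /ps /= subr_ge0; case: eqP => [_|_]; first exact: t0.
by apply: tm; rewrite /predo inordK ?leq_pred // (leq_ltn_trans (leq_pred _)).
Qed.

(** The induction needs an arbitrary past: after conditioning on the state at the first future time,
    the present joins the past and one point fewer remains. *)
Lemma prob_past_future n (k : 'I_n.+1 -> 'I_N) (a : 'I_n.+1 -> int) (t : 'I_n.+1 -> R)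
    m (s : 'I_m -> R) (c : 'I_m -> S) t0 x :
  (forall i, 0 <= s i <= t0) -> 0 <= t0 -> t0 <= t ord0 ->
  (forall l l' : 'I_n.+1, (l <= l')%N -> t l <= t l') ->
  P (past s c t0 x `&` future k a t) = (P (past s c t0 x) * (fval p (spec k a t t0) x)%:E)%E.
Proof.
elim: n k a t m s c t0 x => [|n IH] k a t m s c t0 x hs t00 t0t tm.
  pose A (y : S) := past s c t0 x `&` (if a ord0 <= val y (k ord0)
    then [set w | X (t ord0) w = y] else set0).
  have tE : t ord0 = t0 + (t ord0 - t0) by ring.
  have h0 : 0 <= t ord0 - t0 by rewrite subr_ge0.
  have mp : measurable (past s c t0 x).
    by apply: past_measurable => // i; have /andP[] := hs i.
  have -> : past s c t0 x `&` future k a t = \bigcup_y A y.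
    apply/seteqP; split=> w.
      by move=> [pw fw]; exists (X (t ord0) w) => //; split=> //; rewrite ifT //; exact: fw.
    move=> [y _ [pw]]; case: ifP => // hy /= Xy; split=> // l.
    by rewrite ord1 Xy.
  rewrite measure_esum; last 2 first.
  - move=> y; apply: measurableI => //; case: ifP => // _.
    by apply: mX; apply: le_trans t0t.
  - by move=> y y' w [_]; case: ifP => // _ /= <- [_]; case: ifP => // _ /= <-.
  have c0 : 0 <= fine (P (past s c t0 x)) by apply: fine_ge0.
  have cE : P (past s c t0 x) = (fine (P (past s c t0 x)))%:E.
    by rewrite fineK // fin_num_measure.
  rewrite /= -(proj1 (expectE hp x (chi_unit (spec k a t t0 ord0)) _)) //.
  rewrite [in RHS]cE -esumZ //; last first.
    move=> y; have /andP[g0 _] := chi_unit (spec k a t t0 ord0) y.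
    by rewrite lee_fin mulr_ge0 // (transition_ge0 hp).
  apply: eq_esum => y _; rewrite -cE (@chiE _ _ _ (spec k a t t0 ord0) (k ord0)) //.
  rewrite /A; case: ifP => hy; last first.
    by rewrite setI0 measure0 /spec /pa /= ?hy mulr0 mule0.
  rewrite /spec /pa /= ?hy mulr1 -markov //; congr (P _).
  by apply/seteqP; split=> w /=; rewrite -?tE; [move=> [[h1 h2] h3] | move=> [h1 [h2 h3]]].
(* The enlarged past: the present time and state in front of the old ones. *)
pose s' : 'I_m.+1 -> R := fun i => if unlift ord0 i is Some j then s j else t0.
pose c' : 'I_m.+1 -> S := fun i => if unlift ord0 i is Some j then c j else x.
pose F := future (tailf k) (tailf a) (tailf t).
have tE : t ord0 = t0 + (t ord0 - t0) by ring.
have t1 : 0 <= t ord0 by apply: le_trans t0t.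
have h0 : 0 <= t ord0 - t0 by rewrite subr_ge0.
have hs' i : 0 <= s' i <= t ord0.
  rewrite /s'; case: unliftP => [j _|_]; last by rewrite t00.
  by have /andP[u v] := hs j; rewrite u (le_trans v).
have pastE y : past s' c' (t ord0) y = past s c t0 x `&` [set w | X (t ord0) w = y].
  apply/seteqP; split=> w.
    move=> [h1 h2]; split=> //; split=> [i|].
      by have := h1 (lift ord0 i); rewrite /s' /c' liftK.
    by have := h1 ord0; rewrite /s' /c' unlift_none.
  move=> [[h1 h2] h3]; split=> // i; rewrite /s' /c'.
  by case: unliftP => [j _|_].
pose A (y : S) := if a ord0 <= val y (k ord0) then past s' c' (t ord0) y `&` F else set0.
have mF : measurable F.
  by apply: future_measurable => l; apply: le_trans t1 _; exact: tm.
have mA y : measurable (A y).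
  rewrite /A; case: ifP => // _; apply: measurableI => //.
  by apply: past_measurable => // i; have /andP[] := hs' i.
have -> : past s c t0 x `&` future k a t = \bigcup_y A y.
  apply/seteqP; split=> w.
    move=> [pw fw]; exists (X (t ord0) w) => //; rewrite /A ifT; last exact: fw.
    by rewrite pastE; split=> // l; exact: fw.
  move=> [y _]; rewrite /A; case: ifP => // hy []; rewrite pastE => -[pw /= Xy] fw; split=> // l.
  by case: (unliftP ord0 l) => [j ->|->]; [exact: fw | rewrite Xy].
rewrite measure_esum //; last first.
  by move=> y y' w; rewrite /A; case: ifP => // _ [[_ <-] _]; case: ifP => // _ [[_ <-] _].
have fu : unitf (fval p (tailf (spec k a t t0))).
  apply: fval_unit => // l; rewrite spec_tail /spec /ps /= subr_ge0.
  case: eqP => [->|/eqP l0]; first exact: tm.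
  by apply: tm; rewrite /= leq_bump2 /predo inordK ?leq_pred // (leq_ltn_trans (leq_pred _)).
have cu : unitf (chi (spec k a t t0 ord0) : S -> R) by exact: chi_unit.
have c0 : 0 <= fine (P (past s c t0 x)) by apply: fine_ge0.
have cE : P (past s c t0 x) = (fine (P (past s c t0 x)))%:E.
  rewrite fineK // fin_num_measure //.
  by apply: past_measurable => // i; have /andP[] := hs i.
rewrite /= -(proj1 (expectE hp x (unitfM cu fu) _)) //.
rewrite [in RHS]cE -esumZ //; last first.
  move=> y; have /andP[g0 _] := unitfM cu fu y.
  by rewrite lee_fin mulr_ge0 // (transition_ge0 hp).
apply: eq_esum => y _; rewrite -cE (@chiE _ _ _ (spec k a t t0 ord0) (k ord0)) //.
rewrite /A; case: ifP => hy; last first.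
  by rewrite measure0 /spec /pa /= ?hy mul0r mulr0 mule0.
rewrite IH //; last by move=> l l' ll; apply: tm; rewrite /= /bump leq_add2l.
- rewrite spec_tail /spec /pa /= ?hy mul1r EFinM muleA -markov //; congr (P _ * _)%E.
  rewrite pastE; apply/seteqP; split=> w /=; rewrite -?tE.
    by move=> [[h1 h2] h3].
  by move=> [h1 [h2 h3]].
- exact: tm.
Qed.

Lemma prob_fval n (k : 'I_n.+1 -> 'I_N) (a : 'I_n.+1 -> int) (t : 'I_n.+1 -> R) :
  P [set w | X 0 w = Y] = 1%E -> (forall l, 0 <= t l) ->
  (forall l l' : 'I_n.+1, (l <= l')%N -> t l <= t l') ->
  fine (P (future k a t)) = fval p (spec k a t 0) Y.
Proof.
move=> PY t0 tm.
pose s0 : 'I_0 -> R := fun _ => 0; pose c0 : 'I_0 -> S := fun _ => Y.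
have pE : past s0 c0 0 Y = [set w | X 0 w = Y].
  by apply/seteqP; split=> w; [case | move=> h; split=> // -[]].
have := @prob_past_future n k a t 0 s0 c0 0 Y.
rewrite pE PY mul1e => H.
have mf := future_measurable k a t0.
have m0 : measurable [set w | X 0 w = Y] by exact: mX.
rewrite -[RHS]/(fine (fval p (spec k a t 0) Y)%:E) -H //; last by case.
(* The process starts at [Y] only almost surely; the rest of the event is contained in a null
   set. *)
congr fine; rewrite -[in LHS](setUIDK (future k a t) [set w | X 0 w = Y]).
rewrite measureU //.
- rewrite [X in (_ + X)%E](_ : _ = 0%E) ?adde0 1?setIC //.
  apply/eqP; rewrite eq_le measure_ge0 andbT.
  have <- : P (~` [set w | X 0 w = Y]) = 0%E by rewrite probability_setC // PY subee.
  apply: le_measure; last by move=> w [].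
    by apply/mem_set; exact: measurableD.
  by apply/mem_set; exact: measurableC.
- exact: measurableI.
- exact: measurableD.
- by apply/seteqP; split=> // w [[_ h] [_ ]].
Qed.

End Markov.

(** * From root sums to the decoupled integrand *)

Section NestedSums.
Variable F : nzRingType.

Definition fcons n (x : F) (w : 'I_n -> F) : 'I_n.+1 -> F :=
  fun l => if unlift ord0 l is Some l' then w l' else x.

Lemma fcons0 n x (w : ('I_n -> F)) : fcons x w ord0 = x.
Proof. by rewrite /fcons unlift_none. Qed.

Lemma fconsS n x (w : ('I_n -> F)) l : fcons x w (lift ord0 l) = w l.
Proof. by rewrite /fcons liftK. Qed.

Fixpoint ntuples n : ('I_n -> seq F) -> seq ('I_n -> F) :=
  if n is n'.+1 then fun rs =>
    [seq fcons x w | x <- rs ord0, w <- ntuples (tailf rs)]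
  else fun _ => [:: fun=> 0].

Lemma mem_ntuples n (rs : 'I_n -> seq F) w :
  (w \in ntuples rs) <-> forall l, w l \in rs l.
Proof.
elim: n rs w => [|n IH] rs w /=.
  by split=> [_ []//|_]; rewrite inE; apply/eqP/funext => -[].
split=> [/allpairsP[[x v] /= [xr /IH vr ->]] l|h].
  by case: (unliftP ord0 l) => [j ->|->]; rewrite ?fconsS ?fcons0 //; exact: vr.
apply/allpairsP; exists (w ord0, fun l => w (lift ord0 l)) => /=; split.
- exact: h.
- by apply/IH => l; exact: h.
- apply/funext => l.
  by case: (unliftP ord0 l) => [j ->|->]; rewrite ?fconsS ?fcons0.
Qed.

Lemma ntuples_uniq n (rs : 'I_n -> seq F) : (forall l, uniq (rs l)) -> uniq (ntuples rs).
Proof.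
elim: n rs => [|n IH] rs urs //=.
apply: allpairs_uniq => //; first by apply: IH => l; exact: urs.
move=> [x v] [x' v'] _ _ /= e; congr (_, _).
  by have := congr1 (fun g => g ord0) e; rewrite !fcons0.
by apply/funext => l; have := congr1 (fun g => g (lift ord0 l)) e; rewrite !fconsS.
Qed.

(** Turns the finitely supported sum of [rawD] into a sum over lists, which can be evaluated one
    root at a time. *)
Lemma fsum_ntuples n (A : 'I_n -> set F) (rs : 'I_n -> seq F) (f : ('I_n -> F) -> F) :
  (forall l, uniq (rs l)) -> (forall l x, A l x <-> x \in rs l) ->
  \sum_(w \in [set w : ('I_n -> F) | forall l, A l (w l)]) f w = \sum_(w <- ntuples rs) f w.
Proof.
move=> urs Ars; rewrite (fsbig_seq _ f (ntuples_uniq urs)).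
suff -> : [set w : ('I_n -> F) | forall l, A l (w l)] = [set` ntuples rs] by [].
apply/seteqP; split=> w /=.
  by move=> h; apply/mem_ntuples => l; apply/Ars.
by move=> /mem_ntuples h l; apply/Ars.
Qed.

Lemma prod_pred n (f : 'I_n.+2 -> 'I_n.+2 -> F) :
  \prod_(l < n.+2 | (0 < l)%N) f l (predo l) =
  f (lift ord0 ord0) ord0 * \prod_(l < n.+1 | (0 < l)%N) f (lift ord0 l) (lift ord0 (predo l)).
Proof.
rewrite big_mkcond big_ord_recl /= mul1r big_ord_recl [in RHS]big_mkcond [in RHS]big_ord_recl /= mul1r.
congr (f _ _ * _); first by apply: val_inj; rewrite /predo /= inordK.
by apply: eq_bigr => l _; rewrite predo_lift0.
Qed.

End NestedSums.

(** * Simple roots of p(w) = Z *)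

Section Roots.
Variables (R : realType) (N L : nat).
Hypotheses (N_gt0 : (0 < N)%N) (ltNL : (N < L)%N).
Local Notation C := (Cplx R).
Local Notation p := (@pNL R N L).

(** The logarithmic derivative N / w + (L - N) / (w + 1) = L (w + rho) / (w (w + 1)), with
    denominators cleared. *)
Lemma pNL_deriv (w : C) :
  p^`().[w] * (w * (w + 1)) = p.[w] * (L%:R * (w + rho R N L)).
Proof.
have L0 : L%:R != 0 :> C by rewrite pnatr_eq0 -lt0n (leq_ltn_trans _ ltNL).
have -> : L%:R * (w + rho R N L) = L%:R * w + N%:R :> C.
  by rewrite /rho mulrDr mulrCA mulfV ?mulr1.
rewrite pNL_horner /pNL derivM derivXn deriv_exp !hornerE /= !hornerMn !hornerE.
have NE : N = N.-1.+1 by rewrite prednK.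
have LE : (L - N = (L - N).-1.+1)%N by rewrite prednK // subn_gt0.
have -> : L%:R = N%:R + (L - N)%:R :> C by rewrite -natrD subnKC // ltnW.
move: N.-1 (L - N)%N.-1 NE LE => a b -> ->.
have -> : ('X + 1 : {poly C})^`().[w] = 1.
  by rewrite derivD derivX derivC addr0 hornerC.
rewrite mul1r -(mulr_natl (w ^+ a)) -(mulr_natl ((w + 1) ^+ b)) !exprS; ring.
Qed.

Definition roots_of (Z : C) (rs : seq C) :=
  [/\ uniq rs, forall w, w \in rs <-> p.[w] = Z & size rs = L].

Lemma pNL_root_neq0 (w Z : C) : Z != 0 -> p.[w] = Z -> (w != 0) && (w + 1 != 0).
Proof.
move=> Z0; rewrite pNL_horner => e; move: Z0; rewrite -e mulf_eq0 !expf_eq0 negb_or.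
by rewrite N_gt0 subn_gt0 ltNL.
Qed.

(** By [pNL_deriv], -rho is the only critical point where [p] can be nonzero. *)
Lemma deriv_neq0 (w Z : C) : Z != 0 -> p.[w] = Z -> p.[- rho R N L] <> Z ->
  p^`().[w] != 0.
Proof.
move=> Z0 wZ rZ; apply/eqP => d0.
have := pNL_deriv w; rewrite d0 mul0r wZ => /esym/eqP.
rewrite !mulf_eq0 (negbTE Z0) pnatr_eq0 (gtn_eqF (leq_ltn_trans _ ltNL)) //= addr_eq0.
by move=> /eqP w_eq; apply: rZ; rewrite -w_eq.
Qed.

Lemma roots_ofP (Z : C) : Z != 0 -> p.[- rho R N L] <> Z -> exists rs, roots_of Z rs.
Proof.
move=> Z0 rZ; have [rs /= rsE] := closed_field_poly_normal (p - Z%:P).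
have sZ : (size (- Z%:P : {poly C}) < size p)%N.
  by rewrite size_polyN (size_pNL R ltNL) (leq_ltn_trans (size_polyC_leq1 _)) // ltnS (leq_ltn_trans _ ltNL).
have monZ : p - Z%:P \is monic.
  by rewrite monicE lead_coefDl // (monicP (pNL_monic R N L)).
rewrite (monicP monZ) scale1r in rsE.
exists rs; split.
- rewrite -separable_prod_XsubC -rsE unlock.
  apply: Pdiv.ClosedField.root_coprimep => w; rewrite rootE hornerD hornerN hornerC subr_eq0 => /eqP wZ.
  by rewrite derivB derivC subr0 (deriv_neq0 Z0).
- move=> w; rewrite -root_prod_XsubC -rsE rootE hornerD hornerN hornerC subr_eq0.
  by split=> /eqP.
- apply: succn_inj; rewrite -(size_prod_XsubC _ id) -rsE size_polyDl //.
  exact: (size_pNL R ltNL).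
Qed.

End Roots.

Section ChainSum.
Variables (R : realType) (N L : nat).
Hypotheses (N_gt0 : (0 < N)%N) (ltNL : (N < L)%N).
Local Notation C := (Cplx R).
Local Notation p := (@pNL R N L).
Local Notation pt := (pt R).
Local Notation roots_of := (@roots_of R N L).

(* The value of [calG l] at a root of [p = Z], where
   [w (w + 1) / (L (w + rho)) = Z / p'(w)]. *)
Definition theta (q q' : pt) (Z v : C) : C :=
  Z * (v ^ (pk q - pk q') * (v + 1) ^ (pk q' - pa q' + pa q - pk q)
       * cexp ((ps q')%:C%C * v) / p^`().[v]).

(** The summand of [rawD] without the first weight; w_1 remains only in w_2 - w_1, or as the last
    root when there is a single point. *)
Definition chainF n (j : nat) (q : 'I_n.+1 -> pt) (Z : 'I_n.+1 -> C)
    (w : 'I_n.+1 -> C) : C :=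
  w ord_max ^- j.+1 / (\prod_(l < n.+1 | (0 < l)%N) (w l - w (predo l)))
  * \prod_(l < n.+1 | (0 < l)%N) theta (q (predo l)) (q l) (Z l) (w l).

(** Collects the denominators Z_l - Z_(l-1) of the decoupling, each divided by Z_(l-1). *)
Definition kappa n (Z : 'I_n.+1 -> C) : C :=
  \prod_(l < n.+1 | (0 < l)%N) (Z l / Z (predo l) - 1)^-1.

Lemma kappa_S n (Z : 'I_n.+2 -> C) :
  kappa Z = (Z (lift ord0 ord0) / Z ord0 - 1)^-1 * kappa (tailf Z).
Proof. exact: (prod_pred (fun l l' => (Z l / Z l' - 1)^-1)). Qed.

Lemma chainF_S n j (q : 'I_n.+2 -> pt) Z x y (w : 'I_n -> C) :
  chainF j q Z (fcons x (fcons y w)) =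
  theta (q ord0) (tailf q ord0) (tailf Z ord0) y / (y - x)
  * chainF j (tailf q) (tailf Z) (fcons y w).
Proof.
rewrite /chainF.
rewrite (prod_pred (fun l l' => fcons x (fcons y w) l - fcons x (fcons y w) l')).
rewrite (prod_pred (fun l l' => theta (q l') (q l) (Z l) (fcons x (fcons y w) l))).
rewrite fconsS !fcons0.
have -> : ord_max = lift ord0 ord_max :> 'I_n.+2 by apply: val_inj.
rewrite fconsS invfM.
under eq_bigr do rewrite !fconsS.
under [in X in _ * (_ * X) = _]eq_bigr do rewrite fconsS.
rewrite -/(tailf q ord0) -/(tailf Z ord0); ring.
Qed.

Definition pow_row (x : C) : 'rV[C]_L := \row_b x ^+ b.

Lemma hfin_sum (x Z : C) (j : 'I_N) : Z != 0 -> p.[x] = Z ->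
  x ^- j.+1 = Z^-1 * (pow_row x *m Hfin R N L) 0 j.
Proof.
move=> Z0 xZ; rewrite mxE; under eq_bigr do rewrite mxE.
have /andP[x0 _] := pNL_root_neq0 N_gt0 ltNL Z0 xZ.
have -> : \sum_(b < L) x ^+ b * Hfin R N L b j
    = ('X^(N - j.+1) * ('X + 1) ^+ (L - N) : {poly C}).[x].
  rewrite (@horner_coef_wide _ L) ?size_XnXp1n.
    by apply: eq_bigr => b _; rewrite mxE mulrC.
  have := ltn_ord j; lia.
apply: (mulfI Z0); rewrite mulrA mulfV // mul1r -[in LHS]xZ pNL_horner !hornerE /=.
have -> : x ^+ N = x ^+ (N - j.+1) * x ^+ j.+1 by rewrite -exprD subnK.
by rewrite mulrAC mulfK // expf_neq0.
Qed.

Lemma root_diff_inv (x y Z Z' : C) : p.[x] = Z -> p.[y] = Z' -> Z' != Z ->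
  (y - x)^-1 = (Z' - Z)^-1 * (pow_row x *m Hm R N L *m (pow_row y)^T) 0 0.
Proof.
move=> xZ yZ ZZ; have h : Z' - Z != 0 by rewrite subr_eq0.
have yx : y - x != 0.
  by rewrite subr_eq0; apply: contraNneq ZZ => e; rewrite -xZ -yZ e.
have := hankel_horner (size_pNL R ltNL) x y; rewrite xZ yZ.
rewrite exchange_big /= => hh.
apply: (mulfI yx); rewrite mulfV // mulrCA.
apply: (mulfI h); rewrite mulr1 mulVKf // -[LHS]hh; congr (_ * _).
rewrite mxE; apply: eq_bigr => b _; rewrite !mxE mulr_suml.
by apply: eq_bigr => c _; rewrite !mxE.
Qed.

Lemma theta_sum q q' Z rs : Z != 0 -> 0 <= ps q' -> roots_of Z rs ->
  \sum_(y <- rs) theta q q' Z y *: ((pow_row y)^T *m pow_row y) = Z *: Tm N L q q' Z.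
Proof.
move=> Z0 q0 [urs rZ srs]; apply/matrixP => c b; rewrite summxE !mxE.
rewrite (mu_lagrange N_gt0 ltNL _ _ Z0 q0 urs _ srs) => [|w /rZ//].
rewrite mulr_sumr; apply: eq_big_seq => y /rZ yZ.
have /andP[y0 _] := pNL_root_neq0 N_gt0 ltNL Z0 yZ.
rewrite !mxE big_ord1 !mxE /theta.
have -> : c%:Z + (b%:Z - pk q' + pk q) = c%:Z + b%:Z + (pk q - pk q') by ring.
rewrite !(expfzDr _ _ y0) -!exprnP; ring.
Qed.

(** Induction on the number of points: 1 / (y - x) is a bilinear form in the powers of x and y, so
    the sum over the next root y turns rank-one matrices into [Tm] while x stays in a row vector.
    The powers of [Z] from [theta] and [Hfin] cancel up to 1 / [Z ord0]. *)
Lemma chain_sum n (j : 'I_N) (q : 'I_n.+1 -> pt) (Z : 'I_n.+1 -> C) rs x :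
  (forall l, 0 <= ps (q l)) -> (forall l, Z l != 0) ->
  (forall l : 'I_n.+1, (0 < l)%N -> Z l != Z (predo l)) ->
  (forall l, roots_of (Z l) (rs l)) -> p.[x] = Z ord0 ->
  \sum_(w <- ntuples (tailf rs)) chainF j q Z (fcons x w) =
  kappa Z / Z ord0 * (pow_row x *m chainW N L q Z) 0 j.
Proof.
elim: n q Z rs x => [|n IH] q Z rs x q0 Z0 ZZ hr xZ.
  rewrite big_seq1 /chainF /kappa !big_pred0; try by case=> -[].
  rewrite invr1 !mulr1 mul1r (_ : ord_max = ord0) ?fcons0; last exact: val_inj.
  exact: hfin_sum.
have ZZ1 : tailf Z ord0 != Z ord0.
  have := ZZ (lift ord0 ord0) isT; rewrite (_ : predo _ = ord0) //.
  by apply: val_inj; rewrite /predo /= inordK.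
rewrite [ntuples _]/= big_allpairs_dep chainW_S kappa_S.
set T := Tm _ _ _ _ _; set W := chainW _ _ _ _; set k := kappa _.
have step y : y \in tailf rs ord0 ->
  \sum_(w <- ntuples (tailf (tailf rs))) chainF j q Z (fcons x (fcons y w)) =
  (tailf Z ord0 - Z ord0)^-1 * (k / tailf Z ord0) *
  (pow_row x *m Hm R N L *m (theta (q ord0) (tailf q ord0) (tailf Z ord0) y *: ((pow_row y)^T *m pow_row y)) *m W) 0 j.
  move=> yr; have yZ : p.[y] = tailf Z ord0 by have [_ h _] := hr (lift ord0 ord0); exact/h.
  under eq_bigr do rewrite chainF_S.
  rewrite -mulr_sumr (IH (tailf q) (tailf Z) (tailf rs) y) //; last 4 first.
  - by move=> l; exact: q0.
  - by move=> l; exact: Z0.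
  - by move=> l l0; rewrite /tailf -predo_lift0 ?ZZ // -lt0n.
  - by move=> l; exact: hr.
  rewrite (root_diff_inv xZ yZ ZZ1) -/W -/k.
  rewrite -scalemxAr -scalemxAl [in RHS]mxE.
  have -> : (pow_row x *m Hm R N L *m ((pow_row y)^T *m pow_row y) *m W) 0 j =
      (pow_row x *m Hm R N L *m (pow_row y)^T) 0 0 * (pow_row y *m W) 0 j.
    by rewrite mulmxA -[in LHS]mulmxA mxE big_ord1.
  ring.
rewrite (eq_big_seq _ step) -mulr_sumr -summxE -mulmx_suml -mulmx_sumr.
rewrite (theta_sum _ (Z0 _) (q0 _) (hr (lift ord0 ord0))) -/T.
rewrite -scalemxAr -scalemxAl mxE !mulmxA.
set A := fun_of_matrix _ _ _.
have Z00 := Z0 ord0; have Z10 : tailf Z ord0 != 0 by exact: Z0.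
rewrite -[Z (lift ord0 ord0)]/(tailf Z ord0).
by field; rewrite Z00 Z10 mulN1r subr_eq0 ZZ1.
Qed.

End ChainSum.

Section Entries.
Variables (R : realType) (N L n : nat).
Hypotheses (N_gt0 : (0 < N)%N) (ltNL : (N < L)%N).
Local Notation C := (Cplx R).
Local Notation p := (@pNL R N L).
Local Notation Zf := (@Zf R L _).
Variables (Y : conf N L) (k : 'I_n.+1 -> 'I_N) (a : 'I_n.+1 -> int) (t : 'I_n.+1 -> R).
Hypotheses (t_ge0 : forall l, 0 <= t l)
  (t_le : forall l l' : 'I_n.+1, (l <= l')%N -> t l <= t l').
Let k1 l := (k l).+1.
Let q := spec k a t 0.

Let q_ge0 := spec_ge0 k a t_ge0 t_le.

Lemma residue_weight (v Z : C) : Z != 0 -> p.[v] = Z -> p.[- rho R N L] <> Z ->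
  v * (v + 1) / (L%:R * (v + rho R N L)) = Z / p^`().[v].
Proof.
move=> Z0 vZ rZ; have d0 := deriv_neq0 N_gt0 ltNL Z0 vZ rZ.
have /andP[v0 v1] := pNL_root_neq0 N_gt0 ltNL Z0 vZ.
have := pNL_deriv N_gt0 ltNL v; rewrite vZ => e.
have s0 : L%:R * (v + rho R N L) != 0.
  by apply: contraTneq (mulf_neq0 d0 (mulf_neq0 v0 v1)) => s; rewrite e s mulr0 eqxx.
by apply/eqP; rewrite eqr_div // mulrC e.
Qed.

Lemma gfun_ratio j j' (b b' : int) (s s' : R) (v : C) : v != 0 -> v + 1 != 0 ->
  gfun j b s v / gfun j' b' s' v = v ^ (j'%:Z - j%:Z)
    * (v + 1) ^ (j%:Z - b + b' - j'%:Z) * cexp ((s - s')%:C%C * v).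
Proof.
move=> v0 v1; rewrite /gfun.
set e' := cexp (s'%:C%C * v); have eN : e'^-1 = cexp (- (s'%:C%C * v)) by rewrite cexpN.
clearbody e'; rewrite !invfM invrK eN.
have -> : (s - s')%:C%C * v = s%:C%C * v - s'%:C%C * v.
  by rewrite real_complexD real_complexN mulrBl.
rewrite cexpD (expfzDr _ _ v0) -exprnN.
have -> : j%:Z - b + b' - j'%:Z = (- b + j%:Z) + - (- b' + j'%:Z) by ring.
rewrite (expfzDr (- b + j%:Z) (- (- b' + j'%:Z)) v1) invr_expz -(exprnP v j'); ring.
Qed.

Lemma calG_theta (l : 'I_n.+1) (v Z : C) : (0 < l)%N -> Z != 0 -> p.[v] = Z -> p.[- rho R N L] <> Z ->
  calG N L k1 a t l v = theta N L (q (predo l)) (q l) Z v.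
Proof.
move=> l0 Z0 vZ rZ; have /andP[v0 v1] := pNL_root_neq0 N_gt0 ltNL Z0 vZ.
rewrite /calG (residue_weight Z0 vZ rZ) gfun_ratio // /theta /q /spec /prevval (gtn_eqF l0).
have -> : (l == ord0) = false by apply/negbTE; rewrite -lt0n.
rewrite /pk /pa /ps /= /k1.
have -> : (k (predo l)).+1%:Z - (k l).+1%:Z = (k (predo l))%:Z - (k l)%:Z by lia.
have -> : (k l).+1%:Z - a l + a (predo l) - (k (predo l)).+1%:Z =
  (k l)%:Z - a l + a (predo l) - (k (predo l))%:Z by lia.
ring.
Qed.

(** The convention t_0 = k_0 = a_0 = 0 makes the denominator of [calG] trivial, and passing from
    one-based to zero-based i and k leaves their difference unchanged. *)
Lemma calG_first (i : 'I_N) (v Z : C) : Z != 0 -> p.[v] = Z -> p.[- rho R N L] <> Z ->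
  v ^+ i.+1 * (v + 1) ^ (val Y i - i.+1%:Z) * calG N L k1 a t ord0 v =
  Z * (v ^ (i%:Z - pk (q ord0)) * (v + 1) ^ (val Y i - i%:Z - pa (q ord0) + pk (q ord0))
    * cexp ((ps (q ord0))%:C%C * v) / p^`().[v]).
Proof.
move=> Z0 vZ rZ; have /andP[v0 v1] := pNL_root_neq0 N_gt0 ltNL Z0 vZ.
rewrite /calG (residue_weight Z0 vZ rZ) gfun_ratio // /q /spec /prevval /=.
rewrite /pk /pa /ps /= /k1.
have -> : i%:Z - (k ord0)%:Z = i.+1%:Z + (0 - (k ord0).+1%:Z) by lia.
have -> : val Y i - i%:Z - a ord0 + (k ord0)%:Z =
   (val Y i - i.+1%:Z) + ((k ord0).+1%:Z - a ord0 + 0 - 0) by lia.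
rewrite (expfzDr i.+1%:Z _ v0) (expfzDr (val Y i - i.+1%:Z) _ v1) -(exprnP v i.+1); ring.
Qed.

(** For fixed w_1 the other roots sum to a linear combination of powers of w_1; summing these
    against the first weight gives [Um]. *)
Lemma rawDE (i j : 'I_N) (z : 'rV[C]_n.+1) : (forall l, z 0 l != 0) ->
  (forall l : 'I_n.+1, (0 < l)%N -> Zf z l != Zf z (predo l)) -> regular N L z ->
  rawD Y k1 a t i j z = kappa (Zf z) * (Um L (val Y) (q ord0) (Zf z ord0) *m chainW N L q (Zf z)) i j.
Proof.
move=> z0 zz reg.
have Z0 l : Zf z l != 0 by rewrite expf_neq0.
have pq (x w : C) : (Defs.qpoly N L x w = 0) <-> (p.[w] = x ^+ L).
  by rewrite /Defs.qpoly pNL_horner; split=> [/eqP|->]; rewrite ?subrr // subr_eq0 => /eqP.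
have rZ l : p.[- rho R N L] <> Zf z l by move=> e; apply: (reg l); apply/pq.
pose rs l := sval (cid (roots_ofP N_gt0 ltNL (Z0 l) (rZ l))).
have hr l : roots_of N L (Zf z l) (rs l) by rewrite /rs; case: cid.
have urs l : uniq (rs l) by have [] := hr l.
have mrs l x : x \in rs l -> p.[x] = Zf z l by have [_ h _] := hr l; move/h.
pose f (w : 'I_n.+1 -> C) : C :=
  w ord0 ^+ i.+1 * (w ord0 + 1) ^ (val Y i - i.+1%:Z) * w ord_max ^- j.+1
  / (\prod_(l < n.+1 | (0 < l)%N) (w l - w (predo l))) * \prod_(l < n.+1) calG N L k1 a t l (w l).
transitivity (\sum_(w <- ntuples rs) f w).
  apply: (@fsum_ntuples _ _ (fun l => rootset N L (z 0 l)) rs f urs).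
  move=> l x; have [_ h _] := hr l; split=> [/pq|/h e]; first by move/h.
  exact/pq.
rewrite [ntuples _]/= big_allpairs_dep.
have step x : x \in rs ord0 ->
  \sum_(w <- ntuples (tailf rs)) f (fcons x w) =
  (Zf z ord0 * (x ^ (i%:Z - pk (q ord0)) * (x + 1) ^ (val Y i - i%:Z - pa (q ord0) + pk (q ord0))
    * cexp ((ps (q ord0))%:C%C * x) / p^`().[x])) *
  (kappa (Zf z) / Zf z ord0 * (pow_row L x *m chainW N L q (Zf z)) 0 j).
  move=> xr; have xZ := mrs _ _ xr.
  rewrite -(chain_sum N_gt0 ltNL j q_ge0 Z0 zz hr xZ) -(calG_first i (Z0 ord0) xZ (rZ _)).
  rewrite mulr_sumr; apply: eq_big_seq => w /mem_ntuples wr.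
  rewrite /f fcons0 /chainF [X in _ * X = _]big_ord_recl fcons0.
  rewrite [X in _ = _ * (_ * X)]big_mkcond [X in _ = _ * (_ * X)]big_ord_recl /= mul1r.
  rewrite (eq_bigr (fun l : 'I_n => theta N L (q (predo (lift ord0 l))) (q (lift ord0 l))
       (Zf z (lift ord0 l)) (fcons x w (lift ord0 l)))); first by ring.
  by move=> l _; apply: calG_theta => //; rewrite fconsS; apply: mrs; exact: wr.
rewrite (eq_big_seq _ step) mxE mulr_sumr.
under [RHS]eq_bigr do rewrite mxE.
under eq_bigr do rewrite mxE mulr_sumr mulr_sumr.
rewrite exchange_big /=; apply: eq_bigr => b _.
rewrite (mu_lagrange N_gt0 ltNL _ _ (Z0 ord0) (q_ge0 ord0) (urs ord0) (mrs ord0)); last by have [] := hr ord0.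
rewrite mulr_suml mulr_sumr; apply: eq_big_seq => x /mrs xZ.
have /andP[x0 _] := pNL_root_neq0 N_gt0 ltNL (Z0 _) xZ.
rewrite mxE (expfzDr (i%:Z - pk (q ord0)) _ x0) -(exprnP x b).
have := Z0 ord0; set Z := Zf z ord0 => ZZ0.
set dv := (p^`().[x])^-1; clearbody dv; clearbody Z; by field.
Qed.

End Entries.

(** * Thickened contours and density of regular points *)

Section TorusPoints.
Variable R : realType.
Local Notation C := (Cplx R).

Lemma nbhs_rowP m (z : 'rV[C]_m) (A : set 'rV[C]_m) : nbhs z A <->
  exists2 e : R, 0 < e & forall z' : 'rV[C]_m, (forall l, nrm (z 0 l - z' 0 l) < e) -> A z'.
Proof.
split=> [/nbhs_ballP[e /= e0 H]|[e e0 H]].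
  have eE : e = ((complex.Re e)%:C)%C by rewrite RRe_real // ger0_real // ltW.
  exists (complex.Re e); first by rewrite -(ltcR 0) -eE.
  move=> z' h; apply: H; split=> // i l; rewrite -ball_normE /ball_ /= eE lt_nrmC ord1.
  exact: h.
apply/nbhs_ballP; exists ((e%:C)%C : C) => /=; first by rewrite (ltcR 0 e).
move=> z' [_ h]; apply: H => l; rewrite -lt_nrmC.
by have := h 0 l; rewrite -ball_normE.
Qed.

Lemma pos_lower_bound (I : finType) (f : I -> R) : (forall x, 0 < f x) ->
  exists2 e, 0 < e & forall x, e <= f x.
Proof.
move=> f0; have s0 : 0 < 1 + \sum_x (f x)^-1.
  by rewrite ltr_wpDr // sumr_ge0 // => x _; rewrite invr_ge0 ltW.
exists (1 + \sum_x (f x)^-1)^-1; first by rewrite invr_gt0.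
move=> x; rewrite -[leRHS]invrK lef_pV2 ?posrE ?invr_gt0 // (bigD1 x) //= addrCA.
by rewrite lerDl addr_ge0 // sumr_ge0 // => y _; rewrite invr_ge0 ltW.
Qed.

Lemma fat_nested m (r : 'I_m -> R) : (forall l, 0 < r l) ->
  (forall l l' : 'I_m, (l < l')%N -> r l' < r l) ->
  exists2 e, 0 < e & nested (fun l => r l - e) (fun l => r l + e).
Proof.
move=> r0 rn.
pose f (x : 'I_m * 'I_m) := if (x.1 < x.2)%N then r x.1 - r x.2 else r x.1.
have [|e e0 H] := @pos_lower_bound _ f.
  by move=> [l l']; rewrite /f /=; case: ifP => // ll; rewrite subr_gt0 rn.
(* At most a third of every radius and of every gap between radii, which keeps the annuli apart and
   away from 0. *)
exists (e / 3); first lra.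
split=> [l|]; first by have := H (l, l); rewrite /f /= ltnn; lra.
split=> [l|l l' ll]; first lra.
by have := H (l, l'); rewrite /f /= ll; lra.
Qed.

Lemma fat_ann m (r : 'I_m -> R) e (z z' : 'rV[C]_m) : tor r z ->
  (forall l, nrm (z 0 l - z' 0 l) < e) -> ann (fun l => r l - e) (fun l => r l + e) z'.
Proof.
move=> /torP zr h l; have := h l.
have := nrmD (z 0 l - z' 0 l) (z' 0 l); rewrite subrK zr.
have := nrmD (z' 0 l - z 0 l) (z 0 l); rewrite subrK zr (nrm_distC (z' 0 l)).
by move=> *; apply/andP; split; lra.
Qed.

Lemma predo_lt n (l : 'I_n.+1) : (0 < l)%N -> (predo l < l)%N.
Proof. by move=> l0; rewrite /predo inordK ?prednK // ltnW. Qed.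

Lemma Zf_sep L n lo hi (z : 'rV[C]_n) (l l' : 'I_n) : (0 < L)%N -> nested lo hi -> ann lo hi z ->
  (l < l')%N -> Zf L z l' != Zf L z l.
Proof.
move=> L0 [lo0 [_ sep]] az ll; have /andP[_ h'] := az l'; have /andP[h _] := az l.
have lt : nrm (z 0 l') < nrm (z 0 l) by apply: le_lt_trans h' _; exact: lt_le_trans (sep _ _ ll) h.
apply: contraTneq lt => /(congr1 (@nrm R)); rewrite /Zf !nrmX => e.
by rewrite -leNgt -(@ler_pXn2r _ L) ?nnegrE ?nrm_ge0 // e.
Qed.

Lemma kappa_nice N L n (lo hi : 'I_n.+1 -> R) : (N < L)%N -> nested lo hi ->
  nice lo hi (fun z => kappa (Zf L z)).
Proof.
move=> ltNL nst; apply: (nice_ext (f := fun z : 'rV[C]_n.+1 => \prod_(l < n.+1 | (0 < l)%N)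
    (if (0 < l)%N then (- 1) * (1 - z 0 l ^+ L / z 0 (predo l) ^+ L)^-1 else 1))).
  by move=> z _; apply: eq_bigr => l l0; rewrite l0 mulN1r -(@invrN C) opprB.
apply: nice_prod => l; case: (ltnP 0 l) => l0 /=; last exact: nice_cst.
by apply: niceZ; apply: (geo_nice ltNL nst); exact: predo_lt.
Qed.

(** Scaling a coordinate by a real factor slightly above 1 changes its [L]-th power, so it leaves
    the value p(-rho). This makes the limit in [entryD] one along a proper filter. *)
Lemma regular_dense N L n (z : 'rV[C]_n.+1) (A : set 'rV[C]_n.+1) : (0 < L)%N ->
  (forall l, z 0 l != 0) -> nbhs z A -> exists2 z', regular N L z' & A z'.
Proof.
move=> L0 z0 /nbhs_rowP[e e0 H].
pose z' : 'rV[C]_n.+1 := \row_l (if Defs.qpoly N L (z 0 l) (- rho R N L) == 0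
  then (1 + ((e / 2 / nrm (z 0 l))%:C)%C) * z 0 l else z 0 l).
have s0 l : 0 < e / 2 / nrm (z 0 l) by rewrite !divr_gt0 ?nrm_gt0.
exists z'.
  move=> l; rewrite /rootset /= mxE; case: ifP => [|/eqP//].
  rewrite /Defs.qpoly subr_eq0 => /eqP ->; set s := _ / nrm _.
  rewrite exprMn -{1}[z 0 l ^+ L]mul1r -mulrBl => /eqP.
  rewrite mulf_eq0 expf_eq0 (negbTE (z0 l)) andbF orbF subr_eq0 => /eqP.
  have -> : 1 + (s%:C)%C = ((1 + s)%:C)%C :> C by rewrite real_complexD.
  rewrite -real_complexX => -[] e1.
  have : 1 < (1 + s) ^+ L by rewrite exprn_egt1 ?ltrDl ?s0 // -lt0n.
  by rewrite -e1 ltxx.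
apply: H => l; rewrite mxE; case: ifP => _; last by rewrite subrr nrm0.
rewrite mulrDl mul1r opprD addrA subrr add0r nrmN nrmM nrm_real gtr0_norm ?s0 //.
by rewrite divfK ?gt_eqF ?nrm_gt0 // gtr_pMr // invf_lt1 // ltr1n.
Qed.

End TorusPoints.

Section Integrand.
Variables (R : realType) (N L n : nat).
Hypotheses (N_gt0 : (0 < N)%N) (ltNL : (N < L)%N).
Local Notation C := (Cplx R).
Local Notation Zf := (@Zf R L _).
Variables (Y : conf N L) (k : 'I_n.+1 -> 'I_N) (a : 'I_n.+1 -> int) (t : 'I_n.+1 -> R).
Hypotheses (t_ge0 : forall l, 0 <= t l)
  (t_le : forall l l' : 'I_n.+1, (l <= l')%N -> t l <= t l').
Variable r : 'I_n.+1 -> R.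
Hypotheses (r_gt0 : forall l, 0 < r l)
  (r_nested : forall l l' : 'I_n.+1, (l < l')%N -> r l' < r l).
Let k1 l := (k l).+1.
Let q := spec k a t 0.

Let q_ge0 := spec_ge0 k a t_ge0 t_le.

Let L_gt0 : (0 < L)%N. Proof. exact: leq_ltn_trans ltNL. Qed.

Let ent i j (z : 'rV[C]_n.+1) : C :=
  kappa (Zf z) * (Um L (val Y) (q ord0) (Zf z ord0) *m chainW N L q (Zf z)) i j.

(** The decoupled entry [ent] is continuous on the thickened contours and agrees with [rawD] at
    regular points, so its value at any point of the torus is the limit that defines [entryD]. *)
Lemma entryDE (i j : 'I_N) (z : 'rV[C]_n.+1) : tor r z -> entryD Y k1 a t i j z = ent i j z.
Proof.
move=> zr; have [e e0 nst] := fat_nested r_gt0 r_nested.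
set lo := fun l => r l - e; set hi := fun l => r l + e; rewrite -/lo -/hi in nst.
have [lo0 _] := nst.
have neq0 z' : ann lo hi z' -> forall l, z' 0 l != 0.
  by move=> az l; rewrite -nrm_gt0; apply: lt_le_trans (lo0 l) _; have /andP[] := az l.
have raw z' : ann lo hi z' -> regular N L z' -> rawD Y k1 a t i j z' = ent i j z'.
  move=> az rz; apply: rawDE => //; first exact: neq0.
  by move=> l l0; apply: (Zf_sep L_gt0 nst az); exact: predo_lt.
have az : ann lo hi z by apply: (fat_ann zr) => l; rewrite subrr nrm0.
rewrite /entryD; case: asboolP => [/(raw _ az)//|_].
have nent : nice lo hi (ent i j).
  apply: (niceM (kappa_nice ltNL nst)).
  apply: (nice_mulmx (fun i b => Um_nice ltNL hi (val Y) (lo0 ord0) (q_ge0 ord0) i b)).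
  exact: (chainW_nice ltNL hi lo0 q_ge0).
have PF : ProperFilter (within (@regular R N L n) (nbhs z)).
  apply: (@Build_ProperFilter _ _ _ (within_filter _ _)) => /= h.
  by have [z' rz /(_ rz)] := regular_dense N L_gt0 (neq0 _ az) h.
apply: (@cvg_lim _ (@Cplx_hausdorff R) _ _ PF).
apply/cvg_nrmP => eps eps0; have [d d0 H] := nent.2 _ eps0.
apply/nbhs_rowP; exists (Num.min d e); first by rewrite lt_min d0.
move=> z' h rz.
have az' : ann lo hi z'.
  by apply: (fat_ann zr) => l; have := h l; rewrite lt_min => /andP[].
rewrite raw //; apply: H => // l; have := h l; by rewrite lt_min => /andP[].
Qed.

Lemma chainS_prod m (q' : 'I_m.+1 -> pt R) (Z : 'I_m.+1 -> C) : chainS q' Z =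
  \prod_(l < m.+1 | (0 < l)%N)
    (Z l ^ (pk (q' l) - pk (q' (predo l))) / (1 - Z l / Z (predo l))).
Proof.
elim: m q' Z => [|m IH] q' Z; first by rewrite big_pred0 // => -[[]].
rewrite chainS_S IH.
exact/esym/(prod_pred (fun l l' => Z l ^ (pk (q' l) - pk (q' l')) / (1 - Z l / Z l'))).
Qed.

(** With Q = Z_l / Z_(l-1), each pair contributes -(Q - 1)^(N-1) (Q - 1)^(-N) = 1 / (1 - Q); the
    signs make up the factor (-1)^(m-1) of [calC]. *)
Lemma integrandE (z : 'rV[C]_n.+1) : tor r z ->
  calC N L k1 z * calD Y k1 a t z = Jint L (val Y) q (Zf z).
Proof.
move=> zr; have z0 l : z 0 l != 0.
  by rewrite -nrm_gt0; have /torP -> := zr; exact: r_gt0.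
have nst : nested r r by split=> //; split.
have zz (l : 'I_n.+1) : (0 < l)%N -> Zf z l != Zf z (predo l).
  by move=> l0; apply: (Zf_sep L_gt0 nst zr); exact: predo_lt.
rewrite /calD (_ : \matrix_(i, j) _ =
  kappa (Zf z) *: (Um L (val Y) (q ord0) (Zf z ord0) *m chainW N L q (Zf z))); last first.
  by apply/matrixP => i j; rewrite !mxE entryDE // /ent !mxE.
rewrite detZ /Jint /calC chainS_prod; set D := \det _.
have -> : (k1 ord_max - 1 = (q ord_max).1.1)%N by rewrite /k1 subn1.
have -> : z 0 ord0 ^+ ((k1 ord0 - 1) * L) = Zf z ord0 ^ pk (q ord0).
  by rewrite /k1 subn1 mulnC exprM.
have -> : (-1) ^+ n = \prod_(l < n.+1 | (0 < l)%N) (-1) :> C.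
  by rewrite big_mkcond big_ord_recl /= mul1r prodr_const card_ord.
set A := \prod_(l < _ | _) _; set B := \prod_(l < _ | _) _; set E := \prod_(l < _ | _) _.
suff e : A * B * kappa (Zf z) ^+ N = E by rewrite -e; ring.
rewrite /A /B /E /kappa -prodrXl -!big_split; apply: eq_bigr => l l0 /=.
have -> : z 0 l ^ (((k1 l)%:Z - (k1 (predo l))%:Z) * L%:Z) =
    Zf z l ^ (pk (q l) - pk (q (predo l))).
  by rewrite mulrC -exprz_exp /pk /k1 /=; congr (_ ^ _); lia.
rewrite expr_div_n -/(Zf z l) -/(Zf z (predo l)) subn1.
set Q := Zf z l / Zf z (predo l); set W := _ ^ _.
have Q1 : Q - 1 != 0.
  by rewrite subr_eq0 /Q; apply: contraNneq (zz l l0) => /divr1_eq ->.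
rewrite -[X in _^-1 ^+ X](prednK N_gt0) exprS exprVn.
have Qn : (Q - 1) ^+ N.-1 != 0 by rewrite expf_neq0.
have Q1' : 1 - Q != 0 by rewrite -opprB oppr_eq0.
by field; rewrite Qn Q1 Q1'.
Qed.

End Integrand.

Theorem theorem3p1 (R : realType) (N L : nat)
    (N_ge1 : (1 <= N)%N) (ltNL : (N < L)%N)
    (d : measure_display) (T : measurableType d) (P : probability T R)
    (Y : conf N L) (X : R -> T -> conf N L) (tasepX : is_tasep P Y X)
    (n : nat) (k : 'I_n.+1 -> 'I_N) (t : 'I_n.+1 -> R) (a : 'I_n.+1 -> int)
    (kt_distinct : injective (fun l => (k l, t l)))
    (t_ge0 : forall l, 0 <= t l)
    (t_le : forall l l' : 'I_n.+1, (l <= l')%N -> t l <= t l')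
    (r : 'I_n.+1 -> R) (r_gt0 : forall l, 0 < r l)
    (r_nested : forall l l' : 'I_n.+1, (l < l')%N -> r l' < r l) :
  let k1 := fun l => (k l).+1 in
  ((fine (P [set w | forall l, a l <= val (X (t l) w) (k l)]))%:C)%C
  = ointn r (fun z => calC N L k1 z * calD Y k1 a t z).
Proof.
move=> k1; have [mX X0 [p hp markov]] := tasepX.
have k_lt l : ((spec k a t 0 l).1.1 < N)%N by exact: ltn_ord.
rewrite -/(future X k a t) (prob_fval hp mX markov k a X0 t_ge0 t_le).
have -> := fval_vF N_ge1 ltNL hp k_lt (spec_ge0 k a t_ge0 t_le) r_gt0 r_nested Y.
by apply: (ointn_ext r_gt0) => z zr; rewrite -(integrandE N_ge1 ltNL Y k a t_ge0 t_le r_gt0 r_nested zr).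
Qed.
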